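(* Let $0<\varepsilon<1$. As $s\to0^+$, the functionals $\tilde F_s:X\to(-\infty,+\infty]$ $\Gamma$-converge to $F_0:X\to(-\infty,+\infty]$ (with respect to the topology of $L^1(\Omega)$ on $X$). That is, for every sequence $s_k\to0$ in $(0,1)$: (i) for every sequence $(u_k)\subset X$ with $u_k\to u\in X$ in $L^1(\Omega)$, $F_0(u)\le\liminf_{k\to\infty}\tilde F_{s_k}(u_k)$; (ii) for every $u\in X$ there is a sequence $(u_k)\subset X$ with $u_k\to u$ in $L^1(\Omega)$ and $F_0(u)\ge\limsup_{k\to\infty}\tilde F_{s_k}(u_k)$.
   Context: $d\ge1$, $\Omega\subset\mathbb R^d$ is a bounded domain with smooth enough boundary. $X=\{u\in L^\infty(\mathbb R^d):|u|\le1,\ u\equiv0\text{ in }\mathbb R^d\setminus\Omega\}$ with the norm $\|\cdot\|_{L^1(\Omega)}$. $\mathcal F$ is the Fourier transform, normalized so that Plancherel's identity $\|u\|_{L^2(\mathbb R^d)}=\|\mathcal F[u]\|_{L^2(\mathbb R^d)}$ holds. For $s\in(0,1)$, $|u|^2_{H^s(\mathbb R^d)}=\int_{\mathbb R^d}|\xi|^{2s}|\mathcal F[u](\xi)|^2\,d\xi$. With $W(u)=\frac{(u^2-1)^2}4$, $$F_s(u)=\frac{\varepsilon^2}2|u|^2_{H^s(\mathbb R^d)}+\int_\Omega W(u)\,dx,$$ and $F_s(u)=+\infty$ if $u\in X$ is not in $H^s(\mathbb R^d)$. Let $k_\varepsilon=W(\sqrt{1-\varepsilon^2})+\frac{\varepsilon^2}2(1-\varepsilon^2)$,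 which is the minimum value of $r\mapsto W(r)+\frac{\varepsilon^2}2r^2$, attained exactly at $r=\pm\sqrt{1-\varepsilon^2}$, and set $$\tilde F_s(u)=\frac1{2s}\Big(F_s(u)-\int_\Omega k_\varepsilon\,dx\Big).$$ The limit functional is $$F_0(u)=\frac{\varepsilon^2}2\int_{\mathbb R^d}\ln|\xi|\,|\mathcal F[u](\xi)|^2\,d\xi$$ if $u=\sqrt{1-\varepsilon^2}\,(I_E-I_{\Omega\setminus E})$ a.e. for some measurable $E\subset\Omega$ ($I$ denoting indicator functions; the value may be $+\infty$), and $F_0(u)=+\infty$ otherwise. *)

(* Defs.v *)
From HB Require Import structures.
From mathcomp Require Import all_boot all_order all_algebra.
From mathcomp Require Import all_classical all_reals all_analysis.
From mathcomp Require Import complex.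

Set Implicit Arguments.
Unset Strict Implicit.
Unset Printing Implicit Defensive.

Import Order.TTheory GRing.Theory Num.Theory.
Import numFieldNormedType.Exports.

Local Open Scope classical_set_scope.
Local Open Scope ring_scope.

Definition rV_display : measure_display.
Proof. exact: default_measure_display. Qed.

(* Same construction as the library's product sigma-algebra on n.-tuple T. *)
Section measurable_rV.
Context {R : realType} {n : nat}.

Let coord (i : 'I_n) (x : 'rV[R]_n) : measurableTypeR R := x ord0 i.

Let rV_set0 : g_sigma_preimage coord set0.
Proof. exact: sigma_algebra0. Qed.

Let rV_setC A : g_sigma_preimage coord A -> g_sigma_preimage coord (~` A).
Proof. exact: sigma_algebraC. Qed.

Let rV_bigcup (F : (set 'rV[R]_n)^nat) :
  (forall i, g_sigma_preimage coord (F i)) ->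
  g_sigma_preimage coord (\bigcup_i F i).
Proof. exact: sigma_algebra_bigcup. Qed.

HB.instance Definition _ := @isMeasurable.Build rV_display
  'rV[R]_n (g_sigma_preimage coord) rV_set0 rV_setC rV_bigcup.

Lemma measurable_coord (i : 'I_n) :
  measurable_fun [set: 'rV[R]_n] (fun x : 'rV[R]_n => x ord0 i : R).
Proof.
move=> _ Y mY; rewrite setTI; apply: sub_sigma_algebra => /=.
rewrite -bigcup_seq/=; exists i => /=; first by rewrite mem_index_enum.
by exists Y => //; rewrite setTI.
Qed.

Lemma measurable_fun_rV d (T : measurableType d) (f : T -> 'rV[R]_n) :
  (forall i, measurable_fun [set: T] (fun t => f t ord0 i : R)) ->
  measurable_fun [set: T] f.
Proof.
move=> mf.
have prefS : g_sigma_preimage (fun i => coord i \o f) `<=` measurable.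
  apply: smallest_sub; first exact: sigma_algebra_measurable.
  by move=> B; rewrite -bigcup_seq => -[i _ [C mC <-]]; exact: mf.
move=> _ A mA; apply: prefS; rewrite g_sigma_preimage_comp.
by exists A.
Qed.

End measurable_rV.

Section rV_cons.
Context {R : realType} {n : nat}.

Definition rV_cons (p : R * 'rV[R]_n) : 'rV[R]_n.+1 :=
  row_mx (p.1)%:M p.2 : 'rV[R]_(1 + n).
Definition rV_head (x : 'rV[R]_n.+1) : R := x ord0 ord0.
Definition rV_behead (x : 'rV[R]_n.+1) : 'rV[R]_n :=
  rsubmx (x : 'rV[R]_(1 + n)).

Lemma rV_consK p : (rV_head (rV_cons p), rV_behead (rV_cons p)) = p.
Proof.
case: p => a v; congr pair; last exact: row_mxKr.
rewrite /rV_head (_ : ord0 = lshift n (ord0 : 'I_1)); last exact/val_inj.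
by apply: etrans (row_mxEl _ _ _ _) _; rewrite mxE eqxx mulr1n.
Qed.

Lemma measurable_rV_cons :
  measurable_fun [set: measurableTypeR R * 'rV[R]_n] rV_cons.
Proof.
apply: measurable_fun_rV => i.
rewrite -(@splitK 1 n i); case: (fintype.split _) => j /=.
  rewrite (_ : (fun t => _) = fst); first exact: measurable_fst.
  apply/funext => -[a v]; apply: etrans (row_mxEl _ _ _ _) _.
  by rewrite (ord1 j) mxE.
rewrite (_ : (fun t => _) = (fun v : 'rV[R]_n => v ord0 j) \o snd).
  by apply: measurableT_comp; [exact: measurable_coord|exact: measurable_snd].
by apply/funext => -[a v]; exact: row_mxEr.
Qed.

Lemma measurable_rV_uncons :
  measurable_fun [set: 'rV[R]_n.+1]
    (fun x => (rV_head x : measurableTypeR R, rV_behead x)).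
Proof.
apply: measurable_fun_pair; first exact: measurable_coord.
apply: measurable_fun_rV => i.
rewrite (_ : (fun t => _) = (fun x : 'rV[R]_n.+1 => x ord0 (rshift 1 i))).
  exact: measurable_coord.
by apply/funext => x; rewrite mxE.
Qed.

End rV_cons.

Lemma sigma_finite_prod d1 d2 (T1 : measurableType d1) (T2 : measurableType d2)
    (R : realType) (m1 : {sigma_finite_measure set T1 -> \bar R})
    (m2 : {sigma_finite_measure set T2 -> \bar R}) :
  sigma_finite setT (m1 \x m2)%E.
Proof.
have /sigma_finiteP[F [TF ndF Foo]] := sigma_finiteT m1.
have /sigma_finiteP[G [TG ndG Goo]] := sigma_finiteT m2.
exists (fun k => F k `*` G k).
  rewrite -setXTT TF TG predeqE => -[x y]; split.
    move=> [/= [k _ Fkx] [l _ Gly]]; exists (maxn k l) => //; split.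
    - by move: x Fkx; exact/subsetPset/ndF/leq_maxl.
    - by move: y Gly; exact/subsetPset/ndG/leq_maxr.
  by move=> [k _ []/= ? ?]; split; exists k.
move=> k; have [? ?] := Foo k; have [? ?] := Goo k.
split; first exact: measurableX.
by rewrite product_measure1E// lte_mul_pinfty// ge0_fin_numE.
Qed.

Section lebesgue_rV_step.
Context {R : realType} {n : nat}.
Variable m : {sigma_finite_measure set 'rV[R]_n -> \bar R}.

Definition lebesgue_rV_step : set 'rV[R]_n.+1 -> \bar R :=
  pushforward ((@lebesgue_measure R) \x m)%E rV_cons.

Let step0 : lebesgue_rV_step set0 = 0%E.
Proof. by rewrite /lebesgue_rV_step /pushforward preimage_set0 measure0. Qed.

Let step_ge0 A : (0 <= lebesgue_rV_step A)%E.
Proof. by rewrite /lebesgue_rV_step /pushforward measure_ge0. Qed.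

Let step_sigma_additive : semi_sigma_additive lebesgue_rV_step.
Proof.
move=> F mF tF mUF; rewrite /lebesgue_rV_step /pushforward preimage_bigcup.
apply: measure_semi_sigma_additive.
- by move=> k; rewrite -[X in measurable X]setTI; exact: measurable_rV_cons.
- apply/trivIsetP => /= i j _ _ ij; rewrite -preimage_setI.
  by move/trivIsetP : tF => /(_ _ _ _ _ ij) ->//; rewrite preimage_set0.
- rewrite -preimage_bigcup -[X in measurable X]setTI.
  exact: measurable_rV_cons.
Qed.

HB.instance Definition _ := isMeasure.Build _ _ _ lebesgue_rV_step
  step0 step_ge0 step_sigma_additive.

Let step_sigma_finite : sigma_finite setT lebesgue_rV_step.
Proof.
have [F FT Foo] := sigma_finite_prod (@lebesgue_measure R) m.
pose psi (x : 'rV[R]_n.+1) := (rV_head x : measurableTypeR R, rV_behead x).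
exists (fun k => psi @^-1` F k).
  by rewrite -preimage_bigcup -FT preimage_setT.
move=> k; have [mF Fk] := Foo k; split.
  by rewrite -[X in measurable X]setTI; exact: measurable_rV_uncons.
rewrite /lebesgue_rV_step /pushforward -comp_preimage.
rewrite (_ : psi \o _ = id); first by rewrite preimage_id.
by apply/funext => p; exact: rV_consK.
Qed.

HB.instance Definition _ := Measure_isSigmaFinite.Build _ _ _ lebesgue_rV_step
  step_sigma_finite.

End lebesgue_rV_step.

Fixpoint lebesgue_rV {R : realType} (n : nat) :
    {sigma_finite_measure set 'rV[R]_n -> \bar R} :=
  if n is n'.+1 then lebesgue_rV_step (lebesgue_rV n') else \d_(0 : 'rV[R]_0).

Section euclidean.
Context {R : realType} {n : nat}.
Implicit Types (x y : 'rV[R]_n) (A : set 'rV[R]_n).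

Definition dotmul x y : R := \sum_(i < n) x ord0 i * y ord0 i.

(* The library norm `|x| of 'rV[R]_n is the sup norm. *)
Definition enorm x : R := Num.sqrt (dotmul x x).

Definition boundary A : set 'rV[R]_n := closure A `\` interior A.

End euclidean.

(* Near each boundary point, in suitable orthonormal coordinates, Omega is the
   region lying strictly above the graph of a Lipschitz function of the last n
   coordinates. *)
Definition lipschitz_boundary (R : realType) (n : nat)
    (Omega : set 'rV[R]_n.+1) : Prop :=
  forall x0, boundary Omega x0 ->
  exists (Q : 'M[R]_n.+1) (g : 'rV[R]_n -> R) (L : R),
    [/\ Q *m Q^T = 1%:M,
        forall y z, `|g y - g z| <= L * enorm (y - z) &
        \forall x \near x0,
          Omega x <-> g (rV_behead (x *m Q)) < rV_head (x *m Q)].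

Definition bounded_lipschitz_domain (R : realType) (n : nat)
    (Omega : set 'rV[R]_n.+1) : Prop :=
  [/\ Omega !=set0, open Omega, connected Omega, bounded_set Omega &
      lipschitz_boundary Omega].

(* Unitary normalization in angular frequency, F[u](xi) =
   (2 pi)^(-n/2) int exp(- i x.xi) u(x) dx, for integrable u. *)
Definition fourier (R : realType) (n : nat) (u : 'rV[R]_n -> R)
    (xi : 'rV[R]_n) : R[i] :=
  Complex
    ((Num.sqrt (2 * pi))^-1 ^+ n *
       \int[lebesgue_rV n]_x (cos (dotmul x xi) * u x))
    (- ((Num.sqrt (2 * pi))^-1 ^+ n *
       \int[lebesgue_rV n]_x (sin (dotmul x xi) * u x))).

Definition fourier_energy (R : realType) (n : nat) (u : 'rV[R]_n -> R)
    (xi : 'rV[R]_n) : R :=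
  ComplexField.Normc.normc (fourier u xi) ^+ 2.

Definition Hs_seminorm2 (R : realType) (n : nat) (s : R) (u : 'rV[R]_n -> R) :
    \bar R :=
  (\int[lebesgue_rV n]_xi ((enorm xi `^ (2 * s)) * fourier_energy u xi)%:E)%E.

Section functionals.
Context {R : realType} {n : nat}.
Implicit Types (u v : 'rV[R]_n -> R) (Omega : set 'rV[R]_n) (s eps r : R).

(* Elements are representatives, so all the conditions are imposed up to a
   null set. *)
Definition space_X Omega : set ('rV[R]_n -> R) :=
  [set u : 'rV[R]_n -> R | [/\ measurable_fun setT u,
    {ae lebesgue_rV n, forall x, `|u x| <= 1} &
    {ae lebesgue_rV n, forall x, ~ Omega x -> u x = 0}]].

Definition L1_cvg Omega (u_ : nat -> 'rV[R]_n -> R) u : Prop :=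
  (\int[lebesgue_rV n]_(x in Omega) `|u_ k x - u x|%:E)%E @[k --> \oo] --> 0%E.

Definition W r : R := (r ^+ 2 - 1) ^+ 2 / 4.

(* This is +oo when u in X does not belong to H^s, because the seminorm is
   then infinite and the second integral is nonnegative. *)
Definition F_s Omega eps s u : \bar R :=
  ((eps ^+ 2 / 2)%:E * Hs_seminorm2 s u +
   \int[lebesgue_rV n]_(x in Omega) (W (u x))%:E)%E.

Definition k_ eps : R :=
  W (Num.sqrt (1 - eps ^+ 2)) + eps ^+ 2 / 2 * (1 - eps ^+ 2).

Definition Ftilde_s Omega eps s u : \bar R :=
  ((2 * s)^-1%:E *
   (F_s Omega eps s u - \int[lebesgue_rV n]_(x in Omega) (k_ eps)%:E))%E.

Definition two_phase Omega eps u : Prop :=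
  exists E : set 'rV[R]_n,
    [/\ measurable E, E `<=` Omega &
        {ae lebesgue_rV n, forall x,
          u x = Num.sqrt (1 - eps ^+ 2) * (\1_E x - \1_(Omega `\` E) x)}].

(* The library integral is the integral of the positive part minus that of the
   negative part. *)
Definition F_0 Omega eps u : \bar R :=
  if `[< two_phase Omega eps u >] then
    ((eps ^+ 2 / 2)%:E *
     \int[lebesgue_rV n]_xi (ln (enorm xi) * fourier_energy u xi)%:E)%E
  else +oo%E.

End functionals.

(* Sequential Gamma-convergence on the subset X of T, with respect to a notion
   of convergence of sequences on T. *)
Definition Gamma_cvg (R : realType) (T : Type) (X : set T)
    (cvgT : (nat -> T) -> T -> Prop)
    (F_ : nat -> T -> \bar R) (F : T -> \bar R) : Prop :=
  (forall (u_ : nat -> T) (u : T), (forall k, X (u_ k)) -> X u -> cvgT u_ u ->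
     (F u <= limn_einf (fun k => F_ k (u_ k)))%E) /\
  (forall u : T, X u -> exists u_ : nat -> T,
     [/\ forall k, X (u_ k), cvgT u_ u &
         (limn_esup (fun k => F_ k (u_ k)) <= F u)%E]).

(* Main.v *)
Require Import Defs.
From mathcomp Require Import all_boot all_order all_algebra.
From mathcomp Require Import all_classical all_reals all_analysis measurable_realfun.
From mathcomp Require Import complex ring lra.
Set Implicit Arguments.
Unset Strict Implicit.
Unset Printing Implicit Defensive.
Import Order.TTheory GRing.Theory Num.Theory.
Import numFieldNormedType.Exports.
Local Open Scope classical_set_scope.
Local Open Scope ring_scope.

(** On the Fourier side the two functionals become comparable term by term.
    Let E_u be the energy density of u and V(u) the integral over Omega of
    (u^2 - (1 - eps^2))^2 / 4. Since W(r) + eps^2/2 r^2 - k_eps is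
    (r^2 - (1 - eps^2))^2 / 4, Plancherel's identity (lemma plancherel) turns
    the quadratic term into the integral of E_u and gives (Ftilde_identity)

      Ftilde_s(u) = eps^2/2 * int m_s E_u + V(u) / (2 s),
      m_s(xi) = (|xi|^(2s) - 1) / (2 s).

    Here m_s >= ln|xi| and m_s tends to ln|xi| as s -> 0, while a nonzero limit
    of V forces the value +oo; and V(u) = 0 says exactly that u takes its values
    in the two wells.

    Neither functional takes the value -oo, because E_u is bounded and the
    negative part of ln|xi| is integrable.

    Lower bound (F0_le_liminf). If u_k -> u in L^1 with uniformly bounded values
    and supports, then E_(u_k) converges pointwise and stays bounded. The
    negative part of ln|xi| is integrable, so its contribution converges by
    dominated convergence; the positive part is treated by Fatou's lemma. If
    V(u) > 0, then V(u_k) / (2 s_k) tends to +oo.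

    Upper bound (recovery_sequence). Only a two-phase u whose energy is
    integrable against the positive part of the logarithm needs an argument.
    Such a u may have infinite H^s seminorm for every s > 0, so it has to be
    regularized. Averaging at scale d would spill out of Omega; the Lipschitz
    boundary gives a partition of unity eta_i and directions e_i
    (inward_partition) such that averaging eta_i u over small cubes shifted by
    d e_i stays inside Omega, and u_d is the sum of these averages. Three facts
    make it admissible and cheap.
    - The eta_i are Lipschitz and the wells have modulus less than 1, so
      |u_d| <= 1 for small d (smooth_pointwise_X).
    - V(u_d) is at most the integral of (u_d - u)^2. The symbol of one average
      differs from 1 by a quantity whose square, times ln(1/d), is bounded by a
      multiple of 1 + ln^+|xi| (gap_log) and tends to 0. As each eta_i u also has
      finite logarithmic energy (log_finite_mul), ln(1/d) times the integral of
      (u_d - u)^2 tends to 0 (defect_cvg). One can thus let d depend on s with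
      s ln(1/d) -> 0 so slowly that V(u_d) / s -> 0 (scale_selection).
    - As long as s ln(1/d) <= 1, the factor |xi|^(2s) is bounded for
      |xi| <= 1/d, and for larger xi the decay of the symbol of the average
      compensates it (damp_exp). So m_s E_(u_d) is dominated by a fixed
      integrable function, and the integrals converge to that of ln|xi| E_u. *)

(** * Real-valued integrals and changes of variable on the line *)

Section real_fubini.
Context d1 d2 (T1 : measurableType d1) (T2 : measurableType d2) (R : realType).
Variables (m1 : {sigma_finite_measure set T1 -> \bar R}).
Variables (m2 : {sigma_finite_measure set T2 -> \bar R}).
Variables (f : T1 -> T2 -> R) (g : T1 -> R) (h : T2 -> R).
Hypothesis mf : measurable_fun setT (fun z : T1 * T2 => f z.1 z.2).
Hypothesis ig : m1.-integrable setT (EFin \o g).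
Hypothesis ih : m2.-integrable setT (EFin \o h).
Hypothesis fgh : forall x y, `|f x y| <= g x * h y.

Lemma prod_dom_integrable1 x : m2.-integrable setT (EFin \o f x).
Proof.
have := integrableZl measurableT (g x) ih; apply: le_integrable => //.
  apply/measurable_EFinP; exact: measurable_fun_pair2 mf.
move=> y _ /=; rewrite lee_fin; exact: le_trans (ler_norm _).
Qed.

Lemma prod_dom_integrable2 y : m1.-integrable setT (EFin \o f^~ y).
Proof.
have := integrableZl measurableT (h y) ig; apply: le_integrable => //.
  apply/measurable_EFinP; exact: measurable_fun_pair1 mf.
move=> x _ /=; rewrite lee_fin mulrC; exact: le_trans (ler_norm _).
Qed.

Lemma prod_dom_integrable :
  (m1 \x m2)%E.-integrable setT (fun z => (f z.1 z.2)%:E).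
Proof.
apply/integrable12ltyP; first exact/measurable_EFinP.
have [/measurable_EFinP mg goo] := integrableP _ _ _ ig.
have [/measurable_EFinP mh hoo] := integrableP _ _ _ ih.
have mhn : measurable_fun setT (fun y => `|h y|%:E).
  by apply/measurable_EFinP; exact: measurableT_comp.
have mgn : measurable_fun setT (fun x => `|g x|%:E).
  by apply/measurable_EFinP; exact: measurableT_comp.
have mfn : measurable_fun setT (fun z : T1 * T2 => `|f z.1 z.2|%:E).
  by apply/measurable_EFinP; exact: measurableT_comp.
apply: (@le_lt_trans _ _ (\int[m1]_x (`|g x|%:E * \int[m2]_y `|h y|%:E))%E).
  apply: ge0_le_integral => //=.
  - by move=> x _; apply: integral_ge0.
  - exact: (measurable_fun_fubini_tonelli_F (fun z => `|f z.1 z.2|%:E)).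
  - exact: emeasurable_funM.
  move=> x _; rewrite -ge0_integralZl//=.
  apply: ge0_le_integral => //.
  - exact: measurable_fun_pair2 mfn.
  - exact: emeasurable_funM.
  - move=> y _; rewrite -EFinM lee_fin -normrM.
    exact: le_trans (ler_norm _).
rewrite ge0_integralZr//=; last exact: integral_ge0.
apply: lte_mul_pinfty => //; first exact: integral_ge0.
by rewrite ge0_fin_numE//; exact: integral_ge0.
Qed.

(** Under a product majorant every section is integrable, so real-valued
    iterated integrals make sense at every point and not only almost
    everywhere. *)
Lemma Rfubini_dom :
  \int[m1]_x \int[m2]_y f x y = \int[m2]_y \int[m1]_x f x y.
Proof.
rewrite /Rintegral; congr fine.
transitivity (\int[m1]_x \int[m2]_y (f x y)%:E)%E.
  apply: eq_integral => x _; rewrite fineK//.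
  exact: integrable_fin_num (prod_dom_integrable1 x).
rewrite (@Fubini _ _ _ _ _ m1 m2 (fun z => (f z.1 z.2)%:E)%E); last first.
  exact: prod_dom_integrable.
apply: eq_integral => y _; rewrite fineK//.
exact: integrable_fin_num (prod_dom_integrable2 y).
Qed.

Lemma Rfubini_integrable :
  m1.-integrable setT (EFin \o (fun x => \int[m2]_y f x y)).
Proof.
have := integrable_fubini_F prod_dom_integrable; apply: eq_integrable => //.
move=> x _; rewrite /fubini_F/= /Rintegral fineK//.
exact: integrable_fin_num (prod_dom_integrable1 x).
Qed.

End real_fubini.

Section real_dct.
Context d (T : measurableType d) (R : realType).
Variable mu : {measure set T -> \bar R}.

Lemma Rdominated_cvg (f_ : nat -> T -> R) (f g : T -> R) :
  (forall k, measurable_fun setT (f_ k)) -> measurable_fun setT f ->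
  {ae mu, forall x, f_ ^~ x @ \oo --> f x} ->
  mu.-integrable setT (EFin \o g) ->
  (forall k x, `|f_ k x| <= g x) ->
  mu.-integrable setT (EFin \o f) /\
  (\int[mu]_x f_ k x @[k --> \oo] --> \int[mu]_x f x).
Proof.
move=> mf_ mf ff ig fg.
have ffe : {ae mu, forall x, setT x -> (fun k => (f_ k x)%:E) @ \oo --> (f x)%:E}.
  by move: ff; apply: filterS => x + _ => fx; apply: cvg_EFin => //; exact: nearW.
have fge : {ae mu, forall x k, setT x -> (`|(f_ k x)%:E| <= (g x)%:E)%E}.
  by apply: aeW => x k _; rewrite /= lee_fin.
have mfe k : measurable_fun setT (fun x => (f_ k x)%:E).
  exact/measurable_EFinP.
have [] := dominated_convergence measurableT mfe _ ffe ig fge.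
  exact/measurable_EFinP.
move=> i1 _ i3; split => //; apply: fine_cvg.
by rewrite /Rintegral fineK; [exact: i3|exact: integrable_fin_num i1].
Qed.

Lemma EFin_Rintegral (f : T -> R) : mu.-integrable setT (EFin \o f) ->
  ((\int[mu]_x f x)%:E = \int[mu]_x (f x)%:E)%E.
Proof. by move=> h; rewrite /Rintegral fineK//; exact: integrable_fin_num h. Qed.

Lemma RintegrableD (f g : T -> R) : mu.-integrable setT (EFin \o f) ->
  mu.-integrable setT (EFin \o g) ->
  mu.-integrable setT (EFin \o (fun x => f x + g x)).
Proof. by move=> If Ig; exact: (integrableD measurableT If Ig). Qed.

Lemma RintegrableZ (c : R) (f : T -> R) : mu.-integrable setT (EFin \o f) ->
  mu.-integrable setT (EFin \o (fun x => c * f x)).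
Proof. by move=> If; exact: (integrableZl measurableT c If). Qed.

Lemma RintegrableB (f g : T -> R) : mu.-integrable setT (EFin \o f) ->
  mu.-integrable setT (EFin \o g) ->
  mu.-integrable setT (EFin \o (fun x => f x - g x)).
Proof. by move=> If Ig; exact: (integrableB measurableT If Ig). Qed.

Lemma le_Rintegrable (f g : T -> R) : measurable_fun setT f ->
  (forall x, `|f x| <= g x) -> mu.-integrable setT (EFin \o g) ->
  mu.-integrable setT (EFin \o f).
Proof.
move=> mf fg; apply: le_integrable => //; first exact/measurable_EFinP.
by move=> x _ /=; rewrite lee_fin; exact: le_trans (ler_norm _).
Qed.

End real_dct.

Section affine1.
Context {R : realType}.
Notation leb := (@lebesgue_measure R).

Lemma measurable_affine1 (s b : R) :
  measurable_fun setT (fun x : measurableTypeR R => s * x + b : measurableTypeR R).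
Proof. by apply: measurable_funD => //; exact: measurable_funM. Qed.

Let aff (s b : R) := (fun x : measurableTypeR R => s * x + b : measurableTypeR R).

Let aff_measure (s b : R) (s0 : 0 <= s) : {measure set (measurableTypeR R) -> \bar R} :=
  mscale (NngNum s0)
   (measure_function_pushforward__canonical__measure_function_Measure
      leb (measurable_affine1 s b)).

(** Lebesgue measure is determined by its values on half-open intervals, which
    the pushforward by an affine map rescales by 1/s. *)
Let lebesgue_affine (s b : R) (s0 : 0 < s) (A : set (measurableTypeR R)) :
  measurable A -> leb A = aff_measure b (ltW s0) A.
Proof.
move=> mA; rewrite [LHS](@lebesgue_measure_unique _ (aff_measure b (ltW s0)))//.
move=> _ [[x y]] _ <-; rewrite /aff_measure /= /mscale/= /pushforward.
have -> : (aff s b @^-1` [set` `]x, y]%R]) = [set` `](x - b)/s, (y - b)/s]%R].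
  apply/seteqP; split => z /=; rewrite !in_itv/= /aff => /andP[];
  by rewrite ?ltr_pdivrMr// ?ler_pdivlMr// ltrBlDr lerBrDr mulrC => -> ->.
rewrite !lebesgue_measure_itv/= !lte_fin ltr_pM2r ?invr_gt0// ltrD2r.
case: ifPn => xy; last by rewrite mule0.
rewrite -!EFinB -EFinM; congr EFin; field; exact: lt0r_neq0.
Qed.

Lemma integral_affine1 (s b : R) (s0 : 0 < s) (f : R -> \bar R) :
  measurable_fun setT f -> (forall x, 0 <= f x)%E ->
  (\int[leb]_x f (s * x + b)%R = s^-1%:E * \int[leb]_x f x)%E.
Proof.
move=> mf f0.
have -> : (\int[leb]_x f x = \int[aff_measure b (ltW s0)]_x f x)%E.
  by apply: eq_measure_integral => A mA _; rewrite -(lebesgue_affine b s0 mA).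
rewrite ge0_integral_mscale//= muleA -EFinM mulVf ?mul1e ?lt0r_neq0//.
rewrite ge0_integral_pushforward//=.
exact: measurable_affine1.
Qed.

End affine1.

(** * Integration one coordinate at a time *)

Section rV_measurability.
Context {R : realType} {n : nat}.
Local Notation V := 'rV[R]_n.

Lemma measurable_coordT d (T : measurableType d) (f : T -> V) (i : 'I_n) :
  measurable_fun setT f -> measurable_fun setT (fun t => f t ord0 i : R).
Proof. by move=> mf; exact: (measurableT_comp (measurable_coord i) mf). Qed.

Lemma measurable_rVD d (T : measurableType d) (f g : T -> V) :
  measurable_fun setT f -> measurable_fun setT g ->
  measurable_fun setT (fun t => f t + g t).
Proof.
move=> mf mg; apply: measurable_fun_rV => i.
under eq_fun do rewrite mxE.
by apply: measurable_funD; exact: measurable_coordT.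
Qed.

Lemma measurable_rVZ d (T : measurableType d) (c : R) (f : T -> V) :
  measurable_fun setT f -> measurable_fun setT (fun t => c *: f t).
Proof.
move=> mf; apply: measurable_fun_rV => i.
under eq_fun do rewrite mxE.
by apply: measurable_funM => //; exact: measurable_coordT.
Qed.

Lemma measurable_dotmul d (T : measurableType d) (f g : T -> V) :
  measurable_fun setT f -> measurable_fun setT g ->
  measurable_fun setT (fun t => dotmul (f t) (g t)).
Proof.
move=> mf mg; rewrite /dotmul; apply: measurable_sum => i.
by apply: measurable_funM; exact: measurable_coordT.
Qed.

Lemma measurable_enorm d (T : measurableType d) (f : T -> V) :
  measurable_fun setT f -> measurable_fun setT (fun t => enorm (f t)).
Proof.
move=> mf; rewrite /enorm.
apply: (@measurableT_comp _ _ _ _ _ _ (@Num.sqrt R)).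
  by apply: continuous_measurable_fun; exact: sqrt_continuous.
exact: measurable_dotmul.
Qed.

Lemma measurable_prod_coord (g : 'I_n -> R -> R) :
  (forall i, measurable_fun setT (g i)) ->
  measurable_fun setT (fun x : V => \prod_(i < n) g i (x ord0 i)).
Proof.
move=> mg; apply: measurable_prod => i _.
by apply: measurableT_comp => //; exact: measurable_coord.
Qed.

End rV_measurability.

Section rV_integral.
Context {R : realType}.
Notation leb := (@lebesgue_measure R).

Lemma integral_rV0 (f : 'rV[R]_0 -> \bar R) :
  (\int[lebesgue_rV 0]_x f x = f 0%R)%E.
Proof.
have mf : measurable_fun setT f.
  move=> _ Y _; rewrite setTI.
  have [f0|f0] := pselect (Y (f 0)).
    have -> : f @^-1` Y = setT by apply/seteqP; split => x //= _; rewrite (thinmx0 x).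
    exact: measurableT.
  have -> : f @^-1` Y = set0 by apply/seteqP; split => x //=; rewrite (thinmx0 x).
  exact: measurable0.
by rewrite integral_dirac//= diracE mem_set// mul1e.
Qed.

Lemma integral_rVS n (f : 'rV[R]_n.+1 -> \bar R) :
  measurable_fun setT f -> (forall x, 0 <= f x)%E ->
  (\int[lebesgue_rV n.+1]_x f x =
   \int[leb]_a \int[lebesgue_rV n]_y f (rV_cons (a, y)))%E.
Proof.
move=> mf f0.
have := @ge0_integral_pushforward _ _ (measurableTypeR R * 'rV[R]_n)%type _ R (@rV_cons R n) measurable_rV_cons
  (leb \x lebesgue_rV n)%E setT f measurableT mf (fun y _ => f0 y).
rewrite preimage_setT => E; apply: etrans E _.
have := @fubini_tonelli1 _ _ (measurableTypeR R) 'rV[R]_n R leb (lebesgue_rV n)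
  (f \o @rV_cons R n) _ (fun x => f0 (rV_cons x)).
apply; by apply: measurableT_comp => //; exact: measurable_rV_cons.
Qed.

Lemma measurable_integral_rV_cons n (f : 'rV[R]_n.+1 -> \bar R) :
  measurable_fun setT f -> (forall x, 0 <= f x)%E ->
  measurable_fun setT (fun a : measurableTypeR R =>
     \int[lebesgue_rV n]_y f (rV_cons (a, y)))%E.
Proof.
move=> mf f0; apply: (measurable_fun_fubini_tonelli_F (f \o @rV_cons R n)) => //=.
by apply: measurableT_comp => //; exact: measurable_rV_cons.
Qed.

Lemma measurable_rV_cons2 n (a : R) :
  measurable_fun setT (fun y : 'rV[R]_n => rV_cons (a, y)).
Proof.
exact: (measurable_fun_pair2 (a : measurableTypeR R) (@measurable_rV_cons R n)).
Qed.

Lemma rV_cons_head n (a : R) (y : 'rV[R]_n) : rV_cons (a, y) ord0 ord0 = a.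
Proof. by have [] := rV_consK (a, y). Qed.

Lemma rV_cons_lift n (a : R) (y : 'rV[R]_n) i :
  rV_cons (a, y) ord0 (lift ord0 i) = y ord0 i.
Proof.
rewrite (_ : lift ord0 i = rshift 1 i); last exact/val_inj.
exact: row_mxEr.
Qed.

Lemma rV_cons_affine n (s : R) (h : 'rV[R]_n.+1) a (y : 'rV[R]_n) :
  s *: rV_cons (a, y) + h = rV_cons (s * a + rV_head h, s *: y + rV_behead h).
Proof.
apply/rowP => i; rewrite mxE mxE.
case: (unliftP ord0 i) => [j|] ->; last by rewrite !rV_cons_head.
rewrite !rV_cons_lift mxE mxE; congr (_ + _).
by rewrite /rV_behead mxE; congr (h _ _); exact/val_inj.
Qed.

(** Translations and dilations are treated at once because both reduce, one
    coordinate at a time, to the line. *)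
Lemma integral_affine_rV n (s : R) (h : 'rV[R]_n) (f : 'rV[R]_n -> \bar R) :
  0 < s -> measurable_fun setT f -> (forall x, 0 <= f x)%E ->
  (\int[lebesgue_rV n]_x f (s *: x + h)%R =
   (s^-1 ^+ n)%:E * \int[lebesgue_rV n]_x f x)%E.
Proof.
move=> s0; elim: n h f => [|n IH] h f mf f0.
  by rewrite !integral_rV0 expr0 mul1e (thinmx0 (_ + _)).
have mA : measurable_fun setT (fun x : 'rV[R]_n.+1 => s *: x + h).
  by apply: measurable_rVD => //; exact: measurable_rVZ.
rewrite !integral_rVS//; last exact: (measurableT_comp mf mA).
under eq_integral => a _.
  under eq_integral do rewrite rV_cons_affine.
  rewrite (IH (rV_behead h) (fun y => f (rV_cons (s * a + rV_head h, y))))//; last first.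
    by apply: (measurableT_comp mf); exact: measurable_rV_cons2.
  over.
have mI := measurable_integral_rV_cons mf f0.
have I0 a : (0 <= \int[lebesgue_rV n]_y f (rV_cons (a, y)))%E by exact: integral_ge0.
have mIa : measurable_fun setT (fun a : measurableTypeR R =>
    \int[lebesgue_rV n]_y f (rV_cons ((s * a + rV_head h)%R, y)))%E.
  exact: (measurableT_comp mI (measurable_affine1 s (rV_head h))).
have k0 : (0 <= (s^-1 ^+ n)%:E)%E by rewrite lee_fin exprn_ge0// invr_ge0 ltW.
transitivity ((s^-1 ^+ n)%:E * \int[leb]_a
    \int[lebesgue_rV n]_y f (rV_cons ((s * a + rV_head h)%R, y)))%E.
  by apply: (ge0_integralZl leb measurableT mIa) => // a _; exact: I0.
transitivity ((s^-1 ^+ n)%:E * (s^-1%:E * \int[leb]_a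
    \int[lebesgue_rV n]_y f (rV_cons (a, y))))%E.
  by congr (_ * _)%E; exact: (integral_affine1 (rV_head h) s0 mI I0).
by rewrite muleA -EFinM -exprSr.
Qed.

Lemma integral_prod_rV n (g : 'I_n -> R -> R) :
  (forall i, leb.-integrable setT (EFin \o g i)) -> (forall i x, 0 <= g i x) ->
  (\int[lebesgue_rV n]_x (\prod_(i < n) g i (x ord0 i))%:E =
    (\prod_(i < n) \int[leb]_t g i t)%R%:E)%E.
Proof.
elim: n g => [|n IH] g ig g0; first by rewrite integral_rV0 !big_ord0.
have mg i : measurable_fun setT (g i).
  by apply/measurable_EFinP; have /integrableP[] := ig i.
have mP := measurable_prod_coord mg.
have P0 x : 0 <= \prod_(i < n.+1) g i (x i) by apply: prodr_ge0.
rewrite integral_rVS; [|exact/measurable_EFinP|by move=> x; rewrite lee_fin].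
have J0 : 0 <= \prod_(i < n) \int[leb]_t g (lift ord0 i) t.
  by apply: prodr_ge0 => i _; apply: Rintegral_ge0.
under eq_integral => a _.
  under eq_integral => y _.
    rewrite big_ord_recl rV_cons_head.
    under eq_bigr do rewrite rV_cons_lift.
    rewrite EFinM; over.
  rewrite ge0_integralZl//=; last 3 first.
    by apply/measurable_EFinP; apply: (@measurable_prod_coord R n (fun i => g (lift ord0 i))).
    by move=> x _; rewrite lee_fin; apply: prodr_ge0.
    by rewrite lee_fin.
  rewrite (IH (fun i => g (lift ord0 i)))//; over.
rewrite ge0_integralZr//=; last 2 first.
- by have /integrableP[] := ig ord0.
- by move=> x _; rewrite lee_fin.
by rewrite big_ord_recl EFinM EFin_Rintegral.
Qed.

End rV_integral.

(** * Cubes, and Borel sets of row vectors *)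

Section rV_topology.
Context {R : realType} {n : nat}.
Local Notation V := 'rV[R]_n.

Lemma rV_norm_coord (x : V) i : `|x ord0 i| <= `|x|.
Proof.
have -> : `|x| = mx_norm x by [].
by rewrite mx_normrE; exact: (le_bigmax _ (fun ij => `|x ij.1 ij.2|) (ord0, i)).
Qed.

Lemma rV_norm_le (x : V) (M : R) : 0 <= M -> (forall i, `|x ord0 i| <= M) -> `|x| <= M.
Proof.
move=> M0 xM; have -> : `|x| = mx_norm x by [].
by rewrite mx_normrE; apply/bigmax_leP; split => //= -[i j] _; rewrite (ord1 i).
Qed.

Definition cube (M : R) : set V := [set x | forall i, `|x ord0 i| <= M].

Lemma indic_cube M x :
  \1_(cube M) x = \prod_(i < n) \1_(`[- M, M]%classic : set R) (x ord0 i) :> R.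
Proof.
rewrite indicE; have [xM|xM] := boolP (x \in cube M).
  rewrite big1// => i _; rewrite indicE mem_set//= in_itv/= -ler_norml.
  by move: xM; rewrite inE; exact.
have [i xi] : exists i, ~ `|x ord0 i| <= M.
  by apply/existsNP => h; move/negP: xM; apply; rewrite inE.
by rewrite (bigD1 i)//= indicE memNset ?mul0r//= in_itv/= -ler_norml.
Qed.

Lemma measurable_cube M : measurable (cube M).
Proof.
have -> : cube M = \bigcap_(i : 'I_n) [set x | `|x ord0 i| <= M].
  by apply/seteqP; split => x /= h i => [_|]; apply: h.
apply: fin_bigcap_measurable => [|i _]; first exact: finite_finset.
have -> : (fun x : V => is_true (`|x ord0 i| <= M)) =
    (fun x : V => `|x ord0 i|) @^-1` `]-oo, M].
  by apply/seteqP; split => x /=; rewrite in_itv.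
rewrite -[X in measurable X]setTI.
have mN : measurable_fun setT (fun x : V => `|x ord0 i|).
  exact: (measurableT_comp (@normr_measurable R setT) (measurable_coord i)).
exact: mN.
Qed.

Lemma integral_indic_cube M :
  (\int[lebesgue_rV n]_x (\1_(cube M) x)%:E < +oo)%E.
Proof.
under eq_integral do rewrite indic_cube.
rewrite (@integral_prod_rV _ _ (fun=> \1_(`[- M, M]%classic : set R))) ?ltry// => i.
exact: integrable_indic_itv.
Qed.

Lemma integrable_indic_cube M :
  (lebesgue_rV n).-integrable setT (EFin \o \1_(cube M)).
Proof.
apply/integrableP; split.
  by apply/measurable_EFinP; apply: measurable_indic; exact: measurable_cube.
apply: le_lt_trans (integral_indic_cube M).
by under eq_integral do rewrite /= ger0_norm//.
Qed.

Lemma rational_cube_approx (O : set V) x : open O -> O x ->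
  exists (q : 'rV[rat]_n) (k : nat),
  cube k.+1%:R^-1 (x - map_mx ratr q) /\
  (forall y, cube k.+1%:R^-1 (y - map_mx ratr q) -> O y).
Proof.
move=> oO Ox; have [e/= e0 eO] : exists2 e : R, 0 < e & ball x e `<=` O.
  by have /nbhs_ballP[e e0 eO] := oO x Ox; exists e.
have [k ke] : exists k : nat, k.+1%:R^-1 < e / 2.
  have e20 : 0 < e / 2 by rewrite divr_gt0.
  have [k _ hk] := near_infty_natSinv_lt (PosNum e20).
  by exists k; exact: (hk k (leqnn k)).
move: ke; set d := k.+1%:R^-1 => ke.
have d0 : 0 < d by rewrite invr_gt0.
have /choice[q qx] i : exists q : rat, ratr q \in `](x ord0 i - d)%R, (x ord0 i + d)%R[.
  by apply: rat_in_itvoo; rewrite ltrBlDr -addrA ltrDl addr_gt0.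
exists (\row_i q i), k; rewrite -/d; move: d ke d0 qx => d ke d0 qx.
split => [i|y yq].
  rewrite !mxE; have := qx i; rewrite in_itv/= => /andP[h1 h2].
  by rewrite ler_norml; apply/andP; split; lra.
apply: eO; rewrite -ball_normE/=.
apply: (@le_lt_trans _ _ (d + d)); last first.
  by rewrite [ltRHS](splitr e); exact: ltrD.
apply: rV_norm_le => [|i]; first by rewrite addr_ge0// ltW.
have := yq i; have := qx i; rewrite in_itv/= !mxE => /andP[h1 h2].
by rewrite !ler_norml => /andP[h3 h4]; apply/andP; split; lra.
Qed.

(** Open sets are countable unions of cubes with rational centres, and a cube
    is a finite intersection of preimages under the coordinates. *)
Lemma measurable_open (O : set V) : open O -> measurable O.
Proof.
move=> oO.
pose F (z : 'rV[rat]_n * nat) : set V :=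
  [set x | cube z.2.+1%:R^-1 (x - map_mx ratr z.1) /\
   (forall y, cube z.2.+1%:R^-1 (y - map_mx ratr z.1) -> O y)].
have -> : O = \bigcup_z F z.
  apply/seteqP; split => [x Ox|x [z _] [] hx]; last exact.
  have [q [k h]] := rational_cube_approx oO Ox.
  by exists (q, k).
apply: countable_bigcupT_measurable => [|[q k]]; first exact: countableP.
rewrite /F /=.
have [h|h] := pselect (forall y : V, cube k.+1%:R^-1 (y - map_mx ratr q) -> O y).
  rewrite (_ : [set x | _] = (fun x : V => 1 *: x + - map_mx ratr q) @^-1` cube k.+1%:R^-1); last first.
    by apply/seteqP; split => x /=; rewrite scale1r => //; case.
  rewrite -[X in measurable X]setTI.
  apply: measurable_rVD => //; [exact: measurable_rVZ|exact: measurable_cube].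
by rewrite (_ : [set x | _] = set0)//; apply/seteqP; split => x //= [].
Qed.

Lemma continuous_measurable_rV (f : V -> R) : continuous f -> measurable_fun setT f.
Proof.
move=> cf; apply: (measurability _ (RGenOInfty.measurableE R)) => //.
move=> _ [_ [a ->] <-]; rewrite setTI; apply: measurable_open.
by apply: open_comp => // x _; exact: cf.
Qed.

End rV_topology.

(** * Bounded functions with bounded support *)

Section bcs.
Context {R : realType} {n : nat}.
Local Notation V := 'rV[R]_n.
Local Notation mu := (@lebesgue_rV R n).

(** Bounded, with bounded support. A single M serves as bound and as
    half-width of the support, so that products, sums and translates are
    controlled by one number. *)
Definition bcs (u : V -> R) := measurable_fun setT u /\
  exists2 M, 0 < M & forall x, `|u x| <= M * \1_(cube M) x.

Lemma indic_cube_ge0 M (x : V) : 0 <= \1_(cube M) x :> R.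
Proof. by rewrite indicE. Qed.

Lemma le_indic_cube M M' (x : V) : M <= M' ->
  \1_(cube M) x <= \1_(cube M') x :> R.
Proof.
move=> MM; rewrite !indicE; case: (boolP (x \in cube M)) => //= xM.
rewrite mem_set// => i; apply: le_trans MM.
by move: xM; rewrite inE; exact.
Qed.

Lemma bcs_bound (u : V -> R) M : 0 < M -> (forall x, `|u x| <= M * \1_(cube M) x) ->
  forall M' x, M <= M' -> `|u x| <= M' * \1_(cube M') x.
Proof.
move=> M0 uM M' x MM; apply: le_trans (uM x) _.
by apply: ler_pM => //; [exact: ltW|exact: le_indic_cube].
Qed.

Lemma measurable_indic_cube M : measurable_fun setT (\1_(cube M) : V -> R).
Proof. by apply: measurable_indic; exact: measurable_cube. Qed.

Lemma bcs_measurable u : bcs u -> measurable_fun setT u.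
Proof. by case. Qed.

Lemma bcs_dom (u : V -> R) K M : measurable_fun setT u ->
  (forall x, `|u x| <= K * \1_(cube M) x) -> bcs u.
Proof.
move=> mu' uK; split => //; exists (`|K| + `|M| + 1) => [|x].
  by rewrite -addrA ltr_wpDl// ltr_wpDl.
apply: le_trans (uK x) _; apply: (@le_trans _ _ (`|K| * \1_(cube M) x)).
  by rewrite ler_wpM2r ?ler_norm// indic_cube_ge0.
apply: ler_pM => //; first by rewrite -addrA lerDl addr_ge0.
apply: le_indic_cube; apply: le_trans (ler_norm M) _.
by rewrite addrAC lerDr addr_ge0.
Qed.

Lemma bcs_integrable u : bcs u -> mu.-integrable setT (EFin \o u).
Proof.
move=> [mu' [M M0 uM]].
have := integrableZl measurableT M (@integrable_indic_cube R n M).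
apply: le_integrable => //; first exact/measurable_EFinP.
by move=> x _ /=; rewrite lee_fin; exact: le_trans (ler_norm _).
Qed.

Lemma bcs_indic_cube M : bcs (\1_(cube M)).
Proof.
apply: (@bcs_dom _ 1 M); first exact: measurable_indic_cube.
by move=> x; rewrite mul1r ger0_norm// indic_cube_ge0.
Qed.

Lemma bcsMr u (g : V -> R) K : bcs u -> measurable_fun setT g -> (forall x, `|g x| <= K) ->
  bcs (fun x => u x * g x).
Proof.
move=> [mu' [M M0 uM]] mg gK.
apply: (@bcs_dom _ (M * K) M); first exact: measurable_funM.
move=> x; rewrite normrM mulrAC; apply: ler_pM => //.
Qed.

Lemma bcsMl u (g : V -> R) K : bcs u -> measurable_fun setT g -> (forall x, `|g x| <= K) ->
  bcs (fun x => g x * u x).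
Proof. by move=> bu mg gK; under eq_fun do rewrite mulrC; exact: (bcsMr bu mg gK). Qed.

Lemma bcsD u v : bcs u -> bcs v -> bcs (fun x => u x + v x).
Proof.
move=> [mu' [M M0 uM]] [mv [N N0 vN]].
apply: (@bcs_dom _ ((M + N) + (M + N)) (M + N)); first exact: measurable_funD.
move=> x; apply: le_trans (ler_normD _ _) _; rewrite mulrDl; apply: lerD.
  by apply: (bcs_bound M0 uM); rewrite lerDl ltW.
by apply: (bcs_bound N0 vN); rewrite lerDr ltW.
Qed.

Lemma bcsN u : bcs u -> bcs (fun x => - u x).
Proof.
move=> [mu' [M M0 uM]]; split; first exact: measurableT_comp.
by exists M => // x; rewrite normrN.
Qed.

Lemma bcsB u v : bcs u -> bcs v -> bcs (fun x => u x - v x).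
Proof. by move=> bu bv; apply: bcsD => //; exact: bcsN. Qed.

Lemma bcsZ c u : bcs u -> bcs (fun x => c * u x).
Proof. by move=> bu; apply: (@bcsMl u (fun=> c) `|c|). Qed.

Lemma bcs_norm u : bcs u -> bcs (fun x => `|u x|).
Proof.
move=> [mu' [M M0 uM]]; split; first exact: measurableT_comp.
by exists M => // x; rewrite normr_id.
Qed.

Lemma bcs_bounded u : bcs u -> exists2 K, 0 < K & forall x, `|u x| <= K.
Proof.
move=> [mu' [M M0 uM]]; exists M => // x; apply: le_trans (uM x) _.
by rewrite ler_piMr// ?ltW// indicE; case: (_ \in _).
Qed.

Lemma bcsM u v : bcs u -> bcs v -> bcs (fun x => u x * v x).
Proof.
move=> bu bv; have [K _ vK] := bcs_bounded bv.
by apply: (bcsMr bu _ vK); exact: bcs_measurable.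
Qed.

Lemma bcs0 : bcs (fun=> 0).
Proof. by apply: (@bcs_dom _ 0 0) => // x; rewrite normr0 mul0r. Qed.

Lemma bcs_sum (I : Type) (r : seq I) (u : I -> V -> R) : (forall i, bcs (u i)) ->
  bcs (fun x => \sum_(i <- r) u i x).
Proof.
move=> bu; elim: r => [|i r IH].
  by under eq_fun do rewrite big_nil; exact: bcs0.
by under eq_fun do rewrite big_cons; apply: bcsD.
Qed.

Lemma measurable_translate (h : V) : measurable_fun setT (fun x : V => x + h).
Proof. by apply: measurable_rVD => //; exact: measurable_id. Qed.

Lemma cubeD M N (x h : V) : cube M x -> cube N h -> cube (M + N) (x + h).
Proof.
move=> xM hN i; rewrite mxE; apply: le_trans (ler_normD _ _) _.
exact: lerD.
Qed.

Lemma le_indic_cubeD M N (x h : V) : cube N h ->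
  \1_(cube M) (x + h) <= \1_(cube (M + N)) x :> R.
Proof.
move=> hN; rewrite !indicE; case: (boolP (_ \in cube M)) => //=.
rewrite inE => xM; rewrite mem_set// -[x](addrK h); apply: cubeD => //.
by move=> i; rewrite mxE normrN.
Qed.

Lemma bcs_translate u h : bcs u -> bcs (fun x => u (x + h)).
Proof.
move=> [mu' [M M0 uM]].
apply: (@bcs_dom _ M (M + `|h|)).
  exact: (measurableT_comp mu' (measurable_translate h)).
move=> x; apply: le_trans (uM _) _; rewrite ler_pM2l//.
by apply: le_indic_cubeD => i; exact: rV_norm_coord.
Qed.

Lemma integral_translate (f : V -> \bar R) (h : V) : measurable_fun setT f ->
  (\int[mu]_x f (x + h)%R = \int[mu]_x f x)%E.
Proof.
move=> mf.
have T (g : V -> \bar R) : measurable_fun setT g -> (forall x, 0 <= g x)%E ->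
    (\int[mu]_x g (x + h)%R = \int[mu]_x g x)%E.
  move=> mg g0; have := integral_affine_rV h ltr01 mg g0.
  by rewrite invr1 expr1n mul1e => <-; apply: eq_integral => x _; rewrite scale1r.
rewrite [LHS]integralE [RHS]integralE; congr (_ - _)%E.
  rewrite -(T f^\+%E (measurable_funepos mf))//.
  by rewrite -[X in X^\+%E]/(f \o (fun x => x + h)) funepos_comp.
rewrite -(T f^\-%E (measurable_funeneg mf))//.
by rewrite -[X in X^\-%E]/(f \o (fun x => x + h)) funeneg_comp.
Qed.

Lemma Rintegral_translate (f : V -> R) (h : V) : measurable_fun setT f ->
  \int[mu]_x f (x + h) = \int[mu]_x f x.
Proof.
move=> mf; rewrite /Rintegral; congr fine.
rewrite -(integral_translate (f := EFin \o f) h)//.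
exact/measurable_EFinP.
Qed.

Lemma Rintegral_dilate (f : V -> R) (s : R) : 0 < s ->
  mu.-integrable setT (EFin \o f) ->
  \int[mu]_x f (s *: x) = s^-1 ^+ n * \int[mu]_x f x.
Proof.
move=> s0 If; have /integrableP[mf _] := If.
have T (g : V -> \bar R) : measurable_fun setT g -> (forall x, 0 <= g x)%E ->
    (\int[mu]_x g (s *: x)%R = (s^-1 ^+ n)%:E * \int[mu]_x g x)%E.
  move=> mg g0; have := integral_affine_rV 0 s0 mg g0.
  by move=> <-; apply: eq_integral => x _; rewrite addr0.
have -> : s^-1 ^+ n * \int[mu]_x f x = fine ((s^-1 ^+ n)%:E * \int[mu]_x (f x)%:E)%E.
  by rewrite -EFin_Rintegral.
rewrite /Rintegral; congr fine; rewrite [LHS]integralE [in RHS]integralE.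
rewrite muleBr//; last first.
  exact: integrable_add_def If.
congr (_ - _)%E.
  rewrite -(T (EFin \o f)^\+%E (measurable_funepos mf))//.
  by rewrite -[X in X^\+%E]/((EFin \o f) \o (fun x => s *: x)) funepos_comp.
rewrite -(T (EFin \o f)^\-%E (measurable_funeneg mf))//.
by rewrite -[X in X^\-%E]/((EFin \o f) \o (fun x => s *: x)) funeneg_comp.
Qed.

(** The trace of the hyperplane on each cube has as measure a product of
    one-dimensional integrals, one of which vanishes. *)
Lemma hyperplane_null (i : 'I_n) (a : R) : {ae mu, forall x : V, x ord0 i <> a}.
Proof.
have mH : measurable [set x : V | x ord0 i = a].
  have -> : [set x : V | x ord0 i = a] = (fun x : V => x ord0 i : R) @^-1` [set a] by [].
  rewrite -[X in measurable X]setTI; exact: measurable_coord.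
suff H0 : mu [set x : V | x ord0 i = a] = 0%E.
  by exists [set x : V | x ord0 i = a]; split => // x /= /contrapT.
have -> : [set x : V | x ord0 i = a] = \bigcup_k ([set x : V | x ord0 i = a] `&` cube k%:R).
  rewrite -setI_bigcupr [X in _ `&` X](_ : _ = setT) ?setIT//.
  apply/seteqP; split => // x _; exists (Num.truncn `|x|).+1 => // j.
  by apply: le_trans (rV_norm_coord x j) _; rewrite ltW// truncnS_gt.
apply/eqP; rewrite eq_le measure_ge0 andbT.
pose F k := [set x : V | x ord0 i = a] `&` cube k%:R.
apply: (@le_trans _ _ (\sum_(0 <= k <oo) mu (F k))%E).
apply: measure_sigma_subadditive.
- by move=> k; apply: measurableI => //; exact: measurable_cube.
- by apply: bigcup_measurable => k _; apply: measurableI => //; exact: measurable_cube.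
- by [].
rewrite eseries0// => k _ _.
rewrite -[F k]setIT -integral_indic//; last first.
  by apply: measurableI => //; exact: measurable_cube.
pose g j (t : R) : R := (if j == i then \1_[set a] t else 1) * \1_(`[-k%:R, k%:R]) t.
have ig j : (@lebesgue_measure R).-integrable setT (EFin \o g j).
  have := @integrable_indic_itv R (- k%:R) k%:R true false.
  apply: le_integrable => //.
    apply/measurable_EFinP/measurable_funM; last exact: measurable_indic.
    by case: (j == i) => //; exact: measurable_indic.
  move=> x _ /=; rewrite lee_fin normrM ler_piMl//.
  by case: (j == i); rewrite ?normr1// indicE; case: (_ \in _); rewrite ?normr1// normr0.
have g0 j x : 0 <= g j x by rewrite /g; case: ifP => _; rewrite mulr_ge0.
transitivity (\int[mu]_x (\prod_(j < n) g j (x ord0 j))%:E)%E.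
  apply: eq_integral => x _; congr EFin.
  rewrite /F big_split/= -indic_cube -big_mkcond/= big_pred1_eq.
  rewrite !indicE in_setI -natrM mulnb.
  have -> // : (x \in [set y : V | y ord0 i = a]) = (x ord0 i \in [set a]).
  by apply/idP/idP; rewrite !inE.
rewrite integral_prod_rV// (bigD1 i)//= [X in X * _](_ : _ = 0) ?mul0r//.
rewrite -(Rintegral_set1 (g i) a) [RHS]Rintegral_mkcond.
apply: eq_Rintegral => t _; rewrite patchE /g eqxx indicE.
by case: (t \in [set a]); rewrite ?mul0r.
Qed.

End bcs.

(** * Continuity of translations in the mean *)

Section translation_continuity.
Context {R : realType} {n : nat}.
Local Notation V := 'rV[R]_n.
Local Notation mu := (@lebesgue_rV R n).
Variable h_ : nat -> V.
Hypothesis h0 : `|h_ k| @[k --> \oo] --> 0.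

(** The mean over a fixed cube, rather than the whole space, makes constants
    admissible, hence also complements of sets. *)
Let tc (f : V -> R) := forall M,
  \int[mu]_x (\1_(cube M) x * `|f (x + h_ k) - f x|) @[k --> \oo] --> 0.

Let bm (f : V -> R) := measurable_fun setT f /\ exists K, forall x, `|f x| <= K.

Let bmM f g : bm f -> bm g -> bm (fun x => f x * g x).
Proof.
move=> [mf [K fK]] [mg [L gL]]; split; first exact: measurable_funM.
by exists (K * L) => x; rewrite normrM; apply: ler_pM.
Qed.

Let bmB f g : bm f -> bm g -> bm (fun x => f x - g x).
Proof.
move=> [mf [K fK]] [mg [L gL]]; split; first exact: measurable_funB.
exists (K + L) => x; apply: le_trans (ler_normB _ _) _; exact: lerD.
Qed.

Let bm_tr f h : bm f -> bm (fun x => f (x + h)).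
Proof.
move=> [mf [K fK]]; split; last by exists K.
exact: (measurableT_comp mf (measurable_translate h)).
Qed.

Let bm_norm f : bm f -> bm (fun x => `|f x|).
Proof.
move=> [mf [K fK]]; split; first exact: measurableT_comp.
by exists K => x; rewrite normr_id.
Qed.

Let win_integrable M g : bm g ->
  mu.-integrable setT (EFin \o (fun x => \1_(cube M) x * g x)).
Proof.
move=> [mg [K gK]]; apply: bcs_integrable.
exact: (bcsMr (bcs_indic_cube M) mg gK).
Qed.

Let tc_bound f M B_ : bm f -> B_ @ \oo --> (0 : R) ->
  (\forall k \near \oo, \int[mu]_x (\1_(cube M) x * `|f (x + h_ k) - f x|) <= B_ k) ->
  \int[mu]_x (\1_(cube M) x * `|f (x + h_ k) - f x|) @[k --> \oo] --> 0.
Proof.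
move=> bf B0 fB.
apply: (@squeeze_cvgr _ _ _ _ (fun=> 0) B_) => //; last exact: cvg_cst.
move: fB; apply: filterS => k ->; rewrite andbT.
by apply: Rintegral_ge0 => x _; rewrite mulr_ge0.
Qed.

Let bm_diff f k : bm f -> bm (fun x => `|f (x + h_ k) - f x|).
Proof. by move=> bf; apply/bm_norm/bmB => //; exact: bm_tr. Qed.

Let tc_cst c : tc (fun=> c).
Proof.
move=> M; under eq_fun do under eq_Rintegral do rewrite subrr normr0 mulr0.
by under eq_fun do rewrite Rintegral_cst// mul0r; exact: cvg_cst.
Qed.

Let tc_lin a b f g : bm f -> bm g -> tc f -> tc g -> tc (fun x => a * f x + b * g x).
Proof.
move=> bf bg tf tg M.
have bc c : bm (fun=> c) by split => //; exists `|c|.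
have bfg : bm (fun x => a * f x + b * g x).
  have -> : (fun x => a * f x + b * g x) = (fun x => a * f x - (- b) * g x).
    by apply/funext => x; rewrite mulNr opprK.
  apply: bmB.
    exact: (bmM (bc a) bf).
  exact: (bmM (bc (- b)) bg).
apply: (tc_bound (B_ := fun k =>
  `|a| * \int[mu]_x (\1_(cube M) x * `|f (x + h_ k) - f x|) +
  `|b| * \int[mu]_x (\1_(cube M) x * `|g (x + h_ k) - g x|))) => //.
  have := cvgD (cvgM (cvg_cst (`|a|)) (tf M)) (cvgM (cvg_cst (`|b|)) (tg M)).
  by rewrite !mulr0 addr0; apply.
apply: nearW => k.
have If := win_integrable M (bm_diff k bf).
have Ig := win_integrable M (bm_diff k bg).
rewrite -!RintegralZl// -RintegralD//.
- apply: le_Rintegral => //.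
  + exact: win_integrable (bm_diff k bfg).
  + by apply: RintegrableD; exact: RintegrableZ.
  move=> x _; rewrite [`|a| * _]mulrCA [`|b| * _]mulrCA -mulrDr ler_wpM2l//.
  rewrite -!normrM; apply: le_trans (ler_normD _ _).
  by rewrite le_eqVlt; apply/orP; left; apply/eqP; congr `|_|; ring.
- exact: RintegrableZ.
- exact: RintegrableZ.
Qed.

Let tc_mul f g : bm f -> bm g -> tc f -> tc g -> tc (fun x => f x * g x).
Proof.
move=> bf bg tf tg M.
have [_ [K fK]] := bf; have [_ [L gL]] := bg.
apply: (tc_bound (B_ := fun k =>
  L * \int[mu]_x (\1_(cube M) x * `|f (x + h_ k) - f x|) +
  K * \int[mu]_x (\1_(cube M) x * `|g (x + h_ k) - g x|))) => //.
- exact: bmM.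
- have := cvgD (cvgM (cvg_cst (L)) (tf M)) (cvgM (cvg_cst (K)) (tg M)).
  by rewrite !mulr0 addr0; apply.
apply: nearW => k.
have If := win_integrable M (bm_diff k bf).
have Ig := win_integrable M (bm_diff k bg).
rewrite -!RintegralZl// -RintegralD//.
- apply: le_Rintegral => //.
  + exact: win_integrable (bm_diff k (bmM bf bg)).
  + by apply: RintegrableD; exact: RintegrableZ.
  move=> x _; rewrite [L * _]mulrCA [K * _]mulrCA -mulrDr ler_wpM2l//.
  rewrite (_ : f (x + h_ k) * g (x + h_ k) - f x * g x =
    (f (x + h_ k) - f x) * g (x + h_ k) + f x * (g (x + h_ k) - g x)); last by ring.
  apply: le_trans (ler_normD _ _) _; rewrite !normrM; apply: lerD.
    by rewrite mulrC ler_wpM2r.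
  by rewrite ler_wpM2r.
- exact: RintegrableZ.
- exact: RintegrableZ.
Qed.

Let tc_lim (f_ : nat -> V -> R) (f : V -> R) K :
  (forall N, measurable_fun setT (f_ N)) -> measurable_fun setT f ->
  (forall N x, `|f_ N x| <= K) -> (forall x, f_ ^~ x @ \oo --> f x) ->
  (forall N, tc (f_ N)) -> tc f.
Proof.
move=> mf_ mf fK ff tf M.
have fK' x : `|f x| <= K.
  have : `|f_ N x| @[N --> \oo] --> `|f x| by apply: cvg_norm; exact: ff.
  by move/cvg_lim => <-//; apply: limr_le;
    [apply/cvg_ex; exists `|f x|; apply: cvg_norm; exact: ff|exact: nearW].
have bf : bm f by split => //; exists K.
have bf_ N : bm (f_ N) by split => //; exists K.
have bd N : bm (fun x => `|f x - f_ N x|) by apply/bm_norm/bmB.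
pose J N := \int[mu]_x (\1_(cube (M + 1)) x * `|f x - f_ N x|).
have J0 : J N @[N --> \oo] --> 0.
  have -> : 0 = \int[mu]_x (cst 0 x) :> R by rewrite Rintegral_cst// mul0r.
  apply: (@Rdominated_cvg _ _ _ mu _ _ (fun x => \1_(cube (M + 1)) x * (K + K)) _ _ _ _ _).2 => //.
  - by move=> N; apply: measurable_funM; [exact: measurable_indic_cube|have [] := bd N].
  - apply: aeW => x; rewrite /= -(mulr0 (\1_(cube (M + 1)) x)); apply: cvgM; first exact: cvg_cst.
    rewrite -(@normr0 R R) -(subrr (f x)); apply: cvg_norm; apply: cvgB; [exact: cvg_cst|exact: ff].
  - apply: win_integrable; split => //; by exists `|K + K|.
  - move=> N x; rewrite normrM normr_id ger0_norm// ler_wpM2l//.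
    by apply: le_trans (ler_normB _ _) _; exact: lerD.
apply/cvgr0Pnorm_lt => e e0.
have e3 : 0 < e / 4 by rewrite divr_gt0.
have [N JN] : exists N, J N < e / 4.
  have /cvgr0Pnorm_lt/(_ _ e3)[N _ /(_ N (leqnn N)) h] := J0.
  by exists N; apply: le_lt_trans h; exact: ler_norm.
have h1 : \forall k \near \oo, `|h_ k| < 1.
  by have /cvgr0Pnorm_lt/(_ _ ltr01) := h0; apply: filterS => k; rewrite normr_id.
have h2 : \forall k \near \oo, \int[mu]_x (\1_(cube M) x * `|f_ N (x + h_ k) - f_ N x|) < e / 4.
  have /cvgr0Pnorm_lt/(_ _ e3) := tf N M.
  by apply: filterS => k; apply: le_lt_trans; exact: ler_norm.
move: h1 h2; apply: filterS2 => k h1 h2.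
rewrite ger0_norm; last by apply: Rintegral_ge0 => x _; rewrite mulr_ge0.
have Itr : mu.-integrable setT (EFin \o (fun x => \1_(cube M) x * `|f (x + h_ k) - f_ N (x + h_ k)|)).
  by apply: win_integrable; apply: (@bm_tr (fun x => `|f x - f_ N x|)).
have IJ := win_integrable (M + 1) (bd N).
have I2 := win_integrable M (bm_diff k (bf_ N)).
have J1 : \int[mu]_x (\1_(cube M) x * `|f (x + h_ k) - f_ N (x + h_ k)|) <= J N.
  rewrite /J -(@Rintegral_translate _ _ (fun x => \1_(cube (M + 1)) x * `|f x - f_ N x|) (h_ k)); last first.
    by apply: measurable_funM; [exact: measurable_indic_cube|have [] := bd N].
  apply: le_Rintegral => //.
    apply: bcs_integrable.
    apply: (@bcs_translate _ _ (fun x => \1_(cube (M + 1)) x * `|f x - f_ N x|)).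
    have [mb [L bL]] := bd N.
    exact: (bcsMr (bcs_indic_cube (M + 1)) mb bL).
  move=> x _; rewrite ler_wpM2r// !indicE.
  case: (boolP (x \in cube M)) => //=; rewrite inE => xM.
  rewrite mem_set//; apply: cubeD => // i; apply: le_trans (rV_norm_coord _ i) _.
  exact: ltW.
apply: (@le_lt_trans _ _ (J N + \int[mu]_x (\1_(cube M) x * `|f_ N (x + h_ k) - f_ N x|) + J N)).
  apply: (@le_trans _ _ (\int[mu]_x (\1_(cube M) x * `|f (x + h_ k) - f_ N (x + h_ k)|) +
    \int[mu]_x (\1_(cube M) x * `|f_ N (x + h_ k) - f_ N x|) + J N)); last first.
    by rewrite !lerD2r.
  rewrite /J -!RintegralD//; last exact: RintegrableD.
  apply: le_Rintegral => //.
  - exact: win_integrable (bm_diff k bf).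
  - by apply: RintegrableD => //; apply: RintegrableD.
  move=> x _.
  apply: (@le_trans _ _ (\1_(cube M) x * (`|f (x + h_ k) - f_ N (x + h_ k)| +
     `|f_ N (x + h_ k) - f_ N x| + `|f x - f_ N x|))).
    rewrite ler_wpM2l// [`|f x - _|]distrC.
    rewrite (_ : f (x + h_ k) - f x = (f (x + h_ k) - f_ N (x + h_ k)) +
      (f_ N (x + h_ k) - f_ N x) + (f_ N x - f x)); last by ring.
    by apply: le_trans (ler_normD _ _) _; rewrite lerD2r; exact: ler_normD.
  rewrite !mulrDr lerD2l ler_wpM2r//; apply: le_indic_cube; by rewrite lerDl.
by lra.
Qed.

(** Away from the null hyperplane x_j = a the indicator is locally constant. *)
Let tc_halfspace (j : 'I_n) (a : R) : tc (\1_[set x : V | a < x ord0 j]).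
Proof.
set f : V -> R := \1_ _.
have mf : measurable_fun setT f.
  apply: measurable_indic.
  have -> : [set x : V | a < x ord0 j] = (fun x : V => x ord0 j : R) @^-1` `]a, +oo[.
    by apply/seteqP; split => x /=; rewrite in_itv/= andbT.
  by rewrite -[X in measurable X]setTI; exact: measurable_coord.
have bf : bm f by split => //; exists 1 => x; rewrite ger0_norm// /f indicE; case: (_ \in _).
move=> M.
have -> : 0 = \int[mu]_x (cst 0 x) :> R by rewrite Rintegral_cst// mul0r.
apply: (@Rdominated_cvg _ _ _ mu _ _ (fun x => \1_(cube M) x * 2) _ _ _ _ _).2 => //.
- by move=> N; apply: measurable_funM; [exact: measurable_indic_cube|have [] := bm_diff N bf].
- have := hyperplane_null j a; apply: filterS => x xa.
  have hj : (x + h_ k) ord0 j @[k --> \oo] --> x ord0 j.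
    rewrite -[X in _ --> X]addr0; under eq_fun do rewrite mxE.
    apply: cvgD; first exact: cvg_cst.
    apply/cvgr0Pnorm_lt => e e0; have /cvgr0Pnorm_lt/(_ e e0) := h0.
    apply: filterS => k; rewrite normr_id; apply: le_lt_trans.
    exact: rV_norm_coord.
  have fE (y : V) : f y = (a < y ord0 j)%R%:R.
    by rewrite /f indicE; congr (nat_of_bool _)%:R; apply/idP/idP; rewrite inE.
  apply: cvg_near_cst.
  have [ax|ax] := ltrP a (x ord0 j).
    have /cvgrPdist_lt/(_ (x ord0 j - a)) := hj; rewrite subr_gt0 => /(_ ax).
    apply: filterS => k; rewrite ltr_norml !fE ax => /andP[_ hk].
    by rewrite (_ : a < _ = true) ?subrr ?normr0 ?mulr0//; lra.
  have {}ax : x ord0 j < a by rewrite lt_neqAle ax andbT; apply/eqP.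
  have /cvgrPdist_lt/(_ (a - x ord0 j)) := hj; rewrite subr_gt0 => /(_ ax).
  apply: filterS => k; rewrite ltr_norml !fE => /andP[hk _].
  rewrite (_ : a < x ord0 j = false); last by apply/negbTE; rewrite -leNgt ltW.
  rewrite (_ : a < _ = false) ?subrr ?normr0 ?mulr0//.
  by apply/negbTE; rewrite -leNgt; lra.
- by apply: win_integrable; split => //; exists `|2|.
- move=> N x; rewrite normrM normr_id ger0_norm// ler_wpM2l//.
  apply: le_trans (ler_normB _ _) _; rewrite !ger0_norm// /f !indicE.
  by case: (_ \in _); case: (_ \in _); rewrite /=; lra.
Qed.

Let bm_indic A : measurable A -> bm (\1_A).
Proof.
move=> mA; split; first exact: measurable_indic.
by exists 1 => x; rewrite ger0_norm// indicE; case: (_ \in _).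
Qed.

Let tc_good : set (set V) := [set A | measurable A /\ tc (\1_A)].

Let tc_goodC A : tc_good A -> tc_good (~` A).
Proof.
move=> [mA tA]; split; first exact: measurableC.
have -> : \1_(~` A) = (fun x => 1 * 1 + (- 1) * \1_A x) :> (V -> R).
  by apply/funext => x; rewrite !indicE in_setC; case: (_ \in _) => /=; lra.
have b1 : bm (fun=> 1) by split => //; exists `|1|.
exact: (@tc_lin 1 (-1) _ _ b1 (bm_indic mA) (tc_cst 1) tA).
Qed.

Let tc_goodI A B : tc_good A -> tc_good B -> tc_good (A `&` B).
Proof.
move=> [mA tA] [mB tB]; split; first exact: measurableI.
have -> : \1_(A `&` B) = (fun x => \1_A x * \1_B x) :> (V -> R).
  by apply/funext => x; rewrite !indicE in_setI -natrM mulnb.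
by apply: tc_mul => //; exact: bm_indic.
Qed.

Let tc_good0 : tc_good set0.
Proof.
split => //; have -> : \1_set0 = (fun=> 0) :> (V -> R); last exact: tc_cst.
by apply/funext => x; rewrite indicE in_set0.
Qed.

Let tc_goodU A B : tc_good A -> tc_good B -> tc_good (A `|` B).
Proof.
move=> gA gB; rewrite -[A `|` B]setCK setCU.
by apply: tc_goodC; apply: tc_goodI; exact: tc_goodC.
Qed.

Let tc_good_bigcup (F : nat -> set V) : (forall i, tc_good (F i)) -> tc_good (\bigcup_i F i).
Proof.
move=> gF.
pose G N := \big[setU/set0]_(i < N) F i.
have gG N : tc_good (G N).
  rewrite /G; elim: N => [|N IH]; first by rewrite big_ord0.
  by rewrite big_ord_recr/=; exact: tc_goodU.
have mU : measurable (\bigcup_i F i) by apply: bigcupT_measurable => i; have [] := gF i.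
split => //.
apply: (@tc_lim (fun N => \1_(G N)) (\1_(\bigcup_i F i)) 1).
- by move=> N; apply: measurable_indic; have [] := gG N.
- exact: measurable_indic.
- by move=> N x; rewrite ger0_norm// indicE; case: (_ \in _).
- move=> x; apply: cvg_near_cst.
  have [[i _ Fx]|nx] := pselect ((\bigcup_i F i) x).
    exists i.+1 => // N /= iN.
    have m1 : x \in G N by rewrite inE /G -bigcup_mkord; exists i.
    have m2 : x \in \bigcup_i F i by rewrite inE; exists i.
    by rewrite !indicE m1 m2.
  apply: nearW => N; rewrite !indicE !memNset//.
  by rewrite /G -bigcup_mkord => -[i /= _ Fx]; apply: nx; exists i.
- by move=> N; have [] := gG N.
Qed.

(** Sets whose indicator is continuous in the mean form a sigma-algebra, and
    it contains the half-spaces generated by the coordinates. *)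
Let tc_measurable A : measurable A -> tc_good A.
Proof.
apply: smallest_sub.
  split; [exact: tc_good0| |exact: tc_good_bigcup].
  by move=> B gB; rewrite setTD; exact: tc_goodC.
move=> B; rewrite -bigcup_seq => -[j _ [C mC <-]]; rewrite setTI.
have : [set C : set R | tc_good ((fun x : V => x ord0 j) @^-1` C)] C; last by [].
move: C mC; rewrite RGenOInfty.measurableE; apply: smallest_sub.
  split.
  - by rewrite /= preimage_set0.
  - by move=> C /= gC; rewrite setTD preimage_setC; exact: tc_goodC.
  - by move=> F gF /=; rewrite preimage_bigcup; exact: tc_good_bigcup.
move=> _ [a ->] /=.
have E : (fun x : V => x ord0 j) @^-1` `]a, +oo[ = [set x : V | a < x ord0 j].
  by apply/seteqP; split => x /=; rewrite in_itv/= andbT.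
split; last by rewrite E; exact: tc_halfspace.
by rewrite -[X in measurable X]setTI; exact: measurable_coord.
Qed.

Import HBNNSimple.

Let tc_nnsfun (g : {nnsfun V >-> R}) : tc g.
Proof.
have bg (s : seq R) : bm (fun x => \sum_(r <- s) r * \1_(g @^-1` [set r]) x) /\
    tc (fun x => \sum_(r <- s) r * \1_(g @^-1` [set r]) x).
  elim: s => [|r s [IH1 IH2]].
    have -> : (fun x => \sum_(r <- [::]) r * \1_(g @^-1` [set r]) x) = (fun=> 0).
      by apply/funext => x; rewrite big_nil.
    split; last exact: tc_cst.
    by split => //; exists 0 => x; rewrite normr0.
  have mr : measurable (g @^-1` [set r]) by [].
  have [br tr] : bm (fun x => r * \1_(g @^-1` [set r]) x) /\ tc (fun x => r * \1_(g @^-1` [set r]) x).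
    have [_ t1] := tc_measurable mr.
    have b1 := bm_indic mr.
    have bc : bm (fun=> r) by split => //; exists `|r|.
    split; [exact: bmM|apply: tc_mul => //; exact: tc_cst].
  have E : (fun x => \sum_(r <- (r :: s)) r * \1_(g @^-1` [set r]) x) =
     (fun x => 1 * (r * \1_(g @^-1` [set r]) x) + 1 * (\sum_(r <- s) r * \1_(g @^-1` [set r]) x)).
    by apply/funext => x; rewrite big_cons !mul1r.
  rewrite E; split; last exact: tc_lin.
  have -> : (fun x => 1 * (r * \1_(g @^-1` [set r]) x) + 1 * (\sum_(r <- s) r * \1_(g @^-1` [set r]) x)) = (fun x => (r * \1_(g @^-1` [set r]) x) - (-1) * (\sum_(r <- s) r * \1_(g @^-1` [set r]) x)).
    by apply/funext => x; rewrite mulN1r opprK !mul1r.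
  apply: bmB => //; apply: (@bmM (fun=> -1)) => //.
  by split => //; exists `|-1|.
have -> : (g : V -> R) = (fun x => \sum_(r <- finmap.enum_fset (fset_set (range g))) r * \1_(g @^-1` [set r]) x).
  by apply/funext => x; rewrite [LHS](fimfunE g) fsbig_finite.
by have [] := bg (finmap.enum_fset (fset_set (range g))).
Qed.

(** Bounded functions are limits of simple ones; adding a constant reduces to
    the nonnegative case. *)
Let tc_bm f : bm f -> tc f.
Proof.
move=> [mf [K fK]].
(* f + K is nonnegative, hence an increasing limit of simple functions *)
pose u x := f x + K.
have u0 x : 0 <= u x by rewrite -lerBlDr sub0r; have := fK x; rewrite ler_norml => /andP[].
have mu' : measurable_fun setT u by exact: measurable_funD.
have meu : measurable_fun setT (EFin \o u) by exact/measurable_EFinP.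
pose g := nnsfun_approx measurableT meu.
have gu x : (g ^~ x) @ \oo --> u x.
  have : (EFin \o g ^~ x) @ \oo --> (u x)%:E by apply: cvg_nnsfun_approx => //= y _; rewrite lee_fin.
  by move/fine_cvg.
have tu : tc u.
  apply: (@tc_lim (fun N => g N) u (K + K)) => //.
  move=> N x; rewrite ger0_norm//.
  apply: (@le_trans _ _ (u x)); last by rewrite lerD2r; apply: le_trans (ler_norm _) _.
  have ng : nondecreasing_seq (g ^~ x).
    by move=> a b ab; exact/lefP/nd_nnsfun_approx.
  have cg : cvgn (g ^~ x) by apply/cvg_ex; exists (u x); exact: gu.
  by have := nondecreasing_cvgn_le ng cg N; rewrite (cvg_lim _ (gu x)).
have -> : f = (fun x => 1 * u x + (-1) * K).
  by apply/funext => x; rewrite mul1r mulN1r addrK.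
have bu : bm u.
  split => //; exists (K + K) => x; rewrite ger0_norm// lerD2r.
  by apply: le_trans (ler_norm _) _.
have bK : bm (fun=> K) by split => //; exists `|K|.
exact: (@tc_lin 1 (-1) _ _ bu bK tu (tc_cst K)).
Qed.

Lemma bcs_translation_cvg u : bcs u ->
  \int[mu]_x `|u (x + h_ k) - u x| @[k --> \oo] --> 0.
Proof.
move=> bu; have [mu' [M M0 uM]] := bu.
have [K K0 uK] := bcs_bounded bu.
have tu : tc u by apply: tc_bm; split => //; exists K.
have := tu (M + 1); apply: cvg_trans; apply: near_eq_cvg.
have h1 : \forall k \near \oo, `|h_ k| < 1.
  by have /cvgr0Pnorm_lt/(_ _ ltr01) := h0; apply: filterS => k; rewrite normr_id.
apply: filterS h1 => k hk; apply: eq_Rintegral => x _.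
rewrite indicE; have [xM|xM] := boolP (x \in cube (M + 1)); first by rewrite mul1r.
rewrite mul0r; have Z y : ~ cube M y -> u y = 0.
  by move=> yM; apply: normr0_eq0; apply/eqP; rewrite eq_le normr_ge0 andbT;
   apply: le_trans (uM y) _; rewrite indicE memNset// mulr0.
rewrite !Z ?subrr ?normr0// => cM; move/negP: xM; apply; rewrite inE.
  by move=> i; apply: le_trans (cM i) _; rewrite lerDl.
rewrite -[x](addrK (h_ k)); apply: cubeD => // i.
by rewrite mxE normrN; apply: le_trans (rV_norm_coord _ i) (ltW hk).
Qed.

End translation_continuity.

(** * Two-sided exponentials and the Poisson kernel on the line *)

Section poisson1.
Context {R : realType}.
Notation leb := (@lebesgue_measure R).
Implicit Types s w x : R.

Lemma is_derive_linear (a x : R) : is_derive x 1 (fun t => a * t) a.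
Proof.
have : is_derive x 1 (a *: (@id R)) (a *: 1) by exact: is_deriveZ.
by rewrite /GRing.scale/= mulr1.
Qed.

Lemma is_derive_expRM (a x : R) : is_derive x 1 (fun t => expR (a * t)) (a * expR (a * x)).
Proof.
rewrite mulrC; exact: (is_derive1_comp (is_derive_expR (a * x)) (is_derive_linear a x)).
Qed.

Lemma is_derive_sinM (a x : R) : is_derive x 1 (fun t => sin (a * t)) (a * cos (a * x)).
Proof.
rewrite mulrC; exact: (is_derive1_comp (is_derive_sin (a * x)) (is_derive_linear a x)).
Qed.

Lemma is_derive_cosM (a x : R) : is_derive x 1 (fun t => cos (a * t)) (- (a * sin (a * x))).
Proof.
rewrite mulrC -mulNr; exact: (is_derive1_comp (is_derive_cos (a * x)) (is_derive_linear a x)).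
Qed.

Let prim s w c (x : R) : R :=
  expR (- s * x) * (c * ((s ^+ 2 + w ^+ 2)^-1 * (w * sin (w * x) - s * cos (w * x))) - s^-1).

Let is_derive_prim s w c x : 0 < s ->
  is_derive x 1 (prim s w c) (expR (- s * x) * (1 + c * cos (w * x))).
Proof.
move=> s0.
have d1 := is_derive_expRM (- s) x.
have d2 := is_derive_sinM w x.
have d3 := is_derive_cosM w x.
have d4 : is_derive x 1 (fun t => w * sin (w * t) - s * cos (w * t))
   (w * (w * cos (w * x)) - s * (- (w * sin (w * x)))).
  exact: (is_deriveB (is_deriveZ w d2) (is_deriveZ s d3)).
have d5 : is_derive x 1 (fun t => c * ((s ^+ 2 + w ^+ 2)^-1 * (w * sin (w * t) - s * cos (w * t))) - s^-1)
  (c * ((s ^+ 2 + w ^+ 2)^-1 * (w * (w * cos (w * x)) - s * (- (w * sin (w * x))))) - 0).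
  exact: (is_deriveB (is_deriveZ c (is_deriveZ _ d4)) (is_derive_cst (s^-1) x 1)).
have d := is_deriveM d1 d5.
have -> : prim s w c = (fun t => expR (- s * t)) *
  (fun t => c * ((s ^+ 2 + w ^+ 2)^-1 * (w * sin (w * t) - s * cos (w * t))) - s^-1) by [].
apply: (is_derive_eq d).
rewrite /GRing.scale/=; field; rewrite lt0r_neq0//= lt0r_neq0//.
by rewrite ltr_pwDl ?exprn_gt0// sqr_ge0.
Qed.

Let prim_cvg s w c : 0 < s -> prim s w c x @[x --> +oo] --> 0.
Proof.
move=> s0.
pose B := `|c| * ((s ^+ 2 + w ^+ 2)^-1 * (`|w| + s)) + s^-1.
have e0 : expR (- s * x) @[x --> +oo] --> (0 : R).
  have : expR (- (s * x)) @[x --> +oo] --> (0 : R).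
    by apply: (cvg_comp (fun x => s * x) (fun x => expR (- x))); [exact: gt0_cvgMry|exact: cvgr_expR].
  by under eq_fun do rewrite -mulNr.
apply/norm_cvg0P.
apply: (@squeeze_cvgr _ _ _ _ (fun=> 0) (fun x => expR (- s * x) * B)).
- apply: nearW => x; rewrite normr_ge0/= normrM ger0_norm ?expR_ge0// ler_wpM2l ?expR_ge0//.
  apply: le_trans (ler_normB _ _) _; rewrite (_ : `|s^-1| = s^-1); last by rewrite gtr0_norm// invr_gt0.
  rewrite /B lerD2r !normrM ler_wpM2l// [`|(_ + _)^-1|]ger0_norm; last by rewrite invr_ge0 addr_ge0// sqr_ge0.
  rewrite ler_wpM2l ?invr_ge0 ?addr_ge0 ?sqr_ge0//.
  apply: le_trans (ler_normB _ _) _; rewrite !normrM (gtr0_norm s0); apply: lerD.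
    by rewrite ler_piMr// ler_norml sin_geN1 sin_le1.
  by apply: ler_piMr; [exact: ltW|rewrite ler_norml cos_geN1 cos_le1].
- exact: cvg_cst.
- by rewrite -(mul0r B); apply: cvgM => //; exact: cvg_cst.
Qed.

Let prim_cont s w c x : 0 < s -> {for x, continuous (prim s w c)}.
Proof.
move=> s0; apply: differentiable_continuous; apply/derivable1_diffP.
by have [] := is_derive_prim w c x s0.
Qed.

Let cont_integrand s w c : 0 < s -> continuous (fun x : R => expR (- s * x) * (1 + c * cos (w * x))).
Proof.
move=> s0 x; apply: differentiable_continuous; apply/derivable1_diffP.
have d1 := is_derive_expRM (- s) x.
have d3 := is_derive_cosM w x.
have := is_deriveM d1 (is_deriveD (is_derive_cst (1 : R) x 1) (is_deriveZ c d3)).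
by case.
Qed.

(** The constant 1 makes the integrand nonnegative, which the fundamental
    theorem of calculus on a half-line asks for; it is subtracted again
    afterwards. *)
Lemma integral_halfline_exp_cos s w c : 0 < s -> `|c| <= 1 ->
  (\int[leb]_(x in `[0%R, +oo[) (expR (- s * x) * (1 + c * cos (w * x)))%:E =
   (s^-1 + c * (s / (s ^+ 2 + w ^+ 2)))%:E)%E.
Proof.
move=> s0 c1.
rewrite (@ge0_continuous_FTC2y R _ (prim s w c) 0 0).
- rewrite -EFinB; congr EFin; rewrite /prim !mulr0 expR0 sin0 cos0; field.
  apply/andP; split; apply: lt0r_neq0 => //.
  by rewrite ltr_pwDl ?exprn_gt0// sqr_ge0.
- move=> x _; rewrite mulr_ge0 ?expR_ge0// -lerBlDl sub0r.
  have : `|c * cos (w * x)| <= 1 by rewrite normrM mulr_ile1// ler_norml cos_geN1 cos_le1.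
  by rewrite ler_norml => /andP[].
- by apply: continuous_subspaceT; exact: cont_integrand.
- exact: prim_cvg.
- by move=> x _; have [] := is_derive_prim w c x s0.
- by apply: cvg_at_right_filter; exact: prim_cont.
- by move=> x _; rewrite derive1E; have [_ ->] := is_derive_prim w c x s0.
Qed.

Lemma integral_even_split (g : R -> R) : measurable_fun setT g -> (forall x, 0 <= g x) ->
  (\int[leb]_x (g x)%:E = \int[leb]_(x in `[0%R, +oo[) (g x + g (- x))%:E)%E.
Proof.
move=> mg g0.
have meg : measurable_fun setT (EFin \o g) by exact/measurable_EFinP.
have mgN : measurable_fun setT (fun x => (g (- x))%:E).
  by apply/measurable_EFinP; apply: measurableT_comp.
have -> : [set: R] = `]-oo, 0%R[ `|` `[0%R, +oo[.
  by apply/seteqP; split => // x _ /=; rewrite !in_itv/= andbT; case: ltP => ?; [left|right].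
rewrite ge0_integral_setU//=; last 3 first.
- exact: measurable_funTS.
- by move=> x _; rewrite lee_fin.
- apply/disj_setPS => x /= []; rewrite !in_itv/= andbT => h1 h2.
  by move: (lt_le_trans h1 h2); rewrite ltxx.
rewrite integral_itv_bndo_bndc; last exact: measurable_funTS.
have -> : (\int[leb]_(x in `]-oo, 0%R]) (g x)%:E = \int[leb]_(x in `[0%R, +oo[) (g (- x))%:E)%E.
  rewrite (@ge0_integration_by_substitution0 R (fun x => (g (- x))%:E) mgN) => [|x]; last by rewrite lee_fin.
  by apply: eq_integral => x _; rewrite opprK.
rewrite addeC -ge0_integralD//=.
- by move=> x _; rewrite lee_fin.
- exact: measurable_funTS.
- by move=> x _; rewrite lee_fin.
- exact: measurable_funTS.
Qed.

Let meas_cosphi w phi : measurable_fun setT (fun x : R => cos (w * x + phi)).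
Proof.
apply: (measurableT_comp (continuous_measurable_fun (@continuous_cos R))).
by apply: measurable_funD => //; exact: measurable_funM.
Qed.

Lemma measurable_expR_abs s : measurable_fun setT (fun x : R => expR (- s * `|x|)).
Proof. by apply: measurableT_comp => //; apply: measurable_funM => //; exact: normr_measurable. Qed.

Let integral_exp_abs1 s w phi : 0 < s ->
  (\int[leb]_x (expR (- s * `|x|) * (1 + cos (w * x + phi)))%:E =
   (2 * s^-1 + cos phi * (2 * s / (s ^+ 2 + w ^+ 2)))%:E)%E.
Proof.
move=> s0.
have g0 x : 0 <= expR (- s * `|x|) * (1 + cos (w * x + phi)).
  by rewrite mulr_ge0 ?expR_ge0// -lerBlDl sub0r cos_geN1.
rewrite integral_even_split//; last first.
  by apply: measurable_funM; [exact: measurable_expR_abs|exact: measurable_funD].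
transitivity (\int[leb]_(x in `[0%R, +oo[) (2%:E * (expR (- s * x) * (1 + cos phi * cos (w * x)))%:E))%E.
  apply: eq_integral => x; rewrite inE/= in_itv/= andbT => x0.
  rewrite normrN ger0_norm// -EFinM; congr EFin.
  rewrite mulrN cosD cosD cosN sinN; ring.
have nn x : 0 <= expR (- s * x) * (1 + cos phi * cos (w * x)).
  apply: mulr_ge0; first exact: expR_ge0.
  have : `|cos phi * cos (w * x)| <= 1 by rewrite normrM mulr_ile1// ler_norml cos_geN1 cos_le1.
  by rewrite ler_norml => /andP[]; lra.
have mi : measurable_fun (`[0%R, +oo[%classic : set R) (fun x => (expR (- s * x) * (1 + cos phi * cos (w * x)))%:E).
  apply/measurable_EFinP; apply: measurable_funTS.
  by apply: continuous_measurable_fun; exact: cont_integrand.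
rewrite (ge0_integralZl leb _ mi)//=.
rewrite integral_halfline_exp_cos//; last by rewrite ler_norml cos_geN1 cos_le1.
by rewrite -EFinM; congr EFin; ring.
Qed.

Let integral_exp_abs s : 0 < s -> (\int[leb]_x (expR (- s * `|x|))%:E = (2 * s^-1)%:E)%E.
Proof.
move=> s0; have := integral_exp_abs1 0 (pi / 2) s0; rewrite cos_pihalf mul0r addr0 => <-.
by apply: eq_integral => x _; rewrite mul0r add0r cos_pihalf addr0 mulr1.
Qed.

Lemma integrable_exp_abs s : 0 < s -> leb.-integrable setT (EFin \o (fun x => expR (- s * `|x|))).
Proof.
move=> s0; apply/integrableP; split; first by apply/measurable_EFinP; exact: measurable_expR_abs.
under eq_integral do rewrite /= ger0_norm ?expR_ge0//.
by rewrite integral_exp_abs// ltry.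
Qed.

(** The phase phi makes an induction on the dimension possible: the other
    coordinates enter only through it. *)
Lemma Rintegral_exp_abs_cos s w phi : 0 < s ->
  \int[leb]_x (expR (- s * `|x|) * cos (w * x + phi)) =
   cos phi * (2 * s / (s ^+ 2 + w ^+ 2)).
Proof.
move=> s0.
have ie := integrable_exp_abs s0.
have ic : leb.-integrable setT (EFin \o (fun x => expR (- s * `|x|) * cos (w * x + phi))).
  apply: (le_Rintegrable _ _ ie).
    by apply: measurable_funM; [exact: measurable_expR_abs|exact: meas_cosphi].
  by move=> x; rewrite normrM ger0_norm ?expR_ge0// ler_piMr ?expR_ge0// ler_norml cos_geN1 cos_le1.
have := integral_exp_abs1 w phi s0.
under eq_integral do rewrite mulrDr mulr1.
move/(congr1 fine); rewrite -/(Rintegral _ _ _) RintegralD//=.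
rewrite [X in X + _]/Rintegral integral_exp_abs//=.
by move/addrI.
Qed.

Lemma Rintegral_poisson1 : \int[leb]_x (2 / (1 + x ^+ 2)) = 2 * pi :> R.
Proof.
have m1 : measurable_fun setT (fun x : R => 2 / (1 + x ^+ 2)).
  apply: measurable_funM => //; apply: continuous_measurable_fun.
  exact: continuous_oneDsqrV.
have n1 (x : R) : 0 <= 2 / (1 + x ^+ 2) by rewrite divr_ge0// addr_ge0// sqr_ge0.
rewrite /Rintegral integral_even_split//.
transitivity (fine (\int[leb]_(x in `[0%R, +oo[) (4%:E * ((oneDsqr x)^-1)%:E))%E).
  congr fine; apply: eq_integral => x _; rewrite sqrrN -EFinM; congr EFin.
  by rewrite /oneDsqr/=; field; apply: lt0r_neq0; rewrite ltr_pwDl// sqr_ge0.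
have mi : measurable_fun (`[0%R, +oo[%classic : set R) (fun x : R => (oneDsqr x)^-1%:E).
  apply/measurable_EFinP; apply: measurable_funTS; apply: continuous_measurable_fun.
  exact: continuous_oneDsqrV.
rewrite (ge0_integralZl leb _ mi)//=.
by rewrite integral0y_oneDsqr -EFinM/=; lra.
Qed.

Lemma integrable_poisson1 : leb.-integrable setT (EFin \o (fun x : R => 2 / (1 + x ^+ 2))).
Proof.
have m1 : measurable_fun setT (fun x : R => 2 / (1 + x ^+ 2)).
  apply: measurable_funM => //; apply: continuous_measurable_fun.
  exact: continuous_oneDsqrV.
have n1 (x : R) : 0 <= 2 / (1 + x ^+ 2) by rewrite divr_ge0// addr_ge0// sqr_ge0.
apply/integrableP; split; first exact/measurable_EFinP.
under eq_integral do rewrite /= ger0_norm//.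
have := Rintegral_poisson1; rewrite /Rintegral.
have : (0 <= \int[leb]_x (2 / (1 + x ^+ 2))%:E)%E by apply: integral_ge0 => x _; rewrite lee_fin.
case: (\int[leb]_x _)%E => [r|_|//] /=; first by rewrite ltry.
by move/esym/eqP; rewrite mulf_eq0 pnatr_eq0/= gt_eqF// pi_gt0.
Qed.

End poisson1.

(** * Poisson kernels in several variables *)

Section poisson_rV.
Context {R : realType}.
Notation leb := (@lebesgue_measure R).

Lemma Rintegral_rVS n (f : 'rV[R]_n.+1 -> R) (g : R -> R) (h : 'rV[R]_n -> R) :
  measurable_fun setT f ->
  leb.-integrable setT (EFin \o g) -> (lebesgue_rV n).-integrable setT (EFin \o h) ->
  (forall a y, `|f (rV_cons (a, y))| <= g a * h y) ->
  \int[lebesgue_rV n.+1]_x f x = \int[leb]_a \int[lebesgue_rV n]_y f (rV_cons (a, y)).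
Proof.
move=> mf ig ih fgh.
have mfc : measurable_fun setT (fun z : measurableTypeR R * 'rV[R]_n => f (rV_cons (z.1, z.2))).
  have -> : (fun z : measurableTypeR R * 'rV[R]_n => f (rV_cons (z.1, z.2))) = f \o @rV_cons R n.
    by apply/funext => -[].
  by apply: measurableT_comp => //; exact: measurable_rV_cons.
have ip := @prod_dom_integrable _ _ (measurableTypeR R) 'rV[R]_n R leb (lebesgue_rV n)
  (fun a y => f (rV_cons (a, y))) g h mfc ig ih fgh.
have i1 := @prod_dom_integrable1 _ _ (measurableTypeR R) 'rV[R]_n R (lebesgue_rV n)
  (fun a y => f (rV_cons (a, y))) g h mfc ih fgh.
have E := integral12_prod_meas1 ip.
rewrite [RHS]/Rintegral.
have -> : (\int[leb]_a (\int[lebesgue_rV n]_y f (rV_cons (a, y)))%:E =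
  \int[leb]_a \int[lebesgue_rV n]_y (f (rV_cons (a, y)))%:E)%E.
  by apply: eq_integral => a _; rewrite EFin_Rintegral.
rewrite /Rintegral; congr fine; apply: etrans _ (esym E).
have P (k : 'rV[R]_n.+1 -> \bar R) : measurable_fun setT k -> (forall x, 0 <= k x)%E ->
  (\int[lebesgue_rV n.+1]_x k x = \int[leb \x lebesgue_rV n]_z k (rV_cons (z.1, z.2)))%E.
  move=> mk k0.
  have := @ge0_integral_pushforward _ _ (measurableTypeR R * 'rV[R]_n)%type _ R (@rV_cons R n) measurable_rV_cons
    (leb \x lebesgue_rV n)%E setT k measurableT mk (fun y _ => k0 y).
  rewrite preimage_setT => E'; apply: etrans E' _.
  by apply: eq_integral => -[].
have mef : measurable_fun setT (EFin \o f) by exact/measurable_EFinP.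
rewrite [LHS]integralE [RHS]integralE; congr (_ - _)%E.
  rewrite (P _ (measurable_funepos mef))//.
  by apply: eq_integral => -[a y] _; rewrite !unlock.
rewrite (P _ (measurable_funeneg mef))//.
by apply: eq_integral => -[a y] _; rewrite !unlock.
Qed.

(** A product over the coordinates, rather than the exponential of the
    Euclidean norm, so that its transform is computed one coordinate at a
    time. *)
Definition expw n (s : R) (xi : 'rV[R]_n) : R := \prod_(i < n) expR (- s * `|xi ord0 i|).

Lemma expw_ge0 n s (xi : 'rV[R]_n) : 0 <= expw s xi.
Proof. by apply: prodr_ge0 => i _; exact: expR_ge0. Qed.

Lemma measurable_expw n s : measurable_fun setT (@expw n s).
Proof.
apply: (@measurable_prod_coord R n (fun=> fun t => expR (- s * `|t|))) => i.
exact: measurable_expR_abs.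
Qed.

Lemma integrable_expw n s : 0 < s -> (lebesgue_rV n).-integrable setT (EFin \o @expw n s).
Proof.
move=> s0; apply/integrableP; split; first by apply/measurable_EFinP; exact: measurable_expw.
under eq_integral do rewrite /= ger0_norm ?expw_ge0//.
rewrite (@integral_prod_rV _ _ (fun=> fun t => expR (- s * `|t|))) ?ltry// => i *.
exact: integrable_exp_abs.
Qed.

Lemma rV_beheadE n (x : 'rV[R]_n.+1) i : rV_behead x ord0 i = x ord0 (lift ord0 i).
Proof. by rewrite /rV_behead mxE; congr (x _ _); exact/val_inj. Qed.

Lemma dotmul_cons n (h : 'rV[R]_n.+1) a y :
  dotmul h (rV_cons (a, y)) = h ord0 ord0 * a + dotmul (rV_behead h) y.
Proof.
rewrite /dotmul big_ord_recl rV_cons_head; congr (_ + _).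
by apply: eq_bigr => i _; rewrite rV_cons_lift rV_beheadE.
Qed.

Lemma expw_cons n s a (y : 'rV[R]_n) : expw s (rV_cons (a, y)) = expR (- s * `|a|) * expw s y.
Proof.
rewrite /expw big_ord_recl rV_cons_head; congr (_ * _).
by apply: eq_bigr => i _; rewrite rV_cons_lift.
Qed.

Lemma measurable_cosdot n (h : 'rV[R]_n) (phi : R) :
  measurable_fun setT (fun xi => cos (dotmul h xi + phi)).
Proof.
apply: (measurableT_comp (continuous_measurable_fun (@continuous_cos R))).
by apply: measurable_funD => //; apply: measurable_dotmul => //; exact: measurable_id.
Qed.

Lemma cos_norm_le1 (x : R) : `|cos x| <= 1.
Proof. by rewrite ler_norml cos_geN1 cos_le1. Qed.

Lemma sin_norm_le1 (x : R) : `|sin x| <= 1.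
Proof. by rewrite ler_norml sin_geN1 sin_le1. Qed.

Lemma Rintegral_expw_cos n (h : 'rV[R]_n) s phi : 0 < s ->
  \int[lebesgue_rV n]_xi (expw s xi * cos (dotmul h xi + phi)) =
  cos phi * \prod_(i < n) (2 * s / (s ^+ 2 + h ord0 i ^+ 2)).
Proof.
move=> s0; elim: n h phi => [|n IH] h phi.
  by rewrite /Rintegral integral_rV0/= /expw /dotmul !big_ord0 mul1r add0r mulr1.
rewrite (Rintegral_rVS _ (integrable_exp_abs s0) (integrable_expw n s0)); first last.
- move=> a y; rewrite expw_cons normrM ger0_norm ?mulr_ge0 ?expR_ge0 ?expw_ge0//.
  by rewrite ler_piMr ?cos_norm_le1// mulr_ge0 ?expR_ge0 ?expw_ge0.
- by apply: measurable_funM; [exact: measurable_expw|exact: measurable_cosdot].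
have E a : \int[lebesgue_rV n]_y (expw s (rV_cons (a, y)) * cos (dotmul h (rV_cons (a, y)) + phi)) =
  expR (- s * `|a|) * cos (h ord0 ord0 * a + phi) *
     \prod_(i < n) (2 * s / (s ^+ 2 + (rV_behead h) ord0 i ^+ 2)).
  rewrite -mulrA -IH -RintegralZl//.
    by apply: eq_Rintegral => y _; rewrite expw_cons dotmul_cons -mulrA addrAC [h _ _ * _ + _ + _]addrC addrA addrAC.
  apply: (le_Rintegrable _ _ (integrable_expw n s0)).
    by apply: measurable_funM; [exact: measurable_expw|exact: measurable_cosdot].
  by move=> y; rewrite normrM ger0_norm ?expw_ge0// ler_piMr ?cos_norm_le1// expw_ge0.
under eq_Rintegral do rewrite E.
rewrite RintegralZr//; last first.
  apply: (le_Rintegrable _ _ (integrable_exp_abs s0)).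
    apply: measurable_funM; [exact: measurable_expR_abs|].
    apply: (measurableT_comp (continuous_measurable_fun (@continuous_cos R))).
    by apply: measurable_funD => //; exact: measurable_funM.
  by move=> x; rewrite normrM ger0_norm ?expR_ge0// ler_piMr ?expR_ge0// cos_norm_le1.
rewrite Rintegral_exp_abs_cos// big_ord_recl -[LHS]mulrA; congr (_ * (_ * _)).
by apply: eq_bigr => i _; rewrite rV_beheadE.
Qed.

(** The product of one-dimensional Poisson kernels of width 1, scaled to have
    integral (2 pi)^n. *)
Definition poissonw n (h : 'rV[R]_n) : R := \prod_(i < n) (2 / (1 + h ord0 i ^+ 2)).

Let p1_ge0 (x : R) : 0 <= 2 / (1 + x ^+ 2).
Proof. by rewrite divr_ge0// addr_ge0// sqr_ge0. Qed.

Lemma poissonw_ge0 n (h : 'rV[R]_n) : 0 <= poissonw h.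
Proof. exact: prodr_ge0. Qed.

Lemma integral_poissonw n : (\int[lebesgue_rV n]_h (poissonw h)%:E = ((2 * pi) ^+ n)%:E)%E.
Proof.
rewrite (@integral_prod_rV _ _ (fun=> fun t => 2 / (1 + t ^+ 2)))//.
  by congr EFin; under eq_bigr do rewrite Rintegral_poisson1; rewrite prodr_const card_ord.
by move=> i; exact: integrable_poisson1.
Qed.

Lemma measurable_poissonw n : measurable_fun setT (@poissonw n).
Proof.
apply: (@measurable_prod_coord R n (fun=> fun t => 2 / (1 + t ^+ 2))) => i.
by have /integrableP[/measurable_EFinP] := @integrable_poisson1 R.
Qed.

Lemma integrable_poissonw n : (lebesgue_rV n).-integrable setT (EFin \o @poissonw n).
Proof.
apply/integrableP; split; first by apply/measurable_EFinP; exact: measurable_poissonw.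
by under eq_integral do rewrite /= ger0_norm ?poissonw_ge0//; rewrite integral_poissonw ltry.
Qed.

End poisson_rV.

(** * Plancherel's identity *)

Section trig_transform.
Context {R : realType} {n : nat}.
Local Notation V := 'rV[R]_n.
Local Notation mu := (@lebesgue_rV R n).

Definition costr (u : V -> R) (xi : V) : R := \int[mu]_x (cos (dotmul x xi) * u x).
Definition sintr (u : V -> R) (xi : V) : R := \int[mu]_x (sin (dotmul x xi) * u x).

Lemma fourier_energyE (u : V -> R) xi :
  fourier_energy u xi = ((2 * pi) ^+ n)^-1 * (costr u xi ^+ 2 + sintr u xi ^+ 2).
Proof.
rewrite /fourier_energy /fourier /ComplexField.Normc.normc sqr_sqrtr ?addr_ge0 ?sqr_ge0//.
rewrite sqrrN !exprMn -mulrDr -/(costr u xi) -/(sintr u xi); congr (_ * _).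
have p0 : 0 <= 2 * pi :> R by rewrite mulr_ge0// pi_ge0.
by rewrite -exprM mulnC exprM exprVn sqr_sqrtr// exprVn exprMn.
Qed.

Lemma fourier_energy_ge0 (u : V -> R) xi : 0 <= fourier_energy u xi.
Proof. by rewrite /fourier_energy sqr_ge0. Qed.

Lemma dotmulC (x y : V) : dotmul x y = dotmul y x.
Proof. by apply: eq_bigr => i _; rewrite mulrC. Qed.

Lemma dotmulDl (x y z : V) : dotmul (x + y) z = dotmul x z + dotmul y z.
Proof. by rewrite /dotmul -big_split/=; apply: eq_bigr => i _; rewrite mxE mulrDl. Qed.

Lemma dotmulZl c (x z : V) : dotmul (c *: x) z = c * dotmul x z.
Proof. by rewrite /dotmul mulr_sumr; apply: eq_bigr => i _; rewrite mxE mulrA. Qed.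

Lemma dotmulNl (x z : V) : dotmul (- x) z = - dotmul x z.
Proof. by rewrite -scaleN1r dotmulZl mulN1r. Qed.

Lemma measurable_cosdotT d (T : measurableType d) (f g : T -> V) :
  measurable_fun setT f -> measurable_fun setT g ->
  measurable_fun setT (fun t => cos (dotmul (f t) (g t))).
Proof.
move=> mf mg; apply: (measurableT_comp (continuous_measurable_fun (@continuous_cos R))).
exact: measurable_dotmul.
Qed.

Lemma measurable_sindotT d (T : measurableType d) (f g : T -> V) :
  measurable_fun setT f -> measurable_fun setT g ->
  measurable_fun setT (fun t => sin (dotmul (f t) (g t))).
Proof.
move=> mf mg; apply: (measurableT_comp (continuous_measurable_fun (@continuous_sin R))).
exact: measurable_dotmul.
Qed.

Lemma bcs_cosM (u : V -> R) xi : bcs u -> bcs (fun x => cos (dotmul x xi) * u x).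
Proof.
move=> bu; apply: (@bcsMl _ _ u _ 1 bu) => [|x]; last exact: cos_norm_le1.
by apply: measurable_cosdotT => //; exact: measurable_id.
Qed.

Lemma bcs_sinM (u : V -> R) xi : bcs u -> bcs (fun x => sin (dotmul x xi) * u x).
Proof.
move=> bu; apply: (@bcsMl _ _ u _ 1 bu) => [|x]; last exact: sin_norm_le1.
by apply: measurable_sindotT => //; exact: measurable_id.
Qed.

(** Fubini's theorem gives measurability after restricting the parameter to a
    cube; the cubes exhaust the space. *)
Lemma measurable_Rint_param (f : V -> V -> R) (h : V -> R) :
  measurable_fun setT (fun z : V * V => f z.1 z.2) ->
  mu.-integrable setT (EFin \o h) -> (forall xi x, `|f xi x| <= h x) ->
  measurable_fun setT (fun xi => \int[mu]_x f xi x).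
Proof.
move=> mf ih fh.
pose f_ N xi x := \1_(cube N%:R) xi * f xi x.
have mF N : measurable_fun setT (fun xi => \int[mu]_x f_ N xi x).
  have mf_ : measurable_fun setT (fun z : V * V => f_ N z.1 z.2).
    apply: measurable_funM => //.
    by apply: (measurableT_comp (measurable_indic_cube N%:R)); exact: measurable_fst.
  have df xi x : `|f_ N xi x| <= \1_(cube N%:R) xi * h x.
    by rewrite normrM ger0_norm// ler_wpM2l.
  have := @Rfubini_integrable _ _ V V R mu mu (f_ N) _ _ mf_
    (bcs_integrable (bcs_indic_cube N%:R)) ih df.
  by move=> /integrableP[/measurable_EFinP].
apply: (measurable_fun_cvg mF) => xi _; apply: cvg_near_cst.
exists (Num.truncn `|xi|).+1 => // N /= hN; apply: eq_Rintegral => x _.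
rewrite /f_ indicE mem_set ?mul1r// => j.
apply: le_trans (rV_norm_coord xi j) _; rewrite ltW//.
apply: lt_le_trans (truncnS_gt _) _; by rewrite ler_nat.
Qed.

Lemma measurable_costr (v : V -> R) : bcs v -> measurable_fun setT (costr v).
Proof.
move=> bv; apply: (measurable_Rint_param _ (bcs_integrable (bcs_norm bv))).
  apply: measurable_funM.
    by apply: measurable_cosdotT; [exact: measurable_snd|exact: measurable_fst].
  by apply: (measurableT_comp (bcs_measurable bv)); exact: measurable_snd.
by move=> xi x; rewrite normrM ler_piMl// cos_norm_le1.
Qed.

Lemma measurable_sintr (v : V -> R) : bcs v -> measurable_fun setT (sintr v).
Proof.
move=> bv; apply: (measurable_Rint_param _ (bcs_integrable (bcs_norm bv))).
  apply: measurable_funM.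
    by apply: measurable_sindotT; [exact: measurable_snd|exact: measurable_fst].
  by apply: (measurableT_comp (bcs_measurable bv)); exact: measurable_snd.
by move=> xi x; rewrite normrM ler_piMl// sin_norm_le1.
Qed.

Lemma measurable_fourier_energy (v : V -> R) : bcs v -> measurable_fun setT (fourier_energy v).
Proof.
move=> bv.
have -> : fourier_energy v = (fun xi => ((2 * pi) ^+ n)^-1 * (costr v xi ^+ 2 + sintr v xi ^+ 2)).
  by apply/funext => xi; rewrite fourier_energyE.
apply: measurable_funM => //; apply: measurable_funD; apply: measurable_funX.
  exact: measurable_costr.
exact: measurable_sintr.
Qed.

Lemma expw_cvg1 (xi : V) : expw k.+1%:R^-1 xi @[k --> \oo] --> (1 : R).
Proof.
have E s : expw s xi = expR (- s * \sum_(i < n) `|xi ord0 i|).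
  by rewrite mulr_sumr expR_sum.
rewrite -[X in _ --> X]expR0; under eq_fun do rewrite E.
apply: continuous_cvg; first exact: continuous_expR.
under eq_fun do rewrite mulNr.
pose S := \sum_(i < n) `|xi ord0 i|.
have : - (k.+1%:R^-1 * S) @[k --> \oo] --> - (0 * S).
  by apply: cvgN; apply: cvgM; [exact: cvg_harmonic|exact: cvg_cst].
by rewrite mul0r oppr0.
Qed.

Definition autocorr (u : V -> R) (h : V) : R := \int[mu]_y (u (y + h) * u y).

Section autocorr_bcs.
Variable u : V -> R.
Hypothesis bu : bcs u.

Let mu_ : measurable_fun setT u. Proof. by case: bu. Qed.

Let madd : measurable_fun setT (fun z : V * V => u (z.2 + z.1)).
Proof.
apply: (measurableT_comp mu_); apply: measurable_rVD.
  exact: measurable_snd.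
exact: measurable_fst.
Qed.

Let msnd : measurable_fun setT (fun z : V * V => u z.2).
Proof. by apply: (measurableT_comp mu_); exact: measurable_snd. Qed.

Let dom : exists2 M, 0 < M & forall h y, `|u (y + h) * u y| <=
  \1_(cube (M + M)) h * (M * M * \1_(cube M) y).
Proof.
have [_ [M M0 uM]] := bu; exists M => // h y; rewrite normrM.
apply: le_trans (_ : (M * \1_(cube M) (y + h)) * (M * \1_(cube M) y) <= _).
  exact: ler_pM.
rewrite !indicE; case: (boolP (y \in cube M)) => yM /=; last by rewrite !mulr0.
case: (boolP (y + h \in cube M)) => yhM /=; last by rewrite mulr0 !mul0r mulr_ge0// mulr1 mulr_ge0 ?ltW.
rewrite mem_set/= ?mul1r ?mulr1//.
move: yM yhM; rewrite !inE => yM yhM.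
have -> : h = (y + h) + (- y) by rewrite addrAC subrr add0r.
by apply: cubeD => // i; rewrite mxE normrN.
Qed.

Let ig M : mu.-integrable setT (EFin \o (\1_(cube M) : V -> R)).
Proof. exact/bcs_integrable/bcs_indic_cube. Qed.

Let ih M : mu.-integrable setT (EFin \o (fun y : V => M * M * \1_(cube M) y)).
Proof. exact/bcs_integrable/bcsZ/bcs_indic_cube. Qed.

Lemma bcs_autocorr : bcs (autocorr u).
Proof.
have [M M0 d] := dom.
have mf : measurable_fun setT (fun z : V * V => u (z.2 + z.1) * u z.2) by exact: measurable_funM.
have I := @Rfubini_integrable _ _ V V R mu mu (fun h y => u (y + h) * u y) _ _ mf (ig _) (ih M) d.
apply: (@bcs_dom _ _ _ (\int[mu]_y (M * M * \1_(cube M) y)) (M + M)).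
  by have /integrableP[/measurable_EFinP] := I.
have i1 h := @prod_dom_integrable1 _ _ V V R mu (fun h y => u (y + h) * u y) _ _ mf (ih M) d h.
move=> h; apply: le_trans (le_normr_Rintegral measurableT (i1 h)) _.
rewrite mulrC -(RintegralZl _ measurableT (ih M)).
apply: le_Rintegral => //.
- by have := i1 h; exact: integrable_norm.
- by apply: RintegrableZ; exact: ih.
Qed.

(** The transform of an autocorrelation is the squared modulus of the
    transform; only the cosine part survives, the autocorrelation being even. *)
Lemma costr_autocorr xi : costr (autocorr u) xi = costr u xi ^+ 2 + sintr u xi ^+ 2.
Proof.
have [M M0 d] := dom.
pose f h y := cos (dotmul h xi) * (u (y + h) * u y).
have mf : measurable_fun setT (fun z : V * V => f z.1 z.2).
  apply: measurable_funM; last exact: measurable_funM.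
  by apply: measurable_cosdotT => //; exact: measurable_fst.
have df h y : `|f h y| <= \1_(cube (M + M)) h * (M * M * \1_(cube M) y).
  by apply: le_trans (d h y); rewrite normrM ler_piMl// cos_norm_le1.
have i1 h := @prod_dom_integrable1 _ _ V V R mu f _ _ mf (ih M) df h.
transitivity (\int[mu]_h \int[mu]_y f h y).
  apply: eq_Rintegral => h _; rewrite /f /autocorr RintegralZl//.
  apply: bcs_integrable; apply: bcsM => //; exact: bcs_translate.
rewrite (Rfubini_dom mf (ig _) (ih M) df).
transitivity (\int[mu]_y ((costr u xi * (cos (dotmul y xi) * u y)) + (sintr u xi * (sin (dotmul y xi) * u y)))).
  apply: eq_Rintegral => y _.
  rewrite -(@Rintegral_translate _ _ _ (- y)); last exact: (measurable_fun_pair1 y mf).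
  rewrite /costr /sintr -!RintegralZr//; last 2 first.
  - exact/bcs_integrable/bcs_sinM.
  - exact/bcs_integrable/bcs_cosM.
  rewrite -RintegralD//; last 2 first.
  - apply: bcs_integrable; under eq_fun do rewrite mulrC; exact/bcsZ/bcs_cosM.
  - apply: bcs_integrable; under eq_fun do rewrite mulrC; exact/bcsZ/bcs_sinM.
  apply: eq_Rintegral => x _; rewrite /f [y + _]addrC subrK dotmulDl dotmulNl cosB; ring.
rewrite RintegralD//; last 2 first.
- exact/bcs_integrable/bcsZ/bcs_cosM.
- exact/bcs_integrable/bcsZ/bcs_sinM.
rewrite !RintegralZl//; last 2 first.
- exact/bcs_integrable/bcs_sinM.
- exact/bcs_integrable/bcs_cosM.
Qed.

(** The difference is controlled by the bound of u times the mean translation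
    error. *)
Lemma autocorr_cvg0 (h_ : nat -> V) : `|h_ k| @[k --> \oo] --> 0 ->
  autocorr u (h_ k) @[k --> \oo] --> autocorr u 0.
Proof.
move=> h0; have [K K0 uK] := bcs_bounded bu.
have t := bcs_translation_cvg h0 bu.
apply/cvgrPdist_le => e e0.
have eK : 0 < e / K by rewrite divr_gt0.
have /cvgr0Pnorm_le/(_ _ eK) := t; apply: filterS => k hk.
have bt := bcs_translate (h_ k) bu.
rewrite distrC /autocorr -RintegralB//; last 2 first.
- exact/bcs_integrable/bcsM.
- by apply/bcs_integrable/bcsM => //; exact: bcs_translate.
have bd : bcs (fun y => u (y + h_ k) - u y) by exact: bcsB.
apply: le_trans (le_normr_Rintegral _ _) _ => //.
  by apply/bcs_integrable/bcsB; apply: bcsM => //; exact: bcs_translate.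
apply: (@le_trans _ _ (\int[mu]_y (K * `|u (y + h_ k) - u y|))).
  apply: le_Rintegral => //.
  - apply/bcs_integrable/bcs_norm/bcsB; apply: bcsM => //; exact: bcs_translate.
  - exact/bcs_integrable/bcsZ/bcs_norm.
  by move=> y _; rewrite addr0 -mulrBl normrM mulrC ler_wpM2r.
rewrite RintegralZl//; last exact/bcs_integrable/bcs_norm.
rewrite -ler_pdivlMl// mulrC; apply: le_trans hk; exact: ler_norm.
Qed.

End autocorr_bcs.

Section plancherel.
Variable u : V -> R.
Hypothesis bu : bcs u.
Let phi := autocorr u.

(** Fubini moves the exponential weight onto the cosine, where it becomes a
    Poisson kernel of width s; the dilation by s normalizes the width. *)
Let smoothed s : 0 < s ->
  \int[mu]_xi (expw s xi * costr phi xi) = \int[mu]_h (phi (s *: h) * poissonw h).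
Proof.
move=> s0; have bphi := bcs_autocorr bu.
pose f xi h := expw s xi * (cos (dotmul h xi) * phi h).
have mphi : measurable_fun setT phi by case: bphi.
have mf : measurable_fun setT (fun z : V * V => f z.1 z.2).
  apply: measurable_funM.
    by apply: (measurableT_comp (measurable_expw s)); exact: measurable_fst.
  apply: measurable_funM; last by apply: (measurableT_comp mphi); exact: measurable_snd.
  by apply: measurable_cosdotT; [exact: measurable_snd|exact: measurable_fst].
have df xi h : `|f xi h| <= expw s xi * `|phi h|.
  rewrite !normrM (ger0_norm (expw_ge0 _ _)) ler_wpM2l ?expw_ge0//.
  by rewrite ler_piMl// cos_norm_le1.
have ig := @integrable_expw R n _ s0.
have ih := bcs_integrable (bcs_norm bphi).
transitivity (\int[mu]_xi \int[mu]_h f xi h).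
  apply: eq_Rintegral => xi _; rewrite /f RintegralZl//.
  exact/bcs_integrable/bcs_cosM.
rewrite (Rfubini_dom mf ig ih df).
pose P (h : V) := \prod_(i < n) (2 * s / (s ^+ 2 + h ord0 i ^+ 2)).
transitivity (\int[mu]_h (phi h * P h)).
  apply: eq_Rintegral => h _.
  rewrite -[P h]mul1r -[X in X * P h]cos0 -(Rintegral_expw_cos h 0 s0) -RintegralZl//.
    by apply: eq_Rintegral => xi _; rewrite /f addr0; ring.
  apply: (le_Rintegrable _ _ ig).
    by apply: measurable_funM; [exact: measurable_expw|exact: measurable_cosdot].
  by move=> y; rewrite normrM ger0_norm ?expw_ge0// ler_piMr ?cos_norm_le1// expw_ge0.
have iF : mu.-integrable setT (EFin \o (fun h => phi h * P h)).
  apply: bcs_integrable; apply: (@bcsMr _ _ phi P ((2 / s) ^+ n)) => //.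
    apply: (@measurable_prod_coord R n (fun=> fun t => 2 * s / (s ^+ 2 + t ^+ 2))) => i.
    apply: measurable_funM => //.
    apply: continuous_measurable_fun => x; apply: cvgV.
      by apply: lt0r_neq0; rewrite ltr_pwDl ?exprn_gt0// sqr_ge0.
    by apply: cvgD; [exact: cvg_cst|apply: cvgM; exact: cvg_id].
  move=> h; rewrite ger0_norm; last first.
    apply: prodr_ge0 => i _; apply: divr_ge0; first by rewrite mulr_ge0// ltW.
    by rewrite addr_ge0// sqr_ge0.
  rewrite -[X in _ <= _ ^+ X](card_ord n) -prodr_const; apply: ler_prod => i _.
  have p0 : 0 < s ^+ 2 + h ord0 i ^+ 2 by rewrite ltr_pwDl ?exprn_gt0// sqr_ge0.
  have s1 : 0 <= 2 * s by rewrite mulr_ge0// ltW.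
  rewrite divr_ge0 ?(ltW p0)//= ler_pdivrMr// mulrDr expr2.
  have -> : 2 / s * (s * s) = 2 * s by field; exact: lt0r_neq0.
  by rewrite lerDl mulr_ge0 ?sqr_ge0// divr_ge0// ltW.
have := Rintegral_dilate s0 iF.
have E h : phi (s *: h) * P (s *: h) = s^-1 ^+ n * (phi (s *: h) * poissonw h).
  rewrite mulrCA; congr (_ * _); rewrite /P /poissonw.
  transitivity (\prod_(i < n) (s^-1 * (2 / (1 + h ord0 i ^+ 2)))).
    apply: eq_bigr => i _; rewrite mxE.
    have h1 : 0 < 1 + h ord0 i ^+ 2 by rewrite ltr_pwDl// sqr_ge0.
    have -> : s ^+ 2 + (s * h ord0 i) ^+ 2 = s * (s * (1 + h ord0 i ^+ 2)) by ring.
    by field; rewrite (lt0r_neq0 s0) (lt0r_neq0 h1).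
  by rewrite big_split/= prodr_const card_ord.
under eq_Rintegral do rewrite E.
rewrite RintegralZl//; last first.
  have [K K0 pK] := bcs_bounded bphi.
  apply: (le_Rintegrable _ _ (RintegrableZ K (@integrable_poissonw R n))).
    apply: measurable_funM; last exact: measurable_poissonw.
    by apply: (measurableT_comp mphi); apply: measurable_rVZ; exact: measurable_id.
  by move=> h; rewrite normrM (ger0_norm (poissonw_ge0 _)) ler_wpM2r// poissonw_ge0.
by move/mulfI => -> //; rewrite expf_neq0// invr_neq0// lt0r_neq0.
Qed.

Let smoothed_cvg :
  \int[mu]_xi (expw k.+1%:R^-1 xi * costr phi xi) @[k --> \oo] --> phi 0 * (2 * pi) ^+ n.
Proof.
have bphi := bcs_autocorr bu.
have mphi : measurable_fun setT phi by case: bphi.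
have [K K0 pK] := bcs_bounded bphi.
have s0 k : 0 < k.+1%:R^-1 :> R by rewrite invr_gt0.
under eq_fun do rewrite smoothed//.
have -> : phi 0 * (2 * pi) ^+ n = \int[mu]_h (phi 0 * poissonw h).
  rewrite RintegralZl//; last exact: integrable_poissonw.
  by rewrite /Rintegral integral_poissonw.
apply: (@Rdominated_cvg _ _ _ mu _ _ (fun h => K * poissonw h) _ _ _ _ _).2.
- move=> k; apply: measurable_funM; last exact: measurable_poissonw.
  by apply: (measurableT_comp mphi); apply: measurable_rVZ; exact: measurable_id.
- by apply: measurable_funM => //; exact: measurable_poissonw.
- apply: aeW => h /=; apply: cvgM; last exact: cvg_cst.
  apply: autocorr_cvg0 => //; under eq_fun do rewrite normrZ ger0_norm ?ltW//.
  rewrite -(mul0r `|h|); apply: cvgM; last exact: cvg_cst.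
  exact: cvg_harmonic.
- by apply: RintegrableZ; exact: integrable_poissonw.
- by move=> k h; rewrite normrM (ger0_norm (poissonw_ge0 _)) ler_wpM2r// poissonw_ge0.
Qed.

(** Tested against exp(-s |xi|_1), the energy becomes the average of the
    autocorrelation against a Poisson kernel of width s, which concentrates at
    0, where the autocorrelation is the integral of u^2. Monotone convergence
    removes the weight. *)
Lemma plancherel :
  (\int[mu]_xi (fourier_energy u xi)%:E = (\int[mu]_x (u x ^+ 2))%:E)%E.
Proof.
have bphi := bcs_autocorr bu.
have mphi : measurable_fun setT phi by case: bphi.
have s0 k : 0 < k.+1%:R^-1 :> R by rewrite invr_gt0.
pose c := ((2 * pi) ^+ n)^-1 : R.
have c0 : 0 < (2 * pi) ^+ n :> R by rewrite exprn_gt0// mulr_gt0// pi_gt0.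
have FE xi : fourier_energy u xi = c * costr phi xi.
  by rewrite fourier_energyE costr_autocorr.
have mF := measurable_fourier_energy bu.
have C0 xi : 0 <= costr phi xi.
  by rewrite costr_autocorr// addr_ge0 ?sqr_ge0.
pose g k xi := (expw k.+1%:R^-1 xi * fourier_energy u xi)%:E.
have -> : (\int[mu]_xi (fourier_energy u xi)%:E = \int[mu]_xi (limn (g^~ xi)))%E.
  apply: eq_integral => xi _; apply/esym/cvg_lim => //.
  apply: cvg_EFin; first exact: nearW.
  rewrite -[X in _ --> X]mul1r; apply: cvgM; last exact: cvg_cst.
  exact: expw_cvg1.
rewrite monotone_convergence//; last 3 first.
- move=> k; apply/measurable_EFinP/measurable_funM => //; exact: measurable_expw.
- by move=> k xi _; rewrite lee_fin mulr_ge0 ?expw_ge0 ?fourier_energy_ge0.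
- move=> xi _ j k jk; rewrite lee_fin ler_wpM2r ?fourier_energy_ge0//.
  apply: ler_prod => i _; rewrite expR_ge0/= ler_expR !mulNr lerN2 ler_wpM2r//.
  by rewrite lef_pV2 ?posrE// ler_nat.
apply/cvg_lim => //.
have -> : \int[mu]_x (u x ^+ 2) = c * (phi 0 * (2 * pi) ^+ n).
  rewrite mulrCA mulVf ?lt0r_neq0// mulr1 /phi /autocorr.
  by apply: eq_Rintegral => x _; rewrite addr0.
have E k : (\int[mu]_xi g k xi = (c * \int[mu]_xi (expw k.+1%:R^-1 xi * costr phi xi))%:E)%E.
  have I : mu.-integrable setT (EFin \o (fun xi => expw k.+1%:R^-1 xi * costr phi xi)).
    pose B := \int[mu]_x `|phi x|.
    apply: (le_Rintegrable _ _ (RintegrableZ B (@integrable_expw R n _ (s0 k)))).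
      by apply: measurable_funM; [exact: measurable_expw|exact: measurable_costr].
    move=> xi; rewrite normrM (ger0_norm (expw_ge0 _ _)) mulrC ler_wpM2r ?expw_ge0//.
    apply: le_trans (le_normr_Rintegral measurableT (bcs_integrable (bcs_cosM xi bphi))) _.
    apply: le_Rintegral => //.
    - exact/bcs_integrable/bcs_norm/bcs_cosM.
    - exact/bcs_integrable/bcs_norm.
    - by move=> x _; rewrite normrM ler_piMl// cos_norm_le1.
  rewrite -(RintegralZl c measurableT I) EFin_Rintegral; last exact: RintegrableZ.
  by apply: eq_integral => xi _; rewrite /g FE; congr EFin; ring.
under eq_fun do rewrite E.
apply: cvg_EFin; first exact: nearW.
by apply: cvgM; [exact: cvg_cst|exact: smoothed_cvg].
Qed.

End plancherel.

End trig_transform.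

(** * The Euclidean norm and its logarithm *)

Section ln_near0.
Context {R : realType}.
Notation leb := (@lebesgue_measure R).

Definition lnminus1 (t : R) : R := Num.max 0 (- ln `|t|).

Lemma measurable_lnminus1 : measurable_fun setT lnminus1.
Proof.
apply: measurable_maxr => //; apply: measurableT_comp => //.
by apply: measurableT_comp; [exact: measurable_ln|exact: normr_measurable].
Qed.

Lemma lnminus1_ge0 t : 0 <= lnminus1 t.
Proof. by rewrite /lnminus1 le_max lexx. Qed.

Let primln (t : R) : R := t - t * ln t.

Let is_derive_primln (t : R) : 0 < t -> is_derive t 1 primln (- ln t).
Proof.
move=> t0.
have d1 := is_derive1_ln t0.
have d := is_deriveB (@is_derive_id R R t 1) (is_deriveM (@is_derive_id R R t 1) d1).
apply: (is_derive_eq d); rewrite /GRing.scale/=.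
by rewrite mulfV ?lt0r_neq0// mulr1 opprD addNKr.
Qed.

Let cont_primln (t : R) : 0 < t -> {for t, continuous primln}.
Proof.
move=> t0; apply: differentiable_continuous; apply/derivable1_diffP.
by have [] := is_derive_primln t0.
Qed.

Let integral_lnN (a : R) : 0 < a -> a < 1 ->
  (\int[leb]_(t in `[a, 1%R]) (- ln t)%:E <= 1)%E.
Proof.
move=> a0 a1.
rewrite (@continuous_FTC2 R (fun t => - ln t) primln a 1 a1).
- rewrite /primln ln1 mulr0 subr0 -EFinB lee_fin.
  have : a * ln a <= 0 by rewrite pmulr_rle0// ln_le0// ltW.
  by lra.
- apply: continuous_in_subspaceT => t; rewrite inE/= in_itv/= => /andP[at1 _].
  apply: cvgN; apply: continuous_ln; exact: lt_le_trans at1.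
- split.
  + move=> t; rewrite in_itv/= => /andP[at1 _].
    by have [] := is_derive_primln (lt_trans a0 at1).
  + by apply: cvg_at_right_filter; exact: cont_primln.
  + by apply: cvg_at_left_filter; exact: cont_primln.
- move=> t; rewrite in_itv/= => /andP[at1 _]; rewrite derive1E.
  by have [_ ->] := is_derive_primln (lt_trans a0 at1).
Qed.

(** The primitive t - t ln t is bounded near 0; the half-open interval is
    exhausted by closed ones on which it is continuously differentiable. *)
Lemma integrable_lnminus1 : leb.-integrable setT (EFin \o lnminus1).
Proof.
have me : measurable_fun setT (EFin \o lnminus1).
  by apply/measurable_EFinP; exact: measurable_lnminus1.
apply/integrableP; split => //.
under eq_integral do rewrite /= ger0_norm ?lnminus1_ge0//.
rewrite integral_even_split; [|exact: measurable_lnminus1|exact: lnminus1_ge0].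
(* 1/(i + 2) < 1 keeps the intervals nondegenerate *)
pose F (i : nat) : set R := `[i.+2%:R^-1, 1]%classic.
have F01 i : 0 < i.+2%:R^-1 :> R by rewrite invr_gt0.
have F1 i : i.+2%:R^-1 < 1 :> R by rewrite invf_lt1// ltr1n.
have ndF : nondecreasing_seq F.
  move=> i j ij; apply/subsetPset => t; rewrite /F/= !in_itv/= => /andP[h ->].
  by rewrite andbT; apply: le_trans h; rewrite lef_pV2 ?posrE// ler_nat.
have FU : \bigcup_i F i = `]0, 1]%classic.
  apply/seteqP; split => t /=.
    by move=> [i _]; rewrite /F/= !in_itv/= => /andP[h ->]; rewrite (lt_le_trans _ h).
  rewrite in_itv/= => /andP[t0 t1].
  have [k _ hk] := near_infty_natSinv_lt (PosNum t0).
  exists k => //; rewrite /F/= in_itv/= t1 andbT.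
  apply: le_trans (ltW (hk k (leqnn k))) => /=.
  by rewrite lef_pV2 ?posrE// ler_nat.
have m2 : measurable_fun setT (fun x => (lnminus1 x + lnminus1 (- x))%:E).
  apply/measurable_EFinP; apply: measurable_funD; first exact: measurable_lnminus1.
  by apply: measurableT_comp => //; exact: measurable_lnminus1.
have -> : (\int[leb]_(x in `[0%R, +oo[) (lnminus1 x + lnminus1 (- x))%:E =
   \int[leb]_(x in `]0%R, 1%R]) (lnminus1 x + lnminus1 (- x))%:E)%E.
  rewrite integral_mkcond [RHS]integral_mkcond; apply: eq_integral => x _.
  rewrite !patchE; case: ifPn => [|xn]; case: ifPn => [|xm] //.
  - rewrite inE/= in_itv/= andbT => x0; rewrite /lnminus1 normrN ger0_norm//.
    move: xm; rewrite notin_setE/= in_itv/=; have [xgt0|xle0 _] := ltP 0 x.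
      move=> /= /negP; rewrite -ltNge => x1.
      have -> : Num.max 0 (- ln x) = 0; last by rewrite addr0.
      by apply/max_idPl; rewrite oppr_le0 ln_ge0// ltW.
    by rewrite ln0// oppr0 maxxx addr0.
  - move: xn => /[swap]; rewrite inE/= in_itv/= => /andP[x0 _].
    by rewrite notin_setE/= in_itv/= andbT (ltW x0).
have mF i : measurable (F i) by exact: measurable_itv.
have h := @ge0_nondecreasing_set_cvg_integral _ (measurableTypeR R) R F
  (fun x => (lnminus1 x + lnminus1 (- x))%:E) leb ndF mF
  (fun i => measurable_funTS m2) (fun i x _ => addr_ge0 (lnminus1_ge0 x) (lnminus1_ge0 (- x))).
rewrite FU in h; rewrite -(cvg_lim _ h)//.
apply: (@le_lt_trans _ _ 2%:E); last exact: ltry.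
apply: lime_le; first by apply/cvg_ex; eexists; exact: h.
apply: nearW => i.
apply: (@le_trans _ _ (\int[leb]_(x in F i) (2%:E * (- ln x)%:E))%E).
  rewrite le_eqVlt; apply/orP; left; apply/eqP; apply: eq_integral => x.
  rewrite inE /F/= in_itv/= => /andP[ix x1].
  have x0 : 0 < x by exact: lt_le_trans ix.
  rewrite /lnminus1 normrN ger0_norm ?(ltW x0)//.
  have -> : Num.max 0 (- ln x) = - ln x by apply/max_idPr; rewrite oppr_ge0 ln_le0.
  by rewrite -EFinM; congr EFin; ring.
have ml : measurable_fun (F i) (fun x => (- ln x)%:E).
  by apply/measurable_EFinP/measurable_funTS; apply: measurableT_comp => //; exact: measurable_ln.
rewrite (ge0_integralZl leb (mF i) ml)//.
  rewrite -[leRHS]mule1 lee_pmul2l//; exact: integral_lnN.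
move=> x; rewrite /F/= in_itv/= => /andP[ix x1].
by rewrite lee_fin oppr_ge0 ln_le0.
Qed.

End ln_near0.

Section enorm_facts.
Context {R : realType}.
Notation leb := (@lebesgue_measure R).

Lemma dotmul_ge0 n (x : 'rV[R]_n) : 0 <= dotmul x x.
Proof. by apply: sumr_ge0 => i _; rewrite -expr2 sqr_ge0. Qed.

Lemma enorm_ge0 n (x : 'rV[R]_n) : 0 <= enorm x.
Proof. exact: sqrtr_ge0. Qed.

Lemma enorm_sqr n (x : 'rV[R]_n) : enorm x ^+ 2 = dotmul x x.
Proof. by rewrite /enorm sqr_sqrtr// dotmul_ge0. Qed.

Lemma le_coord_enorm n (x : 'rV[R]_n) i : `|x ord0 i| <= enorm x.
Proof.
rewrite -(@ler_sqr R) ?nnegrE ?enorm_ge0// enorm_sqr /dotmul (bigD1 i)//= real_normK ?num_real//.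
by rewrite -expr2 lerDl; apply: sumr_ge0 => j _; rewrite -expr2 sqr_ge0.
Qed.

Lemma enorm_le n (x : 'rV[R]_n) (M : R) : 0 <= M -> (forall i, `|x ord0 i| <= M) ->
  enorm x <= n%:R * M.
Proof.
move=> M0 xM; rewrite -(@ler_sqr R) ?nnegrE ?enorm_ge0 ?mulr_ge0//.
rewrite enorm_sqr exprMn; apply: (@le_trans _ _ (\sum_(i < n) M ^+ 2)).
  apply: ler_sum => i _; rewrite -expr2 -real_normK ?num_real// ler_sqr ?nnegrE//.
rewrite sumr_const card_ord -[leLHS]mulr_natl ler_wpM2r ?sqr_ge0// -natrX ler_nat.
by rewrite expnS expn1; case: (n) => // m; rewrite leq_pmulr.
Qed.

Lemma dotmul_le n (x y : 'rV[R]_n) : `|dotmul x y| <= n%:R * `|x| * enorm y.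
Proof.
apply: le_trans (ler_norm_sum _ _ _) _.
apply: (@le_trans _ _ (\sum_(i < n) (`|x| * enorm y))).
  apply: ler_sum => i _; rewrite normrM; apply: ler_pM => //.
    exact: rV_norm_coord.
  exact: le_coord_enorm.
by rewrite sumr_const card_ord -[leLHS]mulr_natl mulrA.
Qed.

Definition lnminus n (x : 'rV[R]_n) : R := Num.max 0 (- ln (enorm x)).
Definition lnplus n (x : 'rV[R]_n) : R := Num.max 0 (ln (enorm x)).

Lemma lnminus_ge0 n (x : 'rV[R]_n) : 0 <= lnminus x.
Proof. by rewrite /lnminus le_max lexx. Qed.

Lemma lnplus_ge0 n (x : 'rV[R]_n) : 0 <= lnplus x.
Proof. by rewrite /lnplus le_max lexx. Qed.

Lemma measurable_ln_enorm n : measurable_fun setT (fun x : 'rV[R]_n => ln (enorm x)).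
Proof.
apply: measurableT_comp; first exact: measurable_ln.
by apply: measurable_enorm; exact: measurable_id.
Qed.

Lemma measurable_lnminus n : measurable_fun setT (@lnminus n).
Proof.
by apply: measurable_maxr => //; apply: measurableT_comp => //; exact: measurable_ln_enorm.
Qed.

Lemma measurable_lnplus n : measurable_fun setT (@lnplus n).
Proof. by apply: measurable_maxr => //; exact: measurable_ln_enorm. Qed.

(** On the unit ball |ln|x|| <= |ln|x_0||, so a logarithm in the first
    coordinate times the indicator of a cube in the others dominates. *)
Lemma integrable_lnminus n : (lebesgue_rV n.+1).-integrable setT (EFin \o @lnminus n.+1).
Proof.
apply/integrableP; split; first by apply/measurable_EFinP; exact: measurable_lnminus.
under eq_integral do rewrite /= ger0_norm ?lnminus_ge0//.
(* the logarithm in the first coordinate, a bounded window in the others *)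
pose g (i : 'I_n.+1) : R -> R := if i == ord0 then @lnminus1 R else \1_(`[-1, 1]%classic).
have ig i : leb.-integrable setT (EFin \o g i).
  by rewrite /g; case: ifP => _; [exact: integrable_lnminus1|exact: integrable_indic_itv].
have g0 i t : 0 <= g i t by rewrite /g; case: ifP => _ //; exact: lnminus1_ge0.
apply: (@le_lt_trans _ _ (\int[lebesgue_rV n.+1]_x (\prod_(i < n.+1) g i (x ord0 i))%:E)%E); last first.
  by rewrite integral_prod_rV// ltry.
apply: ae_ge0_le_integral => //.
- by move=> x _; rewrite lee_fin lnminus_ge0.
- by apply/measurable_EFinP; exact: measurable_lnminus.
- by move=> x _; rewrite lee_fin prodr_ge0.
- apply/measurable_EFinP; apply: measurable_prod_coord => i.
  by have /integrableP[/measurable_EFinP] := ig i.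
have := @hyperplane_null R n.+1 ord0 0; apply: filterS => x x0 _; rewrite lee_fin.
have [x1|x1] := leP 1 (enorm x).
  have -> : lnminus x = 0 by apply/max_idPl; rewrite oppr_le0 ln_ge0.
  exact: prodr_ge0.
have xx0 : 0 < `|x ord0 ord0| by rewrite normr_gt0; apply/eqP.
have xe := le_coord_enorm x.
have e0 : 0 < enorm x by exact: lt_le_trans (xe ord0).
rewrite (bigD1 ord0)//= big1 ?mulr1; last first.
  move=> i i0; rewrite /g (negbTE i0) indicE mem_set//= in_itv/= -ler_norml.
  exact: le_trans (xe i) (ltW x1).
rewrite /g eqxx /lnminus /lnminus1 ge_max le_max lexx/= le_max; apply/orP; right.
by rewrite lerN2 ler_ln// posrE.
Qed.

End enorm_facts.

(** * Oscillatory integrals over the unit cube *)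

Section unit_box.
Context {R : realType}.
Notation leb := (@lebesgue_measure R).

Definition box n (z : 'rV[R]_n) : R := \prod_(i < n) \1_(`[0, 1]%classic : set R) (z ord0 i).

Lemma box_ge0 n (z : 'rV[R]_n) : 0 <= box z.
Proof. exact: prodr_ge0. Qed.

Lemma box_le_cube n (z : 'rV[R]_n) : box z <= \1_(cube 1) z.
Proof.
rewrite indic_cube; apply: ler_prod => i _; rewrite indicE ler0n/= !indicE.
case: (boolP (_ \in `[0, 1]%classic)) => //=; rewrite inE/= in_itv/= => /andP[h1 h2].
by rewrite mem_set//= in_itv/= h2 (le_trans _ h1).
Qed.

Lemma measurable_box n : measurable_fun setT (@box n).
Proof.
apply: (@measurable_prod_coord R n (fun=> \1_(`[0, 1]%classic : set R))) => i.
exact: measurable_indic.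
Qed.

Lemma bcs_box n : bcs (@box n).
Proof.
apply: (@bcs_dom _ _ _ 1 1); first exact: measurable_box.
by move=> x; rewrite mul1r ger0_norm ?box_ge0// box_le_cube.
Qed.

Lemma Rintegral_indic01 : \int[leb]_t \1_(`[0, 1]%classic : set R) t = 1.
Proof.
rewrite /Rintegral integral_indic// setIT.
have := @lebesgue_measure_itv R `[0, 1]; rewrite /= lte_fin ltr01 oppr0 adde0.
exact: (congr1 fine).
Qed.

Lemma Rintegral_box n : \int[lebesgue_rV n]_z box z = 1.
Proof.
rewrite /Rintegral (@integral_prod_rV _ _ (fun=> \1_(`[0, 1]%classic : set R)))//=; last first.
  by move=> i; exact: integrable_indic_itv.
rewrite big1// => i _.
exact: Rintegral_indic01.
Qed.

Lemma box_cons n a (y : 'rV[R]_n) : box (rV_cons (a, y)) = \1_(`[0, 1]%classic : set R) a * box y.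
Proof.
rewrite /box big_ord_recl rV_cons_head; congr (_ * _).
by apply: eq_bigr => i _; rewrite rV_cons_lift.
Qed.

(** The primitive sin(w a + psi) / w varies by at most 2/|w| over the unit
    interval. *)
Lemma osc_box1 (w psi : R) : `|w| * `|\int[leb]_a (\1_(`[0, 1]%classic : set R) a * cos (w * a + psi))| <= 2.
Proof.
have [->|w0] := eqVneq w 0; first by rewrite normr0 mul0r.
have d (t : R) : is_derive t 1 (fun a => w^-1 * sin (w * a + psi)) (cos (w * t + psi)).
  have d1 : is_derive t 1 (fun a => w * a + psi) (w + 0).
    exact: (is_deriveD (is_derive_linear w t) (is_derive_cst psi t 1)).
  have d2 := is_deriveZ w^-1 (@is_derive1_comp R sin (fun a => w * a + psi) t _ _ (is_derive_sin (w * t + psi)) d1).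
  apply: (is_derive_eq d2); rewrite /GRing.scale/= addr0 mulrCA mulVf// mulr1//.
have cF (t : R) : {for t, continuous (fun a => w^-1 * sin (w * a + psi))}.
  by apply: differentiable_continuous; apply/derivable1_diffP; have [] := d t.
have -> : \int[leb]_a (\1_(`[0, 1]%classic : set R) a * cos (w * a + psi)) =
    w^-1 * sin (w * 1 + psi) - w^-1 * sin (w * 0 + psi).
  transitivity (\int[leb]_(a in `[0, 1]) cos (w * a + psi)).
    rewrite [RHS]Rintegral_mkcond; apply: eq_Rintegral => a _.
    by rewrite patchE indicE; case: (_ \in _); rewrite ?mul1r ?mul0r.
  rewrite /Rintegral (@continuous_FTC2 R _ (fun a => w^-1 * sin (w * a + psi)) 0 1)//.
  - apply: continuous_subspaceT => t; apply: continuous_comp; last exact: continuous_cos.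
    by apply: cvgD; [apply: cvgM; [exact: cvg_cst|exact: cvg_id]|exact: cvg_cst].
  - split; [by move=> t _; have [] := d t|by apply: cvg_at_right_filter; exact: cF|by apply: cvg_at_left_filter; exact: cF].
  - by move=> t _; rewrite derive1E; have [_ ->] := d t.
rewrite -mulrBr normrM mulrA -normrM mulfV// normr1 mul1r.
apply: le_trans (ler_normB _ _) _; rewrite (_ : 2 = 1 + 1)//.
by apply: lerD; exact: sin_norm_le1.
Qed.

(** Integrate first in the i-th coordinate, where the oscillation gains the
    factor 1/|zeta_i|; the remaining integral is over a probability density.
    The phase psi absorbs the other coordinates. *)
Lemma osc_box n (zeta : 'rV[R]_n) psi i :
  `|zeta ord0 i| * `|\int[lebesgue_rV n]_z (box z * cos (dotmul z zeta + psi))| <= 2.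
Proof.
elim: n zeta psi i => [|n IH] zeta psi i; first by case: i.
have i1 : leb.-integrable setT (EFin \o (\1_(`[0, 1]%classic : set R))).
  exact: integrable_indic_itv.
have ib := bcs_integrable (@bcs_box n).
have mc m (ze : 'rV[R]_m) ps : measurable_fun setT (fun z : 'rV[R]_m => cos (dotmul z ze + ps)).
  by under eq_fun do rewrite dotmulC; exact: measurable_cosdot.
have dB a (y : 'rV[R]_n) : `|box (rV_cons (a, y)) * cos (dotmul (rV_cons (a, y)) zeta + psi)| <=
   \1_(`[0, 1]%classic : set R) a * box y.
  rewrite box_cons normrM ger0_norm ?mulr_ge0 ?box_ge0//.
  by rewrite ler_piMr ?cos_norm_le1// mulr_ge0// box_ge0.
have mf : measurable_fun setT (fun z : 'rV[R]_n.+1 => box z * cos (dotmul z zeta + psi)).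
  by apply: measurable_funM; [exact: measurable_box|exact: mc].
rewrite (Rintegral_rVS mf i1 ib dB).
have E a y : box (rV_cons (a, y)) * cos (dotmul (rV_cons (a, y)) zeta + psi) =
   \1_(`[0, 1]%classic : set R) a * (box y * cos (dotmul y (rV_behead zeta) + (zeta ord0 ord0 * a + psi))).
  by rewrite box_cons dotmulC dotmul_cons dotmulC mulrA; congr (_ * cos _); rewrite addrCA addrA.
have dE a y : `|\1_(`[0, 1]%classic : set R) a * (box y * cos (dotmul y (rV_behead zeta) + (zeta ord0 ord0 * a + psi)))|
   <= \1_(`[0, 1]%classic : set R) a * box y by rewrite -E; exact: dB.
have mfE : measurable_fun setT (fun z : measurableTypeR R * 'rV[R]_n =>
  \1_(`[0, 1]%classic : set R) z.1 * (box z.2 * cos (dotmul z.2 (rV_behead zeta) + (zeta ord0 ord0 * z.1 + psi)))).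
  apply: measurable_funM.
    have m01 : measurable_fun setT (\1_(`[0, 1]%classic : set R) : measurableTypeR R -> R).
      exact: measurable_indic.
    exact: (measurableT_comp m01 measurable_fst).
  apply: measurable_funM; first exact: (measurableT_comp (@measurable_box n)).
  apply: (measurableT_comp (continuous_measurable_fun (@continuous_cos R))).
  apply: measurable_funD; first by apply: measurable_dotmul => //.
  by apply: measurable_funD => //; apply: measurable_funM.
under eq_Rintegral do under eq_Rintegral do rewrite E.
case: (unliftP ord0 i) => [j ->|->].
  have Ib a : (lebesgue_rV n).-integrable setT
      (EFin \o (fun y => box y * cos (dotmul y (rV_behead zeta) + (zeta ord0 ord0 * a + psi)))).
    apply: (le_Rintegrable _ _ ib).
      by apply: measurable_funM; [exact: measurable_box|exact: mc].
    by move=> y; rewrite normrM ger0_norm ?box_ge0// ler_piMr ?cos_norm_le1// box_ge0.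
  have [z0|z0] := eqVneq (`|zeta ord0 (lift ord0 j)|) 0; first by rewrite z0 mul0r.
  have zp : 0 < `|zeta ord0 (lift ord0 j)| by rewrite lt0r z0 normr_ge0.
  rewrite -ler_pdivlMl//.
  have If := @Rfubini_integrable _ _ (measurableTypeR R) 'rV[R]_n R leb (lebesgue_rV n) _ _ _ mfE i1 ib dE.
  apply: le_trans (le_normr_Rintegral measurableT If) _.
  apply: (@le_trans _ _ (\int[leb]_a (\1_(`[0, 1]%classic : set R) a * (`|zeta ord0 (lift ord0 j)|^-1 * 2)))).
    apply: le_Rintegral => //.
    - exact: integrable_norm If.
    - under eq_fun do rewrite mulrC; exact: RintegrableZ.
    move=> a _; rewrite RintegralZl// normrM ger0_norm// ler_wpM2l//.
    by rewrite ler_pdivlMl// -rV_beheadE; exact: IH.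
  rewrite RintegralZr// [X in X * _](_ : _ = 1) ?mul1r//.
  exact: Rintegral_indic01.
rewrite (@Rfubini_dom _ _ (measurableTypeR R) 'rV[R]_n R leb (lebesgue_rV n) _ _ _ mfE i1 ib dE).
have Ey (y : 'rV[R]_n) : \int[leb]_a (\1_(`[0, 1]%classic : set R) a * (box y * cos (dotmul y (rV_behead zeta) + (zeta ord0 ord0 * a + psi)))) =
  box y * \int[leb]_a (\1_(`[0, 1]%classic : set R) a * cos (zeta ord0 ord0 * a + (dotmul y (rV_behead zeta) + psi))).
  rewrite -RintegralZl//.
    by apply: eq_Rintegral => a _; rewrite mulrCA; congr (_ * (_ * cos _)); rewrite addrCA.
  apply: (le_Rintegrable _ _ i1).
    apply: measurable_funM => //; apply: (measurableT_comp (continuous_measurable_fun (@continuous_cos R))).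
    by apply: measurable_funD => //; exact: measurable_funM.
  by move=> a; rewrite normrM ger0_norm// ler_piMr// cos_norm_le1.
have [z0|z0] := eqVneq (`|zeta ord0 ord0|) 0; first by rewrite z0 mul0r.
have zp : 0 < `|zeta ord0 ord0| by rewrite lt0r z0 normr_ge0.
rewrite -ler_pdivlMl//.
have dE' (y : 'rV[R]_n) a : `|\1_(`[0, 1]%classic : set R) a * (box y * cos (dotmul y (rV_behead zeta) + (zeta ord0 ord0 * a + psi)))|
   <= box y * \1_(`[0, 1]%classic : set R) a by rewrite [leRHS]mulrC; exact: dE.
have mfE' : measurable_fun setT (fun z : 'rV[R]_n * measurableTypeR R =>
  \1_(`[0, 1]%classic : set R) z.2 * (box z.1 * cos (dotmul z.1 (rV_behead zeta) + (zeta ord0 ord0 * z.2 + psi)))).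
  exact: (measurableT_comp mfE (@measurable_swap _ _ _ _)).
have If := @Rfubini_integrable _ _ 'rV[R]_n (measurableTypeR R) R (lebesgue_rV n) leb _ _ _ mfE' ib i1 dE'.
apply: le_trans (le_normr_Rintegral measurableT If) _.
apply: (@le_trans _ _ (\int[lebesgue_rV n]_y (box y * (`|zeta ord0 ord0|^-1 * 2)))).
  apply: le_Rintegral => //.
  - exact: integrable_norm If.
  - under eq_fun do rewrite mulrC; exact: RintegrableZ.
  move=> y _; rewrite Ey normrM ger0_norm ?box_ge0// ler_wpM2l ?box_ge0//.
  by rewrite ler_pdivlMl//; exact: osc_box1.
by rewrite RintegralZr// Rintegral_box mul1r.
Qed.

End unit_box.

(** * Averages over shifted cubes *)

Section averaging.
Context {R : realType} {n : nat}.
Local Notation V := 'rV[R]_n.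
Local Notation mu := (@lebesgue_rV R n).

Let lip1 (f df : R -> R) : (forall t : R, is_derive t 1 f (df t)) -> (forall t, `|df t| <= 1) ->
  forall t, `|f t - f 0| <= `|t|.
Proof.
move=> fd d1 t.
have cf (x : R) : {for x, continuous f}.
  by apply: differentiable_continuous; apply/derivable1_diffP; have [] := fd x.
have [t0|t0] := leP 0 t.
  have [c _ ->] := MVT_segment t0 (fun x _ => fd x) (continuous_subspaceT cf).
  by rewrite subr0 normrM ler_piMl.
have [c _ E] := MVT_segment (ltW t0) (fun x _ => fd x) (continuous_subspaceT cf).
by rewrite distrC E sub0r normrM normrN ler_piMl.
Qed.

Lemma sin_le_norm (t : R) : `|sin t| <= `|t|.
Proof. by have := lip1 (@is_derive_sin R) (@cos_norm_le1 R) t; rewrite sin0 subr0. Qed.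

Lemma cosB1_le_norm (t : R) : `|cos t - 1| <= `|t|.
Proof.
rewrite -cos0; apply: (lip1 (@is_derive_cos R)) => x.
by rewrite normrN sin_norm_le1.
Qed.

Variables (d c : R) (e : V).

Definition ashift (z : V) : V := d *: (e + c *: z).

Lemma measurable_ashift : measurable_fun setT ashift.
Proof.
apply: measurable_rVZ; apply: measurable_rVD => //.
by apply: measurable_rVZ; exact: measurable_id.
Qed.

Lemma ashift_bound z : cube 1 z -> `|ashift z| <= `|d| * (`|e| + `|c|).
Proof.
move=> z1; rewrite /ashift normrZ ler_wpM2l//; apply: le_trans (ler_normD _ _) _.
rewrite lerD2l normrZ ler_piMr//; exact: rV_norm_le.
Qed.

(** The mean of v over the cube x - d(e + c [0,1]^n): a convolution that is
    explicit enough to control its support and its Fourier symbol. *)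
Definition avg (v : V -> R) (x : V) : R := \int[mu]_z (box z * v (x - ashift z)).

(** With avgs, the real and the imaginary part of the Fourier symbol of the
    average. *)
Definition avgc (xi : V) : R := \int[mu]_z (box z * cos (dotmul (ashift z) xi)).
Definition avgs (xi : V) : R := \int[mu]_z (box z * sin (dotmul (ashift z) xi)).

Let ibox := bcs_integrable (@bcs_box R n).

Lemma bcs_boxM (g : V -> R) : measurable_fun setT g -> (forall z, `|g z| <= 1) ->
  bcs (fun z => box z * g z).
Proof. by move=> mg g1; exact: (bcsMr (@bcs_box R n) mg g1). Qed.

Let Icos xi : mu.-integrable setT (EFin \o (fun z => box z * cos (dotmul (ashift z) xi))).
Proof.
apply/bcs_integrable/bcs_boxM => [|z]; last exact: cos_norm_le1.
by apply: measurable_cosdotT => //; exact: measurable_ashift.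
Qed.

Let Isin xi : mu.-integrable setT (EFin \o (fun z => box z * sin (dotmul (ashift z) xi))).
Proof.
apply/bcs_integrable/bcs_boxM => [|z]; last exact: sin_norm_le1.
by apply: measurable_sindotT => //; exact: measurable_ashift.
Qed.

Lemma box_eq0 (z : V) : ~ cube 1 z -> box z = 0.
Proof.
move=> h; apply/eqP; rewrite eq_le box_ge0 andbT; apply: le_trans (box_le_cube z) _.
by rewrite indicE memNset.
Qed.

Let Rint_box_le (g : V -> R) (K : R) : (forall z, cube 1 z -> `|g z| <= K) ->
  measurable_fun setT g -> `|\int[mu]_z (box z * g z)| <= K.
Proof.
move=> gK mg.
have K0 : 0 <= K by apply: le_trans (gK 0 _) => // i; rewrite mxE normr0.
have gK' z : `|box z * g z| <= K * box z.
  have [z1|z1] := pselect (cube 1 z); last by rewrite box_eq0// mul0r mulr0 normr0.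
  by rewrite normrM ger0_norm ?box_ge0// mulrC ler_wpM2r ?box_ge0// gK.
have I : mu.-integrable setT (EFin \o (fun z => box z * g z)).
  apply: (le_Rintegrable _ gK'); last exact: RintegrableZ.
  by apply: measurable_funM => //; exact: measurable_box.
apply: le_trans (le_normr_Rintegral measurableT I) _.
rewrite -[leRHS]mulr1 -(@Rintegral_box R n) -RintegralZl//.
by apply: le_Rintegral => //; [exact: integrable_norm I|exact: RintegrableZ].
Qed.

Lemma avgc_le1 xi : `|avgc xi| <= 1.
Proof.
apply: Rint_box_le => [z _|]; first exact: cos_norm_le1.
by apply: measurable_cosdotT => //; exact: measurable_ashift.
Qed.

Lemma avgs_le1 xi : `|avgs xi| <= 1.
Proof.
apply: Rint_box_le => [z _|]; first exact: sin_norm_le1.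
by apply: measurable_sindotT => //; exact: measurable_ashift.
Qed.

Let phase_bound xi z : cube 1 z ->
  `|dotmul (ashift z) xi| <= n%:R * (`|e| + `|c|) * (`|d| * enorm xi).
Proof.
move=> z1; apply: le_trans (dotmul_le _ _) _.
rewrite [leRHS](_ : _ = n%:R * (`|d| * (`|e| + `|c|)) * enorm xi); last by ring.
by rewrite ler_wpM2r ?enorm_ge0// ler_wpM2l//; exact: ashift_bound.
Qed.

(** The phase is at most |d|(|e| + |c|) |xi| up to the dimensional constant
    relating the norms. *)
Lemma avgc_near1 xi : `|avgc xi - 1| <= n%:R * (`|e| + `|c|) * (`|d| * enorm xi).
Proof.
rewrite /avgc -{1}(@Rintegral_box R n) -RintegralB//.
rewrite (_ : (fun z => _) = (fun z => box z * (cos (dotmul (ashift z) xi) - 1))); last first.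
  by apply/funext => z; rewrite mulrBr mulr1.
apply: Rint_box_le => [z z1|].
  by apply: le_trans (cosB1_le_norm _) _; exact: phase_bound.
by apply: measurable_funB => //; apply: measurable_cosdotT => //; exact: measurable_ashift.
Qed.

Lemma avgs_near0 xi : `|avgs xi| <= n%:R * (`|e| + `|c|) * (`|d| * enorm xi).
Proof.
apply: Rint_box_le => [z z1|].
  by apply: le_trans (sin_le_norm _) _; exact: phase_bound.
by apply: measurable_sindotT => //; exact: measurable_ashift.
Qed.

Let enorm_decay (xi : V) (t : R) : (forall i, `|d * c * xi ord0 i| * `|t| <= 2) ->
  (`|d * c| * enorm xi) * `|t| <= n%:R * 2.
Proof.
move=> h; have [K0|K0] := eqVneq (`|d * c| * `|t|) 0.
  by rewrite mulrAC K0 mul0r mulr_ge0.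
have K : 0 < `|d * c| * `|t| by rewrite lt0r K0 mulr_ge0.
rewrite mulrAC mulrC -ler_pdivlMr// -mulrA; apply: enorm_le => [|i].
  by rewrite divr_ge0// ltW.
by rewrite ler_pdivlMr// mulrA -normrM [_ * (d * c)]mulrC; exact: h.
Qed.

(** Some coordinate of xi carries at least 1/n of its Euclidean norm;
    oscillation in that direction gives the decay. *)
Lemma avgc_decay xi : (`|d * c| * enorm xi) * `|avgc xi| <= n%:R * 2.
Proof.
apply: enorm_decay => i.
have := osc_box ((d * c) *: xi) (d * dotmul e xi) i.
rewrite mxE (_ : \int[mu]_z _ = avgc xi)//.
apply: eq_Rintegral => z _; congr (_ * cos _).
by rewrite /ashift dotmulZl dotmulDl dotmulZl dotmulC dotmulZl dotmulC; ring.
Qed.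

Lemma avgs_decay xi : (`|d * c| * enorm xi) * `|avgs xi| <= n%:R * 2.
Proof.
apply: enorm_decay => i.
have := osc_box ((d * c) *: xi) (d * dotmul e xi - pi / 2) i.
rewrite mxE (_ : \int[mu]_z _ = avgs xi)//.
apply: eq_Rintegral => z _; congr (_ * _).
rewrite -cosBpihalf; congr (cos _).
by rewrite /ashift dotmulZl dotmulDl dotmulZl dotmulC dotmulZl dotmulC; ring.
Qed.

Section avg_bcs.
Variable v : V -> R.
Hypothesis bv : bcs v.

Let mv : measurable_fun setT v. Proof. by case: bv. Qed.

Let mvs : measurable_fun setT (fun z : V * V => v (z.1 - ashift z.2)).
Proof.
apply: (measurableT_comp mv); apply: measurable_rVD; first exact: measurable_fst.
under eq_fun do rewrite -scaleN1r.
apply: measurable_rVZ; apply: (measurableT_comp measurable_ashift); exact: measurable_snd.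
Qed.

Let mf : measurable_fun setT (fun z : V * V => box z.2 * v (z.1 - ashift z.2)).
Proof.
apply: measurable_funM => //.
by apply: (measurableT_comp (@measurable_box R n)); exact: measurable_snd.
Qed.

Let dom : exists M B, 0 < M /\ forall x z, `|box z * v (x - ashift z)| <= (M * \1_(cube B) x) * box z.
Proof.
have [_ [M M0 vM]] := bv.
exists M, (M + `|d| * (`|e| + `|c|)); split => // x z.
have [z1|z1] := pselect (cube 1 z); last by rewrite box_eq0// mul0r mulr0 normr0.
rewrite normrM ger0_norm ?box_ge0// mulrC ler_wpM2r ?box_ge0//.
apply: le_trans (vM _) _; rewrite ler_pM2l//; apply: le_indic_cubeD => i.
by rewrite mxE normrN; apply: le_trans (rV_norm_coord _ i) (ashift_bound z1).
Qed.

Let ig M B : mu.-integrable setT (EFin \o (fun x : V => M * \1_(cube B) x)).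
Proof. exact/bcs_integrable/bcsZ/bcs_indic_cube. Qed.

Lemma avg_integrable x : mu.-integrable setT (EFin \o (fun z => box z * v (x - ashift z))).
Proof.
have [M [B [M0 dm]]] := dom.
exact: (@prod_dom_integrable1 _ _ V V R mu (fun x z => box z * v (x - ashift z)) _ _ mf ibox dm x).
Qed.

Lemma bcs_avg : bcs (avg v).
Proof.
have [M [B [M0 dm]]] := dom.
have I := @Rfubini_integrable _ _ V V R mu mu _ _ _ mf (ig M B) ibox dm.
apply: (@bcs_dom _ _ _ M B); first by have /integrableP[/measurable_EFinP] := I.
move=> x; apply: le_trans (le_normr_Rintegral measurableT (avg_integrable x)) _.
rewrite -[leRHS]mulr1 -(@Rintegral_box R n) -RintegralZl//.
apply: le_Rintegral => //; [exact: integrable_norm (avg_integrable x)|exact: RintegrableZ].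
Qed.

Let trig_avg (T : R -> R) (mT : measurable_fun setT T) (T1 : forall t, `|T t| <= 1) xi :
  \int[mu]_x (T (dotmul x xi) * avg v x) =
  \int[mu]_z (box z * \int[mu]_x (T (dotmul x xi + dotmul (ashift z) xi) * v x)).
Proof.
have [M [B [M0 dm]]] := dom.
pose f x z := T (dotmul x xi) * (box z * v (x - ashift z)).
have mf' : measurable_fun setT (fun z : V * V => f z.1 z.2).
  apply: measurable_funM => //; apply: (measurableT_comp mT).
  by apply: measurable_dotmul => //; exact: measurable_fst.
have df x z : `|f x z| <= (M * \1_(cube B) x) * box z.
  by apply: le_trans (dm x z); rewrite /f normrM ler_piMl.
transitivity (\int[mu]_x \int[mu]_z f x z).
  by apply: eq_Rintegral => x _; rewrite /f RintegralZl//; exact: avg_integrable.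
rewrite (Rfubini_dom mf' (ig M B) ibox df); apply: eq_Rintegral => z _.
have mTv : measurable_fun setT (fun x => T (dotmul x xi) * v (x - ashift z)).
  apply: measurable_funM.
    by apply: (measurableT_comp mT); apply: measurable_dotmul => //; exact: measurable_id.
  exact: (measurableT_comp mv (measurable_translate _)).
have bT : bcs (fun x => T (dotmul x xi) * v (x - ashift z)).
  apply: (@bcsMl _ _ (fun x => v (x - ashift z)) (fun x => T (dotmul x xi)) 1) => //.
    exact: bcs_translate.
  by apply: (measurableT_comp mT); apply: measurable_dotmul => //; exact: measurable_id.
transitivity (box z * \int[mu]_x (T (dotmul x xi) * v (x - ashift z))).
  rewrite -RintegralZl//; last exact: bcs_integrable.
  by apply: eq_Rintegral => x _; rewrite /f mulrCA.
congr (_ * _); rewrite -(@Rintegral_translate _ _ _ (ashift z))//.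
by apply: eq_Rintegral => x _; rewrite addrK dotmulDl.
Qed.

Lemma costr_avg xi : costr (avg v) xi = avgc xi * costr v xi - avgs xi * sintr v xi.
Proof.
rewrite /costr (trig_avg (continuous_measurable_fun (@continuous_cos R)) (@cos_norm_le1 R)).
rewrite /avgc /avgs -!RintegralZr// -RintegralB//; last 2 first.
- by under eq_fun do rewrite mulrC; exact: RintegrableZ.
- by under eq_fun do rewrite mulrC; exact: RintegrableZ.
apply: eq_Rintegral => z _; rewrite -!mulrA -mulrBr; congr (_ * _).
rewrite -!RintegralZl//; last 2 first.
- exact/bcs_integrable/bcs_sinM.
- exact/bcs_integrable/bcs_cosM.
rewrite -RintegralB//; last 2 first.
- exact/bcs_integrable/bcsZ/bcs_cosM.
- exact/bcs_integrable/bcsZ/bcs_sinM.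
by apply: eq_Rintegral => x _; rewrite cosD; ring.
Qed.

Lemma sintr_avg xi : sintr (avg v) xi = avgc xi * sintr v xi + avgs xi * costr v xi.
Proof.
rewrite /sintr (trig_avg (continuous_measurable_fun (@continuous_sin R)) (@sin_norm_le1 R)).
rewrite /avgc /avgs -!RintegralZr// -RintegralD//; last 2 first.
- by under eq_fun do rewrite mulrC; exact: RintegrableZ.
- by under eq_fun do rewrite mulrC; exact: RintegrableZ.
apply: eq_Rintegral => z _; rewrite -!mulrA -mulrDr; congr (_ * _).
rewrite -!RintegralZl//; last 2 first.
- exact/bcs_integrable/bcs_cosM.
- exact/bcs_integrable/bcs_sinM.
rewrite -RintegralD//; last 2 first.
- exact/bcs_integrable/bcsZ/bcs_sinM.
- exact/bcs_integrable/bcsZ/bcs_cosM.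
by apply: eq_Rintegral => x _; rewrite sinD; ring.
Qed.

(** Averaging multiplies the transform by the symbol of the average, hence the
    energy by its squared modulus. *)
Lemma energy_avg xi : fourier_energy (avg v) xi = (avgc xi ^+ 2 + avgs xi ^+ 2) * fourier_energy v xi.
Proof. by rewrite !fourier_energyE costr_avg sintr_avg; ring. Qed.

Lemma costrB (u w : V -> R) xi : bcs u -> bcs w ->
  costr (fun x => u x - w x) xi = costr u xi - costr w xi.
Proof.
move=> bu bw; rewrite /costr -RintegralB//; [|exact/bcs_integrable/bcs_cosM..].
by apply: eq_Rintegral => x _; rewrite mulrBr.
Qed.

Lemma sintrB (u w : V -> R) xi : bcs u -> bcs w ->
  sintr (fun x => u x - w x) xi = sintr u xi - sintr w xi.
Proof.
move=> bu bw; rewrite /sintr -RintegralB//; [|exact/bcs_integrable/bcs_sinM..].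
by apply: eq_Rintegral => x _; rewrite mulrBr.
Qed.

Lemma energy_avgB xi : fourier_energy (fun x => avg v x - v x) xi =
  ((avgc xi - 1) ^+ 2 + avgs xi ^+ 2) * fourier_energy v xi.
Proof.
rewrite !fourier_energyE costrB ?sintrB//; try exact: bcs_avg.
by rewrite costr_avg sintr_avg; ring.
Qed.

End avg_bcs.

End averaging.

(** * Symbols of the averages *)

Section symbols.
Context {R : realType} {n : nat}.
Local Notation V := 'rV[R]_n.+1.
Variables (c : R) (e : V).
Hypothesis c0 : 0 < c.

Lemma measurable_avgc d : measurable_fun setT (avgc d c e : V -> R).
Proof.
apply: (measurable_Rint_param _ (bcs_integrable (@bcs_box R n.+1))) => [|xi z].
  apply: measurable_funM; first by apply: (measurableT_comp (@measurable_box R n.+1)); exact: measurable_snd.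
  apply: measurable_cosdotT; last exact: measurable_fst.
  by apply: (measurableT_comp (@measurable_ashift R n.+1 d c e)); exact: measurable_snd.
by rewrite normrM ger0_norm ?box_ge0// ler_piMr ?box_ge0// cos_norm_le1.
Qed.

Lemma measurable_avgs d : measurable_fun setT (avgs d c e : V -> R).
Proof.
apply: (measurable_Rint_param _ (bcs_integrable (@bcs_box R n.+1))) => [|xi z].
  apply: measurable_funM; first by apply: (measurableT_comp (@measurable_box R n.+1)); exact: measurable_snd.
  apply: measurable_sindotT; last exact: measurable_fst.
  by apply: (measurableT_comp (@measurable_ashift R n.+1 d c e)); exact: measurable_snd.
by rewrite normrM ger0_norm ?box_ge0// ler_piMr ?box_ge0// sin_norm_le1.
Qed.

(** The squared distance from 1 of the symbol of the average. *)
Definition gap (d : R) (xi : V) : R := (avgc d c e xi - 1) ^+ 2 + avgs d c e xi ^+ 2.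
(** The squared modulus of the symbol of the average. *)
Definition damp (d : R) (xi : V) : R := avgc d c e xi ^+ 2 + avgs d c e xi ^+ 2.

Lemma gap_ge0 d xi : 0 <= gap d xi.
Proof. by rewrite addr_ge0 ?sqr_ge0. Qed.

Lemma damp_ge0 d xi : 0 <= damp d xi.
Proof. by rewrite addr_ge0 ?sqr_ge0. Qed.

Lemma gap_le5 d xi : gap d xi <= 5.
Proof.
have := avgc_le1 d c e xi; have := avgs_le1 d c e xi.
by rewrite /gap !ler_norml => /andP[h1 h2] /andP[h3 h4]; nra.
Qed.

Lemma damp_le2 d xi : damp d xi <= 2.
Proof.
have := avgc_le1 d c e xi; have := avgs_le1 d c e xi.
by rewrite /damp !ler_norml => /andP[h1 h2] /andP[h3 h4]; nra.
Qed.

Definition gap_const : R := 2 * (n.+1%:R * (`|e| + c)) ^+ 2.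

Lemma gap_const_ge0 : 0 <= gap_const.
Proof. by rewrite mulr_ge0// sqr_ge0. Qed.

Lemma gap_small d xi : 0 <= d -> gap d xi <= gap_const * (d * enorm xi) ^+ 2.
Proof.
move=> d0; have := avgc_near1 d c e xi; have := avgs_near0 d c e xi.
rewrite (ger0_norm d0) (gtr0_norm c0); set t := d * enorm xi => h1 h2.
have t0 : 0 <= n.+1%:R * (`|e| + c) * t by apply: le_trans h1.
have -> : gap_const * t ^+ 2 = (n.+1%:R * (`|e| + c) * t) ^+ 2 + (n.+1%:R * (`|e| + c) * t) ^+ 2.
  by rewrite /gap_const; ring.
by apply: lerD; rewrite -[leLHS]real_normK ?num_real// ler_sqr ?nnegrE.
Qed.

(** For l <= 2 ln^+|xi| the trivial bound 5 on the gap suffices. Otherwise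
    |xi| <= exp(l/2), so the gap is at most a multiple of (exp(-l)|xi|)^2 <=
    exp(-l), which beats l. *)
Lemma gap_log l xi : 0 <= l -> l * gap (expR (- l)) xi <= (10 + gap_const) * (1 + lnplus xi).
Proof.
move=> l0; have C0 := gap_const_ge0; have p0 := lnplus_ge0 xi.
have g0 := gap_ge0 (expR (- l)) xi; have g5 := gap_le5 (expR (- l)) xi.
have [hl|hl] := lerP l (2 * lnplus xi).
  have : l * gap (expR (- l)) xi <= 2 * lnplus xi * 5 by exact: ler_pM.
  by have := mulr_ge0 C0 p0; lra.
have : l * gap (expR (- l)) xi <= gap_const; last by have := mulr_ge0 C0 p0; lra.
have [e0|e0] := eqVneq (enorm xi) 0.
  have := gap_small xi (expR_ge0 (- l)); rewrite e0 mulr0 expr0n/= mulr0 => h.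
  by apply: le_trans C0; rewrite mulr_ge0_le0.
have ep : 0 < enorm xi by rewrite lt0r e0 enorm_ge0.
apply: le_trans (ler_wpM2l l0 (gap_small xi (expR_ge0 (- l)))) _.
rewrite mulrCA ler_piMr// -{1}(lnK ep) -expRD -expRM_natl.
have hln : ln (enorm xi) <= lnplus xi by rewrite /lnplus le_max lexx orbT.
apply: (@le_trans _ _ (l * expR (- l))).
  by apply: ler_wpM2l => //; rewrite ler_expR; lra.
rewrite expRN ler_pdivrMr ?expR_gt0// mul1r.
by have := expR_ge1Dx l; lra.
Qed.

Lemma gap_vanish l xi : 0 < l -> l * gap (expR (- l)) xi <= gap_const * enorm xi ^+ 2 / l.
Proof.
move=> l0; rewrite ler_pdivlMr//.
have h : l * expR (- l) <= 1.
  by rewrite expRN ler_pdivrMr ?expR_gt0// mul1r; have := expR_ge1Dx l; lra.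
have h0 : 0 <= l * expR (- l) by rewrite mulr_ge0 ?expR_ge0// ltW.
apply: (@le_trans _ _ (gap_const * enorm xi ^+ 2 * (l * expR (- l)) ^+ 2)); last first.
  rewrite ler_piMr ?expr_le1//; apply: mulr_ge0; [exact: gap_const_ge0|exact: sqr_ge0].
have := ler_wpM2r (ltW (mulr_gt0 l0 l0)) (gap_small xi (expR_ge0 (- l))).
rewrite (_ : l * gap _ _ * l = gap (expR (- l)) xi * (l * l)); last by ring.
by move/le_trans; apply; rewrite le_eqVlt; apply/orP; left; apply/eqP; ring.
Qed.

Definition damp_const : R := expR 2 * (2 + 2 * (n.+1%:R * 2 / c) ^+ 2).

(** For |xi| <= exp(l) the weight |xi|^(2s) is at most exp(2 s l) <= exp 2.
    Beyond, put y = exp(-l)|xi| > 1: then |xi|^(2s) <= exp(2) y^2 since s <=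
    1, and y times the symbol is bounded by the decay estimate. *)
Lemma damp_exp l s xi : 0 <= l -> 0 < s <= 1 -> s * l <= 1 ->
  expR (2 * s * ln (enorm xi)) * damp (expR (- l)) xi <= damp_const.
Proof.
move=> l0 /andP[s0 s1] sl; rewrite /damp_const; have A0 := expR_ge0 (2 : R).
have B0 : 0 <= (n.+1%:R * 2 / c) ^+ 2 := sqr_ge0 _.
have [hl|hl] := lerP (ln (enorm xi)) l.
  apply: ler_pM; [exact: expR_ge0|exact: damp_ge0| |].
    by rewrite ler_expR; have := ler_wpM2l (ltW s0) hl; lra.
  by have := damp_le2 (expR (- l)) xi; lra.
have ep : 0 < enorm xi.
  by rewrite ltNge; apply/negP => /ln0 h; move: hl; rewrite h; lra.
set y := expR (- l) * enorm xi.
have yE : y = expR (ln (enorm xi) - l) by rewrite /y -{1}(lnK ep) -expRD addrC.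
have y0 : 0 < y by rewrite yE expR_gt0.
have K : expR (2 * s * ln (enorm xi)) <= expR 2 * y ^+ 2.
  rewrite yE -expRM_natl -expRD ler_expR.
  have : s * (ln (enorm xi) - l) <= ln (enorm xi) - l by rewrite ler_piMl//; lra.
  by lra.
apply: le_trans (ler_wpM2r (damp_ge0 _ _) K) _.
rewrite -[leLHS]mulrA; apply: ler_wpM2l => //.
have dec (a : R) : `|expR (- l) * c| * enorm xi * `|a| <= n.+1%:R * 2 ->
    y ^+ 2 * a ^+ 2 <= (n.+1%:R * 2 / c) ^+ 2.
  rewrite gtr0_norm ?mulr_gt0 ?expR_gt0// => h.
  have : y * `|a| <= n.+1%:R * 2 / c.
    by rewrite ler_pdivlMr//; apply: le_trans h; rewrite /y le_eqVlt; apply/orP; left; apply/eqP; ring.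
  move=> h2; rewrite -exprMn -[leLHS]real_normK ?num_real// normrM (gtr0_norm y0).
  rewrite ler_sqr ?nnegrE; [exact: h2|by rewrite mulr_ge0 ?(ltW y0)|].
  by apply: divr_ge0; [rewrite mulr_ge0|exact: ltW].
have := dec _ (avgc_decay (expR (- l)) c e xi); have := dec _ (avgs_decay (expR (- l)) c e xi).
by rewrite /damp mulrDr; lra.
Qed.

End symbols.

(** * Logarithmic energy and Lipschitz multipliers *)

Section dyadic_sums.
Context {R : realType}.
Implicit Types (y A : R).

Let expN2 : expR (- 2) <= 2^-1 :> R.
Proof.
rewrite expRN lef_pV2 ?posrE ?expR_gt0//.
by have := @expR_ge1Dx R 2; lra.
Qed.

Let sum_exp_le A N y : 0 <= A ->
  \sum_(m < N) A * expR (2 * (y - m%:R)) <= 2 * A * expR (2 * y).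
Proof.
move=> A0; elim: N y => [|N IH] y.
  by rewrite big_ord0 !mulr_ge0// expR_ge0.
rewrite big_ord_recl subr0.
have -> : \sum_(i < N) A * expR (2 * (y - (lift ord0 i)%:R)) = \sum_(i < N) A * expR (2 * ((y - 1) - i%:R)).
  by apply: eq_bigr => i _; rewrite /= /bump/= add1n -[_.+1%:R]natr1; congr (_ * expR _); ring.
apply: le_trans (lerD (lexx _) (IH _)) _.
have -> : expR (2 * (y - 1)) = expR (2 * y) * expR (-2) by rewrite -expRD; congr expR; ring.
have : expR (2 * y) * expR (-2) <= expR (2 * y) * 2^-1 by rewrite ler_wpM2l// expR_ge0.
have := expR_ge0 (2 * y); nra.
Qed.

(** About y terms are of order 1; the others form a geometric series. The
    induction removes one term and lowers y by 1. *)
Lemma sum_min_exp_le A N y (a : nat -> R) : 0 <= A ->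
  (forall m, a m <= 5) -> (forall m, a m <= A * expR (2 * (y - m%:R))) ->
  \sum_(m < N) a m <= (5 + 2 * A * expR 2) * (1 + Num.max 0 y).
Proof.
move=> A0; have K0 : 0 <= 2 * A * expR 2 by rewrite !mulr_ge0// expR_ge0.
elim: N y a => [|N IH] y a a5 aA.
  by rewrite big_ord0 mulr_ge0// addr_ge0// le_max lexx.
have [y1|y1] := leP y 1.
  apply: le_trans (_ : 2 * A * expR (2 * y) <= _).
    by apply: le_trans (sum_exp_le _ _ A0); apply: ler_sum => i _; exact: aA.
  apply: (@le_trans _ _ (2 * A * expR 2)).
    by rewrite ler_wpM2l ?mulr_ge0// ler_expR; lra.
  have : 0 <= Num.max 0 y by rewrite le_max lexx.
  by nra.
rewrite big_ord_recl.
have := IH (y - 1) (fun m => a m.+1) (fun m => a5 m.+1) _.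
have h m : a m.+1 <= A * expR (2 * (y - 1 - m%:R)).
  by have -> : y - 1 - m%:R = y - m.+1%:R by rewrite -[m.+1%:R]natr1; ring.
move=> /(_ h); have -> : Num.max 0 (y - 1) = y - 1 by apply/max_idPr; lra.
have -> : Num.max 0 y = y by apply/max_idPr; lra.
have := a5 0%N; have -> : \sum_(i < N) a (lift ord0 i) = \sum_(m < N) a m.+1 by [].
by nra.
Qed.

Lemma sum_quarter_ge c0 N y (b : nat -> R) : (forall m, 0 <= b m) ->
  (forall m, m%:R <= y - c0 -> 1 / 4 <= b m) ->
  1 / 4 * Num.min N%:R (y - c0) <= \sum_(m < N) b m.
Proof.
elim: N y b => [|N IH] y b b0 bq.
  rewrite big_ord0; have : Num.min 0%:R (y - c0) <= 0 by rewrite ge_min lexx.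
  by lra.
have [yc|yc] := leP 0 (y - c0); last first.
  apply: (@le_trans _ _ 0); last exact: sumr_ge0.
  have : Num.min N.+1%:R (y - c0) <= y - c0 by rewrite ge_min lexx orbT.
  by lra.
rewrite big_ord_recl.
have h m : m%:R <= y - 1 - c0 -> 1 / 4 <= b m.+1 by move=> hm; apply: bq; rewrite -natr1; lra.
have := IH (y - 1) (fun m => b m.+1) (fun m => b0 m.+1) h.
have -> : \sum_(i < N) b (lift ord0 i) = \sum_(m < N) b m.+1 by [].
have := bq 0%N yc.
have : Num.min N.+1%:R (y - c0) <= 1 + Num.min N%:R (y - 1 - c0).
  rewrite -natr1 ge_min /Num.min; case: ifP => hh; apply/orP; [left|right]; lra.
by lra.
Qed.

Lemma sum_expN2_le N : \sum_(m < N) expR (- m%:R) ^+ 2 <= 2 :> R.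
Proof.
have := @sum_exp_le 1 N 0 ler01; rewrite mulr0 expR0 !mulr1; apply: le_trans.
apply: ler_sum => i _; rewrite mul1r -expRM_natl; rewrite le_eqVlt; apply/orP; left; apply/eqP.
by congr expR; ring.
Qed.

End dyadic_sums.

Section plancherel_int.
Context {R : realType} {n : nat}.
Local Notation V := 'rV[R]_n.
Local Notation mu := (@lebesgue_rV R n).

Lemma integrable_energy (u : V -> R) : bcs u -> mu.-integrable setT (EFin \o fourier_energy u).
Proof.
move=> bu; apply/integrableP; split.
  by apply/measurable_EFinP; exact: measurable_fourier_energy.
under eq_integral do rewrite /= ger0_norm ?fourier_energy_ge0//.
by rewrite plancherel// ltry.
Qed.

Lemma Rplancherel (u : V -> R) : bcs u -> \int[mu]_xi fourier_energy u xi = \int[mu]_x (u x ^+ 2).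
Proof. by move=> bu; rewrite /Rintegral plancherel. Qed.

End plancherel_int.

Section log_energy.
Context {R : realType} {n : nat}.
Local Notation V := 'rV[R]_n.+1.
Local Notation mu := (@lebesgue_rV R n.+1).

Definition log_finite (u : V -> R) :=
  mu.-integrable setT (EFin \o (fun xi => lnplus xi * fourier_energy u xi)).

Let nu (m : nat) (xi : V) : R := gap 1 0 (expR (- m%:R)) xi.

Let gap_small1 m xi : nu m xi <= 2 * n.+1%:R ^+ 2 * (expR (- m%:R) * enorm xi) ^+ 2.
Proof.
apply: le_trans (gap_small 0 ltr01 xi (expR_ge0 _)) _.
by rewrite /gap_const normr0 add0r mulr1.
Qed.

(** With gap_sum_ge, this compares the weight ln^+|xi| with the sum over the
    scales exp(-m) of the gaps: the gap is of order 1 for m < ln|xi| and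
    decays geometrically afterwards. *)
Let gap_sum_le N xi : \sum_(m < N) nu m xi <= (5 + 2 * (2 * n.+1%:R ^+ 2) * expR 2) * (1 + lnplus xi).
Proof.
have [e0|e0] := eqVneq (enorm xi) 0.
  rewrite big1 => [|i _]; last first.
    apply/eqP; rewrite eq_le gap_ge0 andbT; apply: le_trans (gap_small1 _ _) _.
    by rewrite e0 mulr0 expr0n/= mulr0.
  by rewrite !mulr_ge0 ?addr_ge0 ?lnplus_ge0 ?mulr_ge0 ?expR_ge0 ?sqr_ge0.
have ep : 0 < enorm xi by rewrite lt0r e0 enorm_ge0.
apply: (@sum_min_exp_le R _ N _ (fun m => nu m xi)) => [||m]; first by rewrite mulr_ge0// sqr_ge0.
  by move=> m; exact: gap_le5.
apply: le_trans (gap_small1 _ _) _; rewrite ler_wpM2l ?mulr_ge0 ?sqr_ge0//.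
rewrite -{1}(lnK ep) -expRD -expRM_natl le_eqVlt; apply/orP; left; apply/eqP; congr expR.
by rewrite addrC.
Qed.

(** At frequencies above exp(m + c0) the decay of the symbol at scale exp(-m)
    puts it within 1/2 of 0, and the gap is at least 1/4. *)
Let c0 : R := ln (4 * n.+1%:R).

Let gap_sum_ge N xi : 0 < enorm xi ->
  1 / 4 * Num.min N%:R (ln (enorm xi) - c0) <= \sum_(m < N) nu m xi.
Proof.
move=> ep; apply: (@sum_quarter_ge R _ N _ (fun m => nu m xi)) => [m|m hm]; first exact: gap_ge0.
pose t := expR (- m%:R) * enorm xi.
have n0 : 0 < n.+1%:R :> R by [].
have n4 : 0 < 4 * n.+1%:R :> R by rewrite mulr_gt0.
have ht : 4 * n.+1%:R <= t.
  rewrite /t -(lnK ep) -expRD -[leLHS](lnK n4) ler_expR -/c0; lra.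
have := avgc_decay (expR (- m%:R)) 1 0 xi; rewrite mulr1 (ger0_norm (expR_ge0 _)) -/t.
rewrite /nu /gap; set a := avgc _ _ _ _; set b := avgs _ _ _ _ => h.
have : 4 * n.+1%:R * `|a| <= n.+1%:R * 2 by apply: le_trans h; rewrite ler_wpM2r.
rewrite mulrAC mulrC ler_pM2l// => ha.
have : `|a| <= 1 / 2 by lra.
rewrite ler_norml => /andP[h1 h2].
have := sqr_ge0 b; nra.
Qed.

Section multiplier.
Variables (u eta : V -> R) (L : R).
Hypotheses (bu : bcs u) (meta : measurable_fun setT eta) (L0 : 0 <= L).
Hypothesis eta1 : forall x, `|eta x| <= 1.
Hypothesis etaL : forall x y, `|eta x - eta y| <= L * `|x - y|.
Hypothesis lu : log_finite u.

Let v x := eta x * u x.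

Lemma bcs_eta : bcs v.
Proof. exact: (bcsMl bu meta eta1). Qed.

(** The commutator of averaging with multiplication by eta only sees the
    values of eta at distance d, where the Lipschitz bound applies. *)
Let comm_bound : exists2 M, 0 < M & forall m x,
  `|avg (expR (- m%:R)) 1 0 v x - v x| <=
  `|avg (expR (- m%:R)) 1 0 u x - u x| + expR (- m%:R) * (L * M * \1_(cube M) x).
Proof.
have [mu_ [M M0 uM]] := bu; exists (M + 1) => [|m x]; first by rewrite addr_gt0.
set d := expR (- m%:R).
have d0 : 0 <= d by exact: expR_ge0.
have d1 : d <= 1 by rewrite /d -[leRHS]expR0 ler_expR oppr_le0.
have bv := bcs_eta.
have Iu := avg_integrable d 1 0 bu x.
have Iv := avg_integrable d 1 0 bv x.
have E : avg d 1 0 v x - v x = eta x * (avg d 1 0 u x - u x) +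
    (avg d 1 0 v x - eta x * avg d 1 0 u x) by rewrite /v; ring.
rewrite E; apply: le_trans (ler_normD _ _) _; apply: lerD.
  by rewrite normrM ler_piMl.
rewrite /avg -(RintegralZl (eta x) measurableT Iu) -(RintegralB measurableT Iv (RintegrableZ (eta x) Iu)).
apply: le_trans (le_normr_Rintegral measurableT (RintegrableB Iv (RintegrableZ _ Iu))) _.
set B := d * _.
rewrite [leRHS](_ : B = B * \int[mu]_z box z); last by rewrite Rintegral_box mulr1.
have ib := bcs_integrable (@bcs_box R n.+1).
rewrite -RintegralZl//; apply: le_Rintegral => //.
- exact: (integrable_norm (RintegrableB Iv (RintegrableZ (eta x) Iu))).
- exact: RintegrableZ.
move=> z _; have [z1|z1] := pselect (cube 1 z); last first.
  by rewrite box_eq0// !mul0r !mulr0 subr0 normr0.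
rewrite (_ : _ - _ = box z * ((eta (x - ashift d 1 0 z) - eta x) * u (x - ashift d 1 0 z))); last first.
  by rewrite /v; ring.
rewrite normrM (ger0_norm (box_ge0 z)) mulrC ler_wpM2r ?box_ge0// normrM.
have sb : `|ashift d 1 0 z| <= d.
  by apply: le_trans (ashift_bound _ _ _ z1) _; rewrite normr0 normr1 add0r mulr1 ger0_norm.
have h1 : `|eta (x - ashift d 1 0 z) - eta x| <= L * d.
  apply: le_trans (etaL _ _) _; rewrite ler_wpM2l// addrAC subrr add0r normrN//.
have h2 : `|u (x - ashift d 1 0 z)| <= (M + 1) * \1_(cube (M + 1)) x.
  apply: le_trans (uM _) _; apply: ler_pM => //; first exact: ltW.
    by rewrite lerDl.
  apply: le_indic_cubeD => i; rewrite mxE normrN; apply: le_trans (rV_norm_coord _ i) _.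
  exact: le_trans sb d1.
apply: le_trans (ler_pM _ _ h1 h2) _ => //.
by rewrite /B; rewrite le_eqVlt; apply/orP; left; apply/eqP; ring.
Qed.

Let l2diff_sum_u : exists B, forall N,
  \sum_(m < N) \int[mu]_x ((avg (expR (- m%:R)) 1 0 u x - u x) ^+ 2) <= B.
Proof.
pose K : R := 5 + 2 * (2 * n.+1%:R ^+ 2) * expR 2.
exists (K * \int[mu]_xi (fourier_energy u xi + lnplus xi * fourier_energy u xi)) => N.
have I1 := integrable_energy bu.
have Ib m : bcs (fun x => avg (expR (- m%:R)) 1 0 u x - u x) by apply: bcsB => //; exact: bcs_avg.
have Inu m : mu.-integrable setT (EFin \o (fun xi => nu m xi * fourier_energy u xi)).
  have := integrable_energy (Ib m); apply: eq_integrable => // xi _.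
  by rewrite /= energy_avgB.
have -> : \sum_(m < N) \int[mu]_x ((avg (expR (- m%:R)) 1 0 u x - u x) ^+ 2) =
    \int[mu]_xi (\sum_(m < N) nu m xi * fourier_energy u xi).
  elim: N => [|N IH].
    by rewrite big_ord0; under eq_Rintegral do rewrite big_ord0; rewrite Rintegral_cst// mul0r.
  rewrite big_ord_recr/= IH -Rplancherel//.
  have -> : \int[mu]_xi fourier_energy (fun x => avg (expR (- N%:R)) 1 0 u x - u x) xi =
      \int[mu]_xi (nu N xi * fourier_energy u xi).
    by apply: eq_Rintegral => xi _; rewrite energy_avgB.
  rewrite -RintegralD//; last first.
    elim: (N) => [|k IHk]; first by under eq_fun do rewrite big_ord0; exact: integrable0.
    by under eq_fun do rewrite big_ord_recr/=; exact: RintegrableD.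
  by apply: eq_Rintegral => xi _; rewrite big_ord_recr.
rewrite -RintegralZl//; last exact: RintegrableD.
apply: le_Rintegral => //.
- elim: (N) => [|k IHk]; first by under eq_fun do rewrite big_ord0; exact: integrable0.
  by under eq_fun do rewrite big_ord_recr/=; exact: RintegrableD.
- by apply: RintegrableZ; exact: RintegrableD.
move=> xi _; rewrite -mulr_suml.
rewrite (_ : K * _ = K * (1 + lnplus xi) * fourier_energy u xi); last by ring.
by rewrite ler_wpM2r ?fourier_energy_ge0// gap_sum_le.
Qed.

(** The commutator errors are of order exp(-m), hence square summable. *)
Let l2diff_sum_v : exists B, forall N,
  \sum_(m < N) \int[mu]_x ((avg (expR (- m%:R)) 1 0 v x - v x) ^+ 2) <= B.
Proof.
have [M M0 cb] := comm_bound; have [B hB] := l2diff_sum_u.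
pose J := \int[mu]_x \1_(cube M) x : R.
exists (2 * B + 2 * (L * M) ^+ 2 * J * 2) => N.
have bd (w : V -> R) m : bcs w -> bcs (fun x => (avg (expR (- m%:R)) 1 0 w x - w x) ^+ 2).
  move=> bw; under eq_fun do rewrite expr2.
  by apply: bcsM; apply: bcsB => //; exact: bcs_avg.
have J0 : 0 <= J by apply: Rintegral_ge0.
apply: (@le_trans _ _ (\sum_(m < N) (2 * \int[mu]_x ((avg (expR (- m%:R)) 1 0 u x - u x) ^+ 2) +
    2 * (L * M) ^+ 2 * J * expR (- m%:R) ^+ 2))).
  apply: ler_sum => m _.
  have I1 := bcs_integrable (bd u m bu).
  have I2 := bcs_integrable (@bcs_indic_cube R n.+1 M).
  have -> : 2 * (L * M) ^+ 2 * J * expR (- m%:R) ^+ 2 =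
      \int[mu]_x ((2 * (L * M) ^+ 2 * expR (- m%:R) ^+ 2) * \1_(cube M) x).
    by rewrite RintegralZl// -/J; ring.
  rewrite -RintegralZl// -RintegralD//; [|exact: RintegrableZ..].
  apply: le_Rintegral => //.
  - exact/bcs_integrable/bd/bcs_eta.
  - by apply: RintegrableD; exact: RintegrableZ.
  move=> x _; have := cb m x.
  set a := avg _ _ _ v x - v x; set b := avg _ _ _ u x - u x; set t := expR _.
  rewrite indicE; case: (x \in cube M) => /=; rewrite ?mulr1 ?mulr0 ?addr0 => h.
    have h0 : 0 <= t * (L * M) by apply: mulr_ge0; [exact: expR_ge0|apply: mulr_ge0 => //; exact: ltW].
    have : `|a| ^+ 2 <= (`|b| + t * (L * M)) ^+ 2 by rewrite ler_sqr ?nnegrE ?addr_ge0.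
    rewrite -[a ^+ 2]real_normK ?num_real// -[b ^+ 2]real_normK ?num_real//.
    have := sqr_ge0 (`|b| - t * (L * M)); nra.
  have : `|a| ^+ 2 <= `|b| ^+ 2 by rewrite ler_sqr ?nnegrE.
  rewrite !real_normK ?num_real//; have := sqr_ge0 b; nra.
rewrite big_split/= -!mulr_sumr; apply: lerD; first by rewrite ler_wpM2l// hB.
apply: ler_wpM2l; last exact: sum_expN2_le.
by apply: mulr_ge0 => //; apply: mulr_ge0 => //; exact: sqr_ge0.
Qed.

(** The logarithmic energy is comparable to the sum over m of the squared
    distance to the average at scale exp(-m), and multiplication by a
    Lipschitz function commutes with averaging up to an error proportional to
    the scale. *)
Lemma log_finite_mul : log_finite v.
Proof.
have bv := bcs_eta; have [B hB] := l2diff_sum_v.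
have IE := integrable_energy bv.
have mE := measurable_fourier_energy bv.
pose y (xi : V) := Num.max 0 (ln (enorm xi) - c0).
have my : measurable_fun setT y.
  by apply: measurable_maxr => //; apply: measurable_funB => //; exact: measurable_ln_enorm.
have y0 xi : 0 <= y xi by rewrite /y le_max lexx.
pose g (N : nat) (xi : V) : \bar R := (Num.min N%:R (y xi) * fourier_energy v xi)%:E.
have mg N : measurable_fun setT (g N).
  by apply/measurable_EFinP/measurable_funM => //; exact: measurable_minr.
have gB N : (\int[mu]_xi g N xi <= (4 * B)%:E)%E.
  have Inu m : mu.-integrable setT (EFin \o (fun xi => nu m xi * fourier_energy v xi)).
    have : bcs (fun x => avg (expR (- m%:R)) 1 0 v x - v x) by apply: bcsB => //; exact: bcs_avg.
    by move/integrable_energy; apply: eq_integrable => // xi _; rewrite /= energy_avgB.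
  have Is k : mu.-integrable setT (EFin \o (fun xi => \sum_(m < k) nu m xi * fourier_energy v xi)).
    elim: k => [|k IHk]; first by under eq_fun do rewrite big_ord0; exact: integrable0.
    by under eq_fun do rewrite big_ord_recr/=; exact: RintegrableD.
  apply: (@le_trans _ _ (\int[mu]_xi (4 * (\sum_(m < N) nu m xi * fourier_energy v xi))%:E)%E).
    apply: ae_ge0_le_integral => //.
    - by move=> xi _; rewrite lee_fin mulr_ge0 ?fourier_energy_ge0// le_min ler0n y0.
    - move=> xi _; rewrite lee_fin mulr_ge0// sumr_ge0// => m _.
      by rewrite mulr_ge0 ?fourier_energy_ge0 ?gap_ge0.
    - by have /integrableP[] := RintegrableZ 4 (Is N).
    have := @hyperplane_null R n.+1 ord0 0; apply: filterS => xi xi0 _.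
    have ep : 0 < enorm xi.
      by apply: lt_le_trans (le_coord_enorm xi ord0); rewrite normr_gt0; apply/eqP.
    rewrite lee_fin -mulr_suml mulrA ler_wpM2r ?fourier_energy_ge0//.
    have h := gap_sum_ge N ep.
    have s0 : 0 <= \sum_(m < N) nu m xi by apply: sumr_ge0 => m _; exact: gap_ge0.
    have [yc|yc] := leP 0 (ln (enorm xi) - c0).
      by rewrite /y (max_idPr yc); lra.
    rewrite /y (max_idPl (ltW yc)); have : Num.min N%:R 0 <= 0 :> R by rewrite ge_min lexx orbT.
    by lra.
  rewrite -EFin_Rintegral; last exact: RintegrableZ.
  rewrite lee_fin RintegralZl// ler_wpM2l//; apply: le_trans (hB N).
  rewrite le_eqVlt; apply/orP; left; apply/eqP.
  elim: N => [|N IH].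
    by rewrite big_ord0; under eq_Rintegral do rewrite big_ord0; rewrite Rintegral_cst// mul0r.
  rewrite [RHS]big_ord_recr/= -IH -Rplancherel; last by apply: bcsB => //; exact: bcs_avg.
  have -> : \int[mu]_xi fourier_energy (fun x => avg (expR (- N%:R)) 1 0 v x - v x) xi =
      \int[mu]_xi (nu N xi * fourier_energy v xi).
    by apply: eq_Rintegral => xi _; rewrite energy_avgB.
  by rewrite -RintegralD//; apply: eq_Rintegral => xi _; rewrite big_ord_recr.
have Iy : mu.-integrable setT (EFin \o (fun xi => y xi * fourier_energy v xi)).
  apply/integrableP; split; first by apply/measurable_EFinP/measurable_funM.
  apply: (@le_lt_trans _ _ (4 * B)%:E); last exact: ltry.
  have -> : (\int[mu]_xi `|(y xi * fourier_energy v xi)%:E| =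
      \int[mu]_xi limn (g^~ xi))%E.
    apply: eq_integral => xi _.
    rewrite gee0_abs; last by rewrite lee_fin mulr_ge0 ?y0 ?fourier_energy_ge0.
    apply/esym/cvg_lim => //; apply: cvg_near_cst.
    exists (Num.truncn (y xi)).+1 => // N /= hN; rewrite /g; congr (_ * _)%:E.
    apply/min_idPr; rewrite ltW//; apply: lt_le_trans (truncnS_gt _) _.
    by rewrite ler_nat.
  have g0 N xi : [set: V] xi -> (0 <= g N xi)%E.
    by move=> _; rewrite lee_fin mulr_ge0 ?fourier_energy_ge0// le_min ler0n y0.
  have gnd xi : [set: V] xi -> nondecreasing_seq (g ^~ xi).
    move=> _ j k jk; rewrite lee_fin ler_wpM2r ?fourier_energy_ge0//.
    by rewrite le_min !ge_min lexx orbT andbT ler_nat jk.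
  rewrite (monotone_convergence mu measurableT mg g0 gnd).
  apply: lime_le; last exact: nearW.
  apply: ereal_nondecreasing_is_cvgn => j k jk; apply: ge0_le_integral => //.
  - by move=> xi _; exact: g0.
  - by move=> xi _; exact: gnd.
apply: (@le_Rintegrable _ _ _ mu _ (fun xi => `|c0| * fourier_energy v xi + y xi * fourier_energy v xi)).
- by apply: measurable_funM => //; exact: measurable_lnplus.
- move=> xi; rewrite ger0_norm; last first.
    by apply: mulr_ge0; [exact: lnplus_ge0|exact: fourier_energy_ge0].
  rewrite -mulrDl ler_wpM2r ?fourier_energy_ge0// /lnplus ge_max addr_ge0//=.
  have : ln (enorm xi) - c0 <= y xi by rewrite /y le_max lexx orbT.
  by have := ler_norm c0; lra.
- exact: (RintegrableD (RintegrableZ `|c0| IE) Iy).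
Qed.

End multiplier.
End log_energy.

(** * Inward directions at a Lipschitz boundary *)

Section inward.
Context {R : realType} {n : nat}.
Local Notation V := 'rV[R]_n.+1.
Implicit Types (x y h e : V) (Omega : set V).

(** An interior cone condition near x0, uniform over the points of Omega in a
    ball: moves along t e, up to errors of size c t, stay in Omega. *)
Definition inward Omega (x0 : V) (r : R) (e : V) (c : R) := [/\ 0 < r, 0 < c &
  forall x t h, Omega x -> `|x - x0| < r -> 0 < t < c -> `|h| <= c * t ->
    Omega (x + t *: e + h)].

Lemma inward_interior Omega x0 : open Omega -> Omega x0 ->
  exists r e c, inward Omega x0 r e c.
Proof.
move=> oO Ox; have [d/= d0 dO] : exists2 d : R, 0 < d & ball x0 d `<=` Omega.
  by have /nbhs_ballP[d d0 dO] := oO x0 Ox; exists d.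
have d20 : 0 < d / 2 by rewrite divr_gt0.
exists (d / 2), 0, (Num.min 1 (d / 2)).
split => //; first by rewrite lt_min ltr01.
move=> x t h _ xx0; rewrite lt_min => /andP[t0 /andP[t1 td]] ht.
apply: dO; rewrite -ball_normE/= scaler0 addr0 distrC.
rewrite (_ : x + h - x0 = (x - x0) + h); last by rewrite addrAC.
apply: le_lt_trans (ler_normD _ _) _; rewrite [ltRHS](splitr d) ltr_leD//.
apply: le_trans ht _; apply: (@le_trans _ _ (1 * t)); last by rewrite mul1r ltW.
by rewrite ler_wpM2r ?(ltW t0)// ge_min lexx.
Qed.

Lemma enorm_mulmx_ortho (Q : 'M[R]_n.+1) x : Q *m Q^T = 1%:M -> enorm (x *m Q) = enorm x.
Proof.
move=> QQ; rewrite /enorm; congr Num.sqrt.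
have E (y z : V) : dotmul y z = (y *m z^T) ord0 ord0.
  by rewrite mxE; apply: eq_bigr => i _; rewrite mxE.
by rewrite !E trmx_mul mulmxA -(mulmxA x) QQ mulmx1.
Qed.

Lemma enorm_behead_le (x : V) : enorm (rV_behead x) <= enorm x.
Proof.
rewrite /enorm ler_sqrt ?dotmul_ge0// /dotmul big_ord_recl.
have -> : \sum_(i < n) rV_behead x ord0 i * rV_behead x ord0 i =
  \sum_(i < n) x ord0 (lift ord0 i) * x ord0 (lift ord0 i).
  by apply: eq_bigr => i _; rewrite rV_beheadE.
by rewrite lerDr -expr2 sqr_ge0.
Qed.

Lemma rV_beheadD x y : rV_behead (x + y) = rV_behead x + rV_behead y.
Proof. by rewrite /rV_behead; apply/rowP => i; rewrite !mxE. Qed.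

(** Above a Lipschitz graph, small moves in a cone around the vertical axis
    stay above the graph. The constant c is small enough for the vertical gain
    t to exceed the loss caused by the Lipschitz function and the error. *)
Lemma inward_boundary Omega x0 : lipschitz_boundary Omega -> boundary Omega x0 ->
  exists r e c, inward Omega x0 r e c.
Proof.
move=> lO /lO[Q [g [L [QQ gL nO]]]].
have [d/= d0 dO] : exists2 d : R, 0 < d & forall x, `|x - x0| < d ->
    (Omega x <-> g (rV_behead (x *m Q)) < rV_head (x *m Q)).
  have /nbhs_ballP[d d0 dO] := nO; exists d => // x xd; apply: dO.
  by rewrite -ball_normE/= distrC.
have d20 : 0 < d / 2 by rewrite divr_gt0.
pose e1 : V := rV_cons (1, 0 : 'rV[R]_n).
pose e : V := e1 *m Q^T.
have eQ : e *m Q = e1 by rewrite /e -mulmxA (mulmx1C QQ) mulmx1.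
pose K := n.+1%:R * (`|L| + 1).
have K0 : 0 < K by rewrite mulr_gt0// ltr_wpDl.
pose c := Num.min 1 (Num.min (d / 2 / (`|e| + 1)) (1 / 2 / K)).
have e0 : 0 < `|e| + 1 by rewrite ltr_wpDl.
have c0 : 0 < c by rewrite !lt_min ltr01 !divr_gt0.
have c1 : c <= 1 by rewrite ge_min lexx.
have ce : c * (`|e| + 1) <= d / 2.
  by rewrite -ler_pdivlMr// /c; rewrite ge_min; apply/orP; right; rewrite ge_min lexx.
have cK : c * K <= 1 / 2.
  by rewrite -ler_pdivlMr// /c; rewrite ge_min; apply/orP; right; rewrite ge_min lexx orbT.
exists (d / 2), e, c; split => // x t h Ox xx0 /andP[t0 tc] ht.
have xd : `|x - x0| < d by apply: lt_trans xx0 _; lra.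
have yd : `|x + t *: e + h - x0| < d.
  rewrite (_ : x + t *: e + h - x0 = (x - x0) + (t *: e + h)); last first.
    by rewrite addrAC [X in X + _ = _]addrAC -!addrA.
  apply: le_lt_trans (ler_normD _ _) _.
  have : `|t *: e + h| <= c * (`|e| + 1).
    apply: le_trans (ler_normD _ _) _; rewrite normrZ gtr0_norm// mulrDr mulr1; apply: lerD.
      by rewrite ler_wpM2r// ltW.
    apply: le_trans ht _; rewrite ler_piMr//; [exact: ltW|].
    by apply: ltW; apply: lt_le_trans tc c1.
  by lra.
apply/(dO _ yd); move/(dO _ xd) : Ox.
rewrite !mulmxDl -scalemxAl eQ !rV_beheadD.
have -> : rV_behead (t *: e1) = 0.
  by apply/rowP => i; rewrite rV_beheadE mxE rV_cons_lift !mxE mulr0.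
rewrite addr0 /rV_head.
have -> : (x *m Q + t *: e1 + h *m Q) ord0 ord0 = (x *m Q) ord0 ord0 + t + (h *m Q) ord0 ord0.
  by rewrite mxE mxE; congr (_ + _ + _); rewrite mxE rV_cons_head mulr1.
set b := rV_behead (x *m Q); set b' := rV_behead (h *m Q) => gb.
have eh : enorm (h *m Q) <= n.+1%:R * (c * t).
  rewrite enorm_mulmx_ortho//; apply: enorm_le => [|i]; first by rewrite mulr_ge0// ltW.
  exact: le_trans (rV_norm_coord h i) ht.
have h1 : `|(h *m Q) ord0 ord0| <= n.+1%:R * (c * t) by apply: le_trans (le_coord_enorm _ _) eh.
have h2 : g (b + b') <= g b + `|L| * (n.+1%:R * (c * t)).
  rewrite -lerBlDl; apply: le_trans (ler_norm _) _; apply: le_trans (gL _ _) _.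
  rewrite addrAC subrr add0r; apply: le_trans (_ : `|L| * enorm b' <= _).
    by rewrite ler_wpM2r ?enorm_ge0// ler_norm.
  by rewrite ler_wpM2l//; apply: le_trans (enorm_behead_le _) eh.
have h3 : (`|L| + 1) * (n.+1%:R * (c * t)) <= 1 / 2 * t.
  rewrite (_ : (`|L| + 1) * _ = c * K * t); first by rewrite ler_wpM2r// ltW.
  by rewrite /K; ring.
move: h1; rewrite ler_norml => /andP[h1 _]; lra.
Qed.

Lemma inward_closure Omega x0 : open Omega -> lipschitz_boundary Omega -> closure Omega x0 ->
  exists r e c, inward Omega x0 r e c.
Proof.
move=> oO lO cx; have [Ox|Ox] := pselect (Omega x0); first exact: inward_interior.
apply: inward_boundary => //; split => // ix; apply: Ox.
exact: interior_subset ix.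
Qed.

Lemma ord_lower_bound N (f : 'I_N -> R) : (forall i, 0 < f i) ->
  exists2 m, 0 < m & forall i, m <= f i.
Proof.
elim: N f => [|N IH] f f0; first by exists 1 => // -[].
have [m m0 mf] := IH (fun i => f (lift ord0 i)) (fun i => f0 _).
exists (Num.min m (f ord0)); first by rewrite lt_min m0 f0.
move=> i; case: (unliftP ord0 i) => [j|] ->; last by rewrite ge_min lexx orbT.
by rewrite ge_min mf.
Qed.

Lemma compact_closure_bounded Omega : bounded_set Omega -> compact (closure Omega).
Proof.
move=> bO; apply: bounded_closed_compact; last exact: closed_closure.
have [M [_ hM]] := bO.
exists (M + 1); split; first exact: num_real.
move=> t Mt x cx /=.
have oM : Omega `<=` [set y | `|y| <= t].
  by move=> y Oy; apply: (hM t) => //; apply: lt_trans Mt; rewrite ltrDl.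
have cl : closed [set y : V | `|y| <= t].
  rewrite (_ : [set y : V | `|y| <= t] = (fun y : V => `|y|) @^-1` [set s | s <= t])//.
  by apply: closed_comp => [y _|]; [exact: norm_continuous|exact: closed_le].
by have := closure_subset oM; move/(_ x cx); rewrite -(closure_id _).1.
Qed.

(** Compactness of the closure; the balls have half the radius on which the
    cone condition holds, which leaves room for the hat functions. *)
Lemma finite_inward_cover Omega : open Omega -> bounded_set Omega -> lipschitz_boundary Omega ->
  exists N (x_ : 'I_N -> V) (r_ : 'I_N -> R) (e_ : 'I_N -> V) (c_ : 'I_N -> R),
    (forall i, inward Omega (x_ i) (r_ i) (e_ i) (c_ i)) /\
    (forall x, Omega x -> exists i, `|x - x_ i| < r_ i / 2).
Proof.
move=> oO bO lO.
have /choice[F hF] : forall x0 : V, exists p : R * V * R,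
    closure Omega x0 -> inward Omega x0 p.1.1 p.1.2 p.2.
  move=> x0; have [cx|cx] := pselect (closure Omega x0); last by exists (0, 0, 0).
  by have [r [e [c h]]] := inward_closure oO lO cx; exists (r, e, c).
have := compact_closure_bounded bO; rewrite compact_cover.
move=> /(_ _ (closure Omega) (fun x0 => ball x0 ((F x0).1.1 / 2))) [].
- by move=> x0 cx0; apply: ball_open; have [r0 _ _] := hF _ cx0; rewrite divr_gt0.
- move=> x cx; exists x => //; apply: ballxx.
  by have [r0 _ _] := hF _ cx; rewrite divr_gt0.
move=> D DO cov.
pose s := finmap.enum_fset D.
exists (size s), (fun i => s`_i), (fun i => (F s`_i).1.1), (fun i => (F s`_i).1.2), (fun i => (F s`_i).2).
split => [i|x Ox].
  apply: hF; have : s`_i \in s by exact: mem_nth.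
  by move=> h; have := DO s`_i h; rewrite inE.
have [y yD xy] := cov x (subset_closure Ox).
have ys : y \in s by exact: yD.
have ysz : (index y s < size s)%N by rewrite index_mem.
exists (Ordinal ysz) => /=; rewrite nth_index//.
by move: xy; rewrite -ball_normE/= distrC.
Qed.

Lemma normB_lip (a : R) x y : `|(a - `|x|) - (a - `|y|)| <= `|x - y|.
Proof. by rewrite opprB addrC addrA subrK distrC; exact: ler_dist_dist. Qed.

Lemma max_lip (a b m : R) : `|Num.max m a - Num.max m b| <= `|a - b|.
Proof.
rewrite /Num.max; case: ifPn => h1; case: ifPn => h2 //; rewrite ?subrr ?normr0//.
  by move: h2; rewrite -leNgt => h2; rewrite !ger0_norm; lra.
by move: h1; rewrite -leNgt => h1; rewrite distrC [`|a - b|]distrC !ger0_norm; lra.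
Qed.

(** Normalized hat functions of the finite cover. The denominator is truncated
    from below so that the quotients are Lipschitz on the whole space; on
    Omega the truncation is inactive. *)
Lemma inward_partition Omega : open Omega -> bounded_set Omega -> lipschitz_boundary Omega ->
  exists N (eta : 'I_N -> V -> R) (e : 'I_N -> V) (c L : R),
  [/\ 0 < c /\ 0 <= L, forall i x, 0 <= eta i x,
      (forall x, \sum_i eta i x <= 1) /\ (forall x, Omega x -> \sum_i eta i x = 1),
      forall i x y, `|eta i x - eta i y| <= L * `|x - y| &
      forall i x t h, Omega x -> eta i x != 0 -> 0 < t < c -> `|h| <= c * t ->
        Omega (x + t *: e i + h)].
Proof.
move=> oO bO lO.
have [N [x_ [r_ [e_ [c_ [inw cov]]]]]] := finite_inward_cover oO bO lO.
have r0 i : 0 < r_ i / 2 by have [? _ _] := inw i; rewrite divr_gt0.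
have c0 i : 0 < c_ i by have [_ ? _] := inw i.
have [m m0 mr] := ord_lower_bound r0.
have [c cp cc] := ord_lower_bound c0.
pose psi i x := Num.max 0 (r_ i - `|x - x_ i|).
have psi0 i x : 0 <= psi i x by rewrite /psi le_max lexx.
(* m is at most the sum of the hats on Omega, so the truncation is inactive there *)
pose Psi x := Num.max m (\sum_i psi i x).
have Psim x : m <= Psi x by rewrite /Psi le_max lexx.
have Psi0 x : 0 < Psi x by exact: lt_le_trans (Psim x).
have psiPsi i x : psi i x <= Psi x.
  rewrite /Psi le_max; apply/orP; right; rewrite (bigD1 i)//= lerDl.
  by apply: sumr_ge0.
have psiL i x y : `|psi i x - psi i y| <= `|x - y|.
  apply: le_trans (max_lip _ _ _) _; apply: le_trans (normB_lip _ _ _) _.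
  by rewrite opprB addrA subrK.
have PsiL x y : `|Psi x - Psi y| <= N%:R * `|x - y|.
  apply: le_trans (max_lip _ _ _) _; rewrite -sumrB; apply: le_trans (ler_norm_sum _ _ _) _.
  apply: (@le_trans _ _ (\sum_(i < N) `|x - y|)); first by apply: ler_sum => i _; exact: psiL.
  by rewrite sumr_const card_ord -[leLHS]mulr_natl.
exists N, (fun i x => psi i x / Psi x), e_, c, ((1 + N%:R) / m).
split.
- by split => //; rewrite divr_ge0 ?(ltW m0)// addr_ge0.
- by move=> i x; rewrite divr_ge0// ltW.
- split => x; first by rewrite -mulr_suml ler_pdivrMr// mul1r /Psi le_max lexx orbT.
  move=> Ox; rewrite -mulr_suml; have [i xi] := cov x Ox.
  have psx : Psi x = \sum_j psi j x.
    apply/max_idPr; rewrite (bigD1 i)//=; apply: (@le_trans _ _ (psi i x)).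
      by apply: le_trans (mr i) _; rewrite /psi le_max; apply/orP; right; lra.
    by rewrite lerDl; apply: sumr_ge0.
  by rewrite -psx divff// gt_eqF.
- move=> i x y.
  have -> : psi i x / Psi x - psi i y / Psi y =
    ((psi i x - psi i y) + (psi i y / Psi y) * (Psi y - Psi x)) / Psi x.
    by field; rewrite !gt_eqF.
  rewrite normrM normfV (gtr0_norm (Psi0 x)).
  have q1 : psi i y / Psi y <= 1 by rewrite ler_pdivrMr// mul1r.
  have q0 : 0 <= psi i y / Psi y by rewrite divr_ge0// ltW.
  have A : `|psi i x - psi i y + psi i y / Psi y * (Psi y - Psi x)| <= (1 + N%:R) * `|x - y|.
    apply: le_trans (ler_normD _ _) _; rewrite mulrDl mul1r; apply: lerD; first exact: psiL.
    rewrite normrM (ger0_norm q0) distrC; apply: le_trans (PsiL x y).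
    by rewrite ler_piMl.
  rewrite [leRHS]mulrAC; apply: ler_pM => //; first by rewrite invr_ge0 ltW.
  by rewrite lef_pV2 ?posrE.
- move=> i x t h Ox ni /andP[t0 tc] ht.
  have [_ _ inwi] := inw i; apply: inwi => //.
  + rewrite ltNge; apply/negP => hr; move/eqP: ni; apply.
    by rewrite /psi (_ : Num.max _ _ = 0) ?mul0r//; apply/max_idPl; lra.
  + by rewrite t0 (lt_le_trans tc).
  + by apply: le_trans ht _; rewrite ler_wpM2r// ltW.
Qed.

End inward.

(** * Representatives and the energy identity *)

Section representatives.
Context {R : realType} {n : nat}.
Local Notation V := 'rV[R]_n.+1.
Local Notation mu := (@lebesgue_rV R n.+1).
Variable Omega : set V.
Hypotheses (oO : open Omega) (bO : bounded_set Omega).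

Lemma measurable_Omega : measurable Omega.
Proof. exact: measurable_open. Qed.

Lemma bounded_sub_cube : exists M, Omega `<=` cube M.
Proof.
have [M [_ hM]] := bO; exists (M + 1) => x Ox i.
apply: le_trans (rV_norm_coord x i) _; apply: (hM (M + 1)) => //.
by rewrite ltrDl.
Qed.

Lemma bcs_indic_Omega : bcs (\1_Omega : V -> R).
Proof.
have [M hM] := bounded_sub_cube.
apply: (@bcs_dom _ _ _ 1 M); first by apply: measurable_indic; exact: measurable_Omega.
move=> x; rewrite mul1r ger0_norm// !indicE; case: (boolP (x \in Omega)) => //.
by rewrite inE => /hM xM; rewrite mem_set.
Qed.

(** Representatives that satisfy the constraints at every point; on them all
    the integrals below are over the whole space. *)
Definition pointwise_X (u : V -> R) := [/\ measurable_fun setT u, forall x, `|u x| <= 1 &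
  forall x, ~ Omega x -> u x = 0].

Lemma bcs_pointwise_X u : pointwise_X u -> bcs u.
Proof.
move=> [mu1 u1 u0].
have -> : u = (fun x => u x * \1_Omega x).
  apply/funext => x; rewrite indicE; case: (boolP (x \in Omega)) => [_|]; first by rewrite mulr1.
  by move/negP => xO; rewrite u0 ?mul0r// => Ox; apply: xO; rewrite inE.
by apply: (bcsMl bcs_indic_Omega mu1 u1).
Qed.

Lemma pointwise_X_space_X u : pointwise_X u -> space_X Omega u.
Proof. by move=> [m b z]; split => //; exact: aeW. Qed.

(** Values at the exceptional points are replaced by 0. *)
Definition rep (u : V -> R) (x : V) : R := if (x \in Omega) && (`|u x| <= 1) then u x else 0.

Lemma pointwise_X_rep u : space_X Omega u -> pointwise_X (rep u).
Proof.
move=> [mu1 _ _]; split.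
- have -> : rep u = (fun x => \1_(Omega `&` [set x | `|u x| <= 1]) x * u x).
    apply/funext => x; rewrite /rep indicE in_setI.
    have -> : (x \in [set x | `|u x| <= 1]) = (`|u x| <= 1) by apply/idP/idP; rewrite inE.
    by case: ifP; rewrite ?mul1r ?mul0r.
  apply: measurable_funM => //; apply: measurable_indic; apply: measurableI.
    exact: measurable_Omega.
  have -> : [set x | `|u x| <= 1] = (fun x => `|u x|) @^-1` `]-oo, 1].
    by apply/seteqP; split => x /=; rewrite in_itv.
  rewrite -[X in measurable X]setTI.
  by have : measurable_fun setT (fun x => `|u x|) by [exact: measurableT_comp]; apply.
- by move=> x; rewrite /rep; case: ifP => [/andP[]//|_]; rewrite normr0.
- by move=> x xO; rewrite /rep memNset.
Qed.

Lemma ae_rep u : space_X Omega u -> {ae mu, forall x, u x = rep u x}.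
Proof.
move=> [_ u1 u0]; move: u1 u0; apply: filterS2 => x u1 u0.
rewrite /rep u1 andbT; case: (boolP (x \in Omega)) => // /negP xO.
by apply: u0 => Ox; apply: xO; rewrite inE.
Qed.

Section ae_equal.
Variables u w : V -> R.
Hypotheses (mu1 : measurable_fun setT u) (mw : measurable_fun setT w).
Hypothesis uw : {ae mu, forall x, u x = w x}.

Lemma Rintegral_ae_eq (f g : V -> R) : measurable_fun setT f -> measurable_fun setT g ->
  {ae mu, forall x, f x = g x} -> \int[mu]_x f x = \int[mu]_x g x.
Proof.
move=> mf mg fg; rewrite /Rintegral; congr fine; apply: ae_eq_integral => //.
- exact/measurable_EFinP.
- exact/measurable_EFinP.
- by move: fg; apply: filterS => x /= -> .
Qed.

Lemma fourier_energy_ae : fourier_energy u = fourier_energy w.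
Proof.
apply/funext => xi; rewrite !fourier_energyE; congr (_ * (_ ^+ 2 + _ ^+ 2)).
  apply: Rintegral_ae_eq.
  - by apply: measurable_funM => //; apply: measurable_cosdotT => //; exact: measurable_id.
  - by apply: measurable_funM => //; apply: measurable_cosdotT => //; exact: measurable_id.
  - by move: uw; apply: filterS => x ->.
apply: Rintegral_ae_eq.
- by apply: measurable_funM => //; apply: measurable_sindotT => //; exact: measurable_id.
- by apply: measurable_funM => //; apply: measurable_sindotT => //; exact: measurable_id.
- by move: uw; apply: filterS => x ->.
Qed.

Lemma measurable_W (f : V -> R) : measurable_fun setT f -> measurable_fun setT (fun x => W (f x)).
Proof.
move=> mf; rewrite /W; apply: measurable_funM => //; apply: measurable_funX.
by apply: measurable_funB => //; exact: measurable_funX.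
Qed.

Lemma Ftilde_ae eps s : Ftilde_s Omega eps s u = Ftilde_s Omega eps s w.
Proof.
rewrite /Ftilde_s /F_s /Hs_seminorm2 fourier_energy_ae; congr (_ * (_ + _ - _))%E.
apply: ae_eq_integral.
- exact: measurable_Omega.
- by apply/measurable_EFinP; apply: measurable_funTS; exact: measurable_W.
- by apply/measurable_EFinP; apply: measurable_funTS; exact: measurable_W.
- by move: uw; apply: filterS => x /= -> .
Qed.

Lemma two_phase_ae eps : two_phase Omega eps u -> two_phase Omega eps w.
Proof.
move=> [E [mE EO h]]; exists E; split => //.
by move: uw h; apply: filterS2 => x <-.
Qed.

End ae_equal.

Lemma F0_ae eps u w : measurable_fun setT u -> measurable_fun setT w ->
  {ae mu, forall x, u x = w x} -> F_0 Omega eps u = F_0 Omega eps w.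
Proof.
move=> mu1 mw uw; rewrite /F_0 (fourier_energy_ae mu1 mw uw).
have -> // : `[< two_phase Omega eps u >] = `[< two_phase Omega eps w >].
apply/asbool_equiv_eq; split; first exact: two_phase_ae.
by apply: two_phase_ae => //; move: uw; apply: filterS => x ->.
Qed.

End representatives.

Section energy_identity.
Context {R : realType} {n : nat}.
Local Notation V := 'rV[R]_n.+1.
Local Notation mu := (@lebesgue_rV R n.+1).
Variable Omega : set V.
Hypotheses (oO : open Omega) (bO : bounded_set Omega).
Variable eps : R.
Hypothesis heps : 0 < eps < 1.

(** The value 0 at xi = 0 agrees with the convention ln 0 = 0, so that the
    bounds below hold everywhere. *)
Definition log_quotient (s : R) (xi : V) : R :=
  if enorm xi == 0 then 0 else (expR (2 * s * ln (enorm xi)) - 1) / (2 * s).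

(** Convexity of the exponential at 0, from below and, after multiplication by
    exp(2 s ln|xi|), from above. *)
Lemma log_quotient_bounds s xi : 0 < s ->
  ln (enorm xi) <= log_quotient s xi <= ln (enorm xi) * expR (2 * s * ln (enorm xi)).
Proof.
move=> s0; rewrite /log_quotient; case: eqP => [->|_]; first by rewrite ln0// mul0r lexx.
set l := ln _; have s2 : 0 < 2 * s by rewrite mulr_gt0.
rewrite ler_pdivlMr// ler_pdivrMr//; apply/andP; split.
  by have := @expR_ge1Dx R (2 * s * l); lra.
have := @expR_ge1Dx R (- (2 * s * l)) => h.
have X0 := expR_ge0 (2 * s * l).
have := ler_wpM2l X0 h; rewrite -expRD subrr expR0; lra.
Qed.

Lemma measurable_log_quotient s : measurable_fun setT (log_quotient s).
Proof.
apply: measurable_fun_ifT.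
- apply: (measurable_fun_eqr) => //; exact: (measurable_enorm (@measurable_id _ _ _)).
- exact: measurable_cst.
- apply: measurable_funM => //; apply: measurable_funB => //; apply: measurableT_comp => //.
  by apply: measurable_funM => //; exact: measurable_ln_enorm.
Qed.

Lemma enorm_neq0_ae : {ae mu, forall xi : V, enorm xi != 0}.
Proof.
have := @hyperplane_null R n.+1 ord0 0; apply: filterS => xi xi0.
apply: lt0r_neq0; apply: lt_le_trans (le_coord_enorm xi ord0).
by rewrite normr_gt0; apply/eqP.
Qed.

Definition well_excess (u : V -> R) : R :=
  \int[mu]_x (\1_Omega x * ((u x ^+ 2 - (1 - eps ^+ 2)) ^+ 2 / 4)).

Lemma well_excess_ge0 u : 0 <= well_excess u.
Proof. by apply: Rintegral_ge0 => x _; rewrite mulr_ge0// divr_ge0// sqr_ge0. Qed.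

Variable u : V -> R.
Hypothesis Xu : pointwise_X Omega u.
Let bu := bcs_pointwise_X oO bO Xu.
Let E := fourier_energy u.

Let q_gt0 : 0 < 1 - eps ^+ 2.
Proof. by move: heps => /andP[e0 e1]; nra. Qed.

Let IE : mu.-integrable setT (EFin \o E). Proof. exact: integrable_energy. Qed.
Let mE : measurable_fun setT E. Proof. exact: measurable_fourier_energy. Qed.
Let E0 xi : 0 <= E xi. Proof. exact: fourier_energy_ge0. Qed.

(** Completing the square: k_eps is the minimum of r |-> W r + eps^2/2 r^2. *)
Lemma double_wellE (r : R) : W r + eps ^+ 2 / 2 * r ^+ 2 - k_ eps = (r ^+ 2 - (1 - eps ^+ 2)) ^+ 2 / 4.
Proof. by rewrite /k_ /W sqr_sqrtr ?(ltW q_gt0)//; field. Qed.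

Let ibd (f : V -> R) K : measurable_fun setT f -> (forall x, `|f x| <= K) ->
  mu.-integrable setT (EFin \o (fun x => \1_Omega x * f x)).
Proof.
move=> mf fK; apply: bcs_integrable.
exact: (bcsMr (bcs_indic_Omega oO bO) mf fK).
Qed.

Let usq1 x : 0 <= u x ^+ 2 <= 1.
Proof.
have [_ u1 _] := Xu; rewrite sqr_ge0/= -real_normK ?num_real//.
by rewrite expr_le1.
Qed.

Let mu1 : measurable_fun setT u. Proof. by case: Xu. Qed.

Let intO (f : V -> R) : mu.-integrable setT (EFin \o (fun x => \1_Omega x * f x)) ->
  (\int[mu]_(x in Omega) (f x)%:E = (\int[mu]_x (\1_Omega x * f x))%:E)%E.
Proof.
move=> I; rewrite EFin_Rintegral// [LHS]integral_mkcond; apply: eq_integral => x _.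
by rewrite patchE indicE; case: (x \in Omega); rewrite ?mul1r ?mul0r.
Qed.

Let IW : mu.-integrable setT (EFin \o (fun x => \1_Omega x * W (u x))).
Proof.
apply: (@ibd _ 1); first exact: measurable_W.
move=> x; have /andP[h0 h1] := usq1 x; rewrite /W ger0_norm; last by rewrite divr_ge0// sqr_ge0.
by nra.
Qed.

Let Ik : mu.-integrable setT (EFin \o (fun x => \1_Omega x * k_ eps)).
Proof. exact: (@ibd _ `|k_ eps|). Qed.

Let Isq : mu.-integrable setT (EFin \o (fun x => \1_Omega x * (eps ^+ 2 / 2 * u x ^+ 2))).
Proof.
apply: (@ibd _ 1); first by apply: measurable_funM => //; exact: measurable_funX.
move=> x; have /andP[h0 h1] := usq1 x; move: heps => /andP[e0 e1].
by rewrite ger0_norm; [nra|rewrite mulr_ge0// divr_ge0// sqr_ge0].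
Qed.

Let wells : \int[mu]_x (\1_Omega x * W (u x)) + eps ^+ 2 / 2 * \int[mu]_xi E xi -
   \int[mu]_x (\1_Omega x * k_ eps) = well_excess u.
Proof.
rewrite Rplancherel//.
have -> : eps ^+ 2 / 2 * \int[mu]_x (u x ^+ 2) = \int[mu]_x (\1_Omega x * (eps ^+ 2 / 2 * u x ^+ 2)).
  rewrite -RintegralZl//; last first.
    by apply: bcs_integrable; under eq_fun do rewrite expr2; exact: bcsM.
  apply: eq_Rintegral => x _; rewrite indicE; have [_ _ u0] := Xu.
  case: (boolP (x \in Omega)) => [_|/negP xO]; first by rewrite mul1r.
  by rewrite u0 ?expr0n/= ?mulr0// => Ox; apply: xO; rewrite inE.
rewrite -RintegralD// -RintegralB//; last exact: RintegrableD.
by apply: eq_Rintegral => x _; rewrite -double_wellE; ring.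
Qed.

Let ge0_lin (f g : V -> R) c : 0 <= c -> measurable_fun setT f -> measurable_fun setT g ->
  (forall x, 0 <= f x) -> (forall x, 0 <= g x) ->
  (\int[mu]_x (f x)%:E + c%:E * \int[mu]_x (g x)%:E = \int[mu]_x (f x + c * g x)%:E)%E.
Proof.
move=> c0 mf mg f0 g0.
have mcg : measurable_fun setT (fun x => c * g x) by exact: measurable_funM.
transitivity (\int[mu]_x ((f x)%:E + (c * g x)%:E))%E; last by [].
rewrite (@ge0_integralD _ _ _ mu setT measurableT (fun x => (f x)%:E) (fun x => (c * g x)%:E)).
- congr (_ + _)%E.
  rewrite -(@ge0_integralZl _ _ _ mu setT measurableT (fun x => (g x)%:E)) ?lee_fin//.
  + exact/measurable_EFinP.
  + by move=> x _; rewrite lee_fin.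
- by move=> x _; rewrite lee_fin.
- exact/measurable_EFinP.
- by move=> x _; rewrite lee_fin mulr_ge0.
- exact/measurable_EFinP.
Qed.

(** Plancherel's identity trades eps^2/2 u^2 for the integral of the energy,
    which turns |xi|^(2s) into |xi|^(2s) - 1. Both sides may be +oo; positive
    and negative parts are balanced separately because only the negative part
    of the frequency integrand is integrable a priori. *)
Lemma Ftilde_identity s : 0 < s ->
  Ftilde_s Omega eps s u = ((eps ^+ 2 / 2)%:E * \int[mu]_xi (log_quotient s xi * E xi)%:E +
    (well_excess u / (2 * s))%:E)%E.
Proof.
move=> s0; have s2 : 0 < 2 * s by rewrite mulr_gt0.
have e2 : 0 < eps ^+ 2 / 2 by move: heps => /andP[e0 e1]; rewrite divr_gt0// exprn_gt0.
rewrite /Ftilde_s /F_s (intO IW) (intO Ik).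
pose f xi : R := log_quotient s xi * E xi.
have mf : measurable_fun setT f by apply: measurable_funM => //; exact: measurable_log_quotient.
pose fp xi := Num.max 0 (f xi). pose fm xi := Num.max 0 (- f xi).
have fp0 xi : 0 <= fp xi by rewrite /fp le_max lexx.
have fm0 xi : 0 <= fm xi by rewrite /fm le_max lexx.
have mfp : measurable_fun setT fp by exact: measurable_maxr.
have mfm : measurable_fun setT fm by apply: measurable_maxr => //; exact: measurableT_comp.
have fpm xi : f xi = fp xi - fm xi.
  by rewrite /fp /fm /Num.max; case: ifPn => h1; case: ifPn => h2; lra.
have Ifm : mu.-integrable setT (EFin \o fm).
  apply: (le_Rintegrable mfm _ (RintegrableZ (2 * s)^-1 IE)) => xi.
  rewrite ger0_norm// /fm ge_max mulr_ge0 ?invr_ge0 ?(ltW s2)//= /f -mulNr ler_wpM2r//.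
  rewrite /log_quotient; case: ifP => _; first by rewrite oppr0 invr_ge0 ltW.
  rewrite -mulNr opprB -[leRHS]mul1r; apply: ler_wpM2r; first by rewrite invr_ge0 ltW.
  by have := expR_ge0 (2 * s * ln (enorm xi)); lra.
have Ef : (\int[mu]_xi (f xi)%:E = \int[mu]_xi (fp xi)%:E - \int[mu]_xi (fm xi)%:E)%E.
  rewrite integralE; congr (_ - _)%E; apply: eq_integral => xi _.
    by rewrite unlock /= maxC -EFin_max.
  by rewrite unlock /= maxC -EFin_max.
have H : (Hs_seminorm2 s u + (2 * s)%:E * \int[mu]_xi (fm xi)%:E =
    \int[mu]_xi (E xi)%:E + (2 * s)%:E * \int[mu]_xi (fp xi)%:E)%E.
  have mpw : measurable_fun setT (fun xi : V => enorm xi `^ (2 * s) * E xi).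
    apply: measurable_funM => //; exact: (measurableT_comp (@measurable_powR R (2 * s)) (measurable_enorm (@measurable_id _ V setT))).
  have pw0 (xi : V) : 0 <= enorm xi `^ (2 * s) * E xi by rewrite mulr_ge0// powR_ge0.
  rewrite (ge0_lin (ltW s2) mE mfp E0 fp0).
  have -> : Hs_seminorm2 s u = (\int[mu]_xi (enorm xi `^ (2 * s) * E xi)%:E)%E by [].
  rewrite (ge0_lin (ltW s2) mpw mfm pw0 fm0).
  apply: ge0_ae_eq_integral => //.
  - by apply/measurable_EFinP/measurable_funD => //; exact: measurable_funM.
  - by apply/measurable_EFinP/measurable_funD => //; exact: measurable_funM.
  - by move=> xi _; rewrite lee_fin addr_ge0// mulr_ge0// ltW.
  - by move=> xi _; rewrite lee_fin addr_ge0// mulr_ge0// ltW.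
  have := enorm_neq0_ae; apply: filterS => xi xi0 _; congr EFin.
  have : 2 * s * f xi = enorm xi `^ (2 * s) * E xi - E xi.
    rewrite /f /log_quotient (negbTE xi0) /powR (negbTE xi0); field; exact: lt0r_neq0.
  by rewrite fpm; lra.
rewrite Ef -(EFin_Rintegral Ifm); move: H; rewrite -(EFin_Rintegral Ifm) -(EFin_Rintegral IE).
have wE := wells; move: wE.
set w := \int[mu]_x _; set e := \int[mu]_xi E xi; set k := \int[mu]_x _; set m := \int[mu]_xi fm xi.
set c := eps ^+ 2 / 2 in e2 *; set v := well_excess u => wE.
have : (0 <= \int[mu]_xi (fp xi)%:E)%E by apply: integral_ge0 => xi _; rewrite lee_fin.
case: (\int[mu]_xi (fp xi)%:E)%E => [p _|_|//].
  case: (Hs_seminorm2 s u) => [h| |] //=.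
  move=> [H].
  have G : (2 * s)^-1 * (c * h + w - k) = c * (p - m) + v / (2 * s).
    rewrite (_ : h = e + 2 * s * p - 2 * s * m); last by lra.
    by rewrite -wE; field; exact: lt0r_neq0.
  exact: (congr1 EFin G).
rewrite mulry (gtr0_sg s2) mul1e addey// -EFinM.
case: (Hs_seminorm2 s u) => [h| |] // _.
by rewrite addye// mulry (gtr0_sg e2) mul1e !addye// mulry gtr0_sg ?invr_gt0// mul1e.
Qed.

End energy_identity.

(** * Convergence of the energies *)

Section ereal_liminf.
Context {R : realType}.
Implicit Types (u : nat -> \bar R) (x y : \bar R).

Lemma lee_real_below x y : (forall r : R, (r%:E < x)%E -> (r%:E <= y)%E) -> (x <= y)%E.
Proof.
case: x => [v| |] h; last by rewrite leNye.
- case: y h => [s| |] h; rewrite ?leey//.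
    rewrite lee_fin leNgt; apply/negP => sv.
    have /h : (((s + v) / 2)%:E < v%:E)%E by rewrite lte_fin; lra.
    by rewrite lee_fin; lra.
  by have /h : ((v - 1)%:E < v%:E)%E by [rewrite lte_fin; lra].
- case: y h => [s| |] h; rewrite ?leey//.
    have /h : ((s + 1)%:E < +oo)%E by exact: ltry.
    by rewrite lee_fin {h} gerDl ler10.
  by have /h : (0%:E < +oo :> \bar R)%E by exact: ltry.
Qed.

Lemma limn_einfE u : limn_einf u = ereal_sup (range (einfs u)).
Proof. by rewrite limn_einf_lim; apply/cvg_lim => //; exact: cvg_einfs_sup. Qed.

Lemma le_limn_einf u x : (forall r : R, (r%:E < x)%E -> \forall k \near \oo, (r%:E <= u k)%E) ->
  (x <= limn_einf u)%E.
Proof.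
move=> h; apply: lee_real_below => r /h[N _ hN]; rewrite limn_einfE.
apply: (@le_trans _ _ (einfs u N)); last by apply: ereal_sup_ubound; exists N.
by apply: le_ereal_inf_tmp => _ [k /= Nk <-]; exact: hN.
Qed.

Lemma lt_limn_einf u (r : R) : (r%:E < limn_einf u)%E -> \forall k \near \oo, (r%:E < u k)%E.
Proof.
rewrite limn_einfE => /ereal_sup_gt[_ [N _ <-]] h; exists N => // k /= Nk.
by apply: lt_le_trans h _; apply: ereal_inf_lbound; exists k.
Qed.

End ereal_liminf.

Section integrable_wells.
Context {R : realType} {n : nat}.
Local Notation V := 'rV[R]_n.+1.
Local Notation mu := (@lebesgue_rV R n.+1).
Variable Omega : set V.
Hypotheses (oO : open Omega) (bO : bounded_set Omega).
Variable eps : R.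
Hypothesis heps : 0 < eps < 1.

Let mOmega : measurable Omega := measurable_Omega oO.

Lemma measurable_well (u : V -> R) : measurable_fun setT u ->
  measurable_fun setT (fun x : V => \1_Omega x * ((u x ^+ 2 - (1 - eps ^+ 2)) ^+ 2 / 4)).
Proof.
move=> mu1; apply: measurable_funM; first by apply: measurable_indic; exact: mOmega.
apply: measurable_funM => //; apply: measurable_funX; apply: measurable_funB => //.
exact: measurable_funX.
Qed.

Lemma integrable_well u : pointwise_X Omega u ->
  mu.-integrable setT (EFin \o (fun x : V => \1_Omega x * ((u x ^+ 2 - (1 - eps ^+ 2)) ^+ 2 / 4))).
Proof.
move: heps => /andP[e0 e1] [mw w1 _]; apply: bcs_integrable.
apply: (@bcsMr _ _ (\1_Omega) _ 1 (bcs_indic_Omega oO bO)).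
  apply: measurable_funM => //; apply: measurable_funX; apply: measurable_funB => //.
  exact: measurable_funX.
move=> x; rewrite ger0_norm; last by rewrite divr_ge0// sqr_ge0.
have h3 : 0 <= u x ^+ 2 by exact: sqr_ge0.
have h4 : u x ^+ 2 <= 1 by rewrite -real_normK ?num_real// expr_le1.
have q1 : 0 < eps ^+ 2 <= 1 by rewrite exprn_gt0//= expr_le1// ltW.
rewrite ler_pdivrMr// mul1r; apply: (@le_trans _ _ 1) => //; last by lra.
by rewrite -real_normK ?num_real// expr_le1// ler_norml; apply/andP; split; lra.
Qed.

End integrable_wells.

Section convergence_of_energies.
Context {R : realType} {n : nat}.
Local Notation V := 'rV[R]_n.+1.
Local Notation mu := (@lebesgue_rV R n.+1).
Variable Omega : set V.
Hypotheses (oO : open Omega) (bO : bounded_set Omega).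
Variables (u_ : nat -> V -> R) (u : V -> R).
Hypotheses (Xu_ : forall k, pointwise_X Omega (u_ k)) (Xu : pointwise_X Omega u).
Hypothesis cvgu : \int[mu]_x `|u_ k x - u x| @[k --> \oo] --> 0.

Let bu_ k := bcs_pointwise_X oO bO (Xu_ k).
Let bu := bcs_pointwise_X oO bO Xu.

Let trig_cvg (T : R -> R) (mT : measurable_fun setT T) (T1 : forall t, `|T t| <= 1) xi :
  \int[mu]_x (T (dotmul x xi) * u_ k x) @[k --> \oo] --> \int[mu]_x (T (dotmul x xi) * u x).
Proof.
have bT (w : V -> R) : bcs w -> bcs (fun x => T (dotmul x xi) * w x).
  move=> bw; apply: (bcsMl bw _ (fun x => T1 _)).
  by apply: (measurableT_comp mT); apply: measurable_dotmul => //; exact: measurable_id.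
apply/cvgrPdist_le => e e0; have /cvgr0Pnorm_le/(_ _ e0) := cvgu.
apply: filterS => k hk; apply: le_trans hk; apply: le_trans (ler_norm _).
rewrite -RintegralB//; last 2 first.
- exact/bcs_integrable/bT.
- exact/bcs_integrable/bT.
have bD : bcs (fun x => u x - u_ k x) by apply: bcsB.
have bTD := bT _ bD.
have -> : (fun x => T (dotmul x xi) * u x - T (dotmul x xi) * u_ k x) =
  (fun x => T (dotmul x xi) * (u x - u_ k x)) by apply/funext => x; rewrite mulrBr.
apply: le_trans (le_normr_Rintegral measurableT (bcs_integrable bTD)) _.
apply: le_Rintegral => //.
- exact/bcs_integrable/bcs_norm.
- by apply/bcs_integrable/bcs_norm/bcsB.
- by move=> x _; rewrite normrM distrC ler_piMl.
Qed.

Lemma energy_cvg xi : fourier_energy (u_ k) xi @[k --> \oo] --> fourier_energy u xi.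
Proof.
rewrite fourier_energyE; under eq_fun do rewrite fourier_energyE.
apply: cvgM; first exact: cvg_cst.
apply: cvgD; rewrite expr2; under eq_fun do rewrite expr2; apply: cvgM.
- exact: (trig_cvg (continuous_measurable_fun (@continuous_cos R)) (@cos_norm_le1 R)).
- exact: (trig_cvg (continuous_measurable_fun (@continuous_cos R)) (@cos_norm_le1 R)).
- exact: (trig_cvg (continuous_measurable_fun (@continuous_sin R)) (@sin_norm_le1 R)).
- exact: (trig_cvg (continuous_measurable_fun (@continuous_sin R)) (@sin_norm_le1 R)).
Qed.

(** The cosine and sine transforms are bounded by the L^1 norm, and an
    admissible function is dominated by the indicator of Omega. *)
Definition energy_bound : R := ((2 * pi) ^+ n.+1)^-1 * (2 * (\int[mu]_x \1_Omega x) ^+ 2).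

Lemma energy_le w xi : pointwise_X Omega w -> fourier_energy w xi <= energy_bound.
Proof.
move=> Xw; have bw := bcs_pointwise_X oO bO Xw.
have h (f : V -> R) : bcs f -> (forall x, `|f x| <= `|w x|) ->
    (\int[mu]_x f x) ^+ 2 <= (\int[mu]_x \1_Omega x) ^+ 2.
  move=> bf fw; rewrite -[leLHS]real_normK ?num_real// ler_sqr ?nnegrE//; last exact: Rintegral_ge0.
  apply: le_trans (le_normr_Rintegral measurableT (bcs_integrable bf)) _.
  apply: le_Rintegral => //; first exact/bcs_integrable/bcs_norm.
    exact/bcs_integrable/bcs_indic_Omega.
  move=> x _; apply: le_trans (fw x) _; have [_ w1 w0] := Xw; rewrite indicE.
  by case: (boolP (x \in Omega)) => [_|/negP xO] /=; [exact: w1|rewrite w0 ?normr0// => Ox; apply: xO; rewrite inE].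
rewrite fourier_energyE /energy_bound ler_wpM2l ?invr_ge0 ?exprn_ge0 ?mulr_ge0 ?pi_ge0//.
rewrite mulrDl mul1r; apply: lerD; apply: h.
- exact: bcs_cosM.
- by move=> x; rewrite normrM ler_piMl// cos_norm_le1.
- exact: bcs_sinM.
- by move=> x; rewrite normrM ler_piMl// sin_norm_le1.
Qed.

Lemma integrable_lnminus_energy w : pointwise_X Omega w ->
  mu.-integrable setT (EFin \o (fun xi => lnminus xi * fourier_energy w xi)).
Proof.
move=> Xw; have bw := bcs_pointwise_X oO bO Xw.
apply: (le_Rintegrable _ _ (RintegrableZ energy_bound (@integrable_lnminus R n))).
  by apply: measurable_funM; [exact: measurable_lnminus|exact: measurable_fourier_energy].
move=> xi; rewrite ger0_norm; last by apply: mulr_ge0; [exact: lnminus_ge0|exact: fourier_energy_ge0].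
by rewrite mulrC ler_wpM2r ?lnminus_ge0// energy_le.
Qed.

Lemma lnminus_energy_cvg : \int[mu]_xi (lnminus xi * fourier_energy (u_ k) xi) @[k --> \oo] -->
  \int[mu]_xi (lnminus xi * fourier_energy u xi).
Proof.
apply: (@Rdominated_cvg _ _ _ mu _ _ (fun xi => energy_bound * lnminus xi) _ _ _ _ _).2.
- by move=> k; apply: measurable_funM; [exact: measurable_lnminus|exact: measurable_fourier_energy].
- by apply: measurable_funM; [exact: measurable_lnminus|exact: measurable_fourier_energy].
- by apply: aeW => xi /=; apply: cvgM; [exact: cvg_cst|exact: energy_cvg].
- exact: RintegrableZ (@integrable_lnminus R n).
- move=> k xi; rewrite ger0_norm; last by apply: mulr_ge0; [exact: lnminus_ge0|exact: fourier_energy_ge0].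
  by rewrite mulrC ler_wpM2r ?lnminus_ge0// energy_le.
Qed.

(** The energies converge pointwise, and Fatou's lemma asks for nothing more
    on the high frequencies. *)
Lemma lnplus_energy_liminf :
  (\int[mu]_xi (lnplus xi * fourier_energy u xi)%:E <=
   limn_einf (fun k => \int[mu]_xi (lnplus xi * fourier_energy (u_ k) xi)%:E))%E.
Proof.
pose f k xi : \bar R := (lnplus xi * fourier_energy (u_ k) xi)%:E.
have mf k : measurable_fun setT (f k).
  apply/measurable_EFinP; apply: measurable_funM; [exact: measurable_lnplus|exact: measurable_fourier_energy].
have f0 k xi : [set: V] xi -> (0 <= f k xi)%E.
  by move=> _; rewrite lee_fin; apply: mulr_ge0; [exact: lnplus_ge0|exact: fourier_energy_ge0].
have := fatou mu measurableT mf f0; apply: le_trans.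
rewrite le_eqVlt; apply/orP; left; apply/eqP; apply: eq_integral => xi _.
have c : f k xi @[k --> \oo] --> (lnplus xi * fourier_energy u xi)%:E.
  by apply: cvg_EFin; [exact: nearW|apply: cvgM; [exact: cvg_cst|exact: energy_cvg]].
by rewrite (cvg_limn_einf_sup c).1.
Qed.

Lemma well_excess_cvg eps : 0 < eps < 1 ->
  well_excess Omega eps (u_ k) @[k --> \oo] --> well_excess Omega eps u.
Proof.
move=> heps; have /andP[e0 e1] := heps.
apply/cvgrPdist_le => e ep; have /cvgr0Pnorm_le/(_ _ ep) := cvgu.
apply: filterS => k hk; apply: le_trans hk; apply: le_trans (ler_norm _).
have Ik := integrable_well oO bO heps (Xu_ k); have Iu := integrable_well oO bO heps Xu.
rewrite distrC /well_excess -RintegralB//.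
apply: le_trans (le_normr_Rintegral measurableT (RintegrableB Ik Iu)) _.
apply: le_Rintegral => //.
- exact: integrable_norm (RintegrableB Ik Iu).
- by apply/bcs_integrable/bcs_norm/bcsB.
move=> x _; rewrite indicE; case: (x \in Omega) => /=; last by rewrite !mul0r subrr normr0.
have [_ a1 _] := Xu_ k; have [_ b1 _] := Xu; move: (a1 x) (b1 x); rewrite !mul1r.
move: (u_ k x) (u x) => a b; rewrite ![in X in X -> _]ler_norml => /andP[h1 h2]; rewrite ![in X in X -> _]ler_norml => /andP[h3 h4].
rewrite (_ : _ - _ = (a - b) * ((a + b) * (a ^+ 2 + b ^+ 2 - 2 * (1 - eps ^+ 2)) / 4)); last by field.
rewrite normrM ler_piMr// normrM [`|4^-1|]ger0_norm// ler_pdivrMr// mul1r normrM.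
have A : `|a + b| <= 2 by rewrite ler_norml; apply/andP; split; lra.
have B : `|a ^+ 2 + b ^+ 2 - 2 * (1 - eps ^+ 2)| <= 2.
  have q1 : 0 < eps ^+ 2 <= 1 by rewrite exprn_gt0//= expr_le1// ltW.
  have a2 : 0 <= a ^+ 2 <= 1 by rewrite sqr_ge0/= -real_normK ?num_real// expr_le1// ler_norml h1.
  have b2 : 0 <= b ^+ 2 <= 1 by rewrite sqr_ge0/= -real_normK ?num_real// expr_le1// ler_norml h3.
  by rewrite ler_norml; apply/andP; split; lra.
by rewrite (_ : 4 = 2 * 2); [exact: ler_pM|lra].
Qed.

End convergence_of_energies.

(** * The lower bound *)

Section gamma_liminf.
Context {R : realType} {n : nat}.
Local Notation V := 'rV[R]_n.+1.
Local Notation mu := (@lebesgue_rV R n.+1).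
Variable Omega : set V.
Hypotheses (oO : open Omega) (bO : bounded_set Omega).
Variable eps : R.
Hypothesis heps : 0 < eps < 1.

Let mOmega : measurable Omega := measurable_Omega oO.

Lemma L1_cvgE (u_ : nat -> V -> R) u : (forall k, pointwise_X Omega (u_ k)) -> pointwise_X Omega u ->
  L1_cvg Omega u_ u <-> (\int[mu]_x `|u_ k x - u x| @[k --> \oo] --> 0).
Proof.
move=> Xu_ Xu.
have E k : (\int[mu]_(x in Omega) `|u_ k x - u x|%:E = (\int[mu]_x `|u_ k x - u x|)%:E)%E.
  rewrite EFin_Rintegral; last exact/bcs_integrable/bcs_norm/(bcsB (bcs_pointwise_X oO bO (Xu_ k)) (bcs_pointwise_X oO bO Xu)).
  rewrite [LHS]integral_mkcond; apply: eq_integral => x _; rewrite patchE.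
  case: (boolP (x \in Omega)) => // /negP xO.
  have nO : ~ Omega x by move=> Ox; apply: xO; rewrite inE.
  by have [_ _ h1] := Xu_ k; have [_ _ h2] := Xu; rewrite h1// h2// subrr normr0.
rewrite /L1_cvg; under eq_fun do rewrite E; split; last by move=> h; apply: cvg_EFin => //; exact: nearW.
by move=> /(@fine_cvgP _ _ _ _ _ (0 : R))[_].
Qed.

(** The integrand vanishes almost everywhere, so u^2 = 1 - eps^2 there, and E
    is the set where u is positive. *)
Lemma two_phase_excess0 u : pointwise_X Omega u -> well_excess Omega eps u = 0 -> two_phase Omega eps u.
Proof.
move=> Xu V0; have [mu1 u1 u0] := Xu.
have q0 : 0 < 1 - eps ^+ 2 by move: heps => /andP[e0 e1]; nra.
exists (Omega `&` [set x | 0 < u x]); split.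
- apply: measurableI => //.
  have -> : [set x | 0 < u x] = u @^-1` `]0, +oo[.
    by apply/seteqP; split => x /=; rewrite in_itv/= andbT.
  by rewrite -[X in measurable X]setTI; exact: mu1.
- exact: subIsetl.
have I := integrable_well oO bO heps Xu.
have : ae_eq mu setT (EFin \o (fun x : V => \1_Omega x * ((u x ^+ 2 - (1 - eps ^+ 2)) ^+ 2 / 4))) (cst 0%E).
  apply/(ae_eq_integral_abs mu measurableT); first by apply/measurable_EFinP; exact: (measurable_well oO).
  move: V0; rewrite /well_excess => V0.
  transitivity ((0:R)%:E); last by [].
  rewrite -V0 EFin_Rintegral//; apply: eq_integral => x _ /=; rewrite ger0_norm//.
  by rewrite mulr_ge0// divr_ge0// sqr_ge0.
apply: filterS => x /= /(_ Logic.I)[].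
rewrite !indicE !in_setD in_setI; case: (boolP (x \in Omega)) => [_|/negP xO] /=; last first.
  by rewrite subrr mulr0 u0// => Ox; apply: xO; rewrite inE.
rewrite mul1r => /eqP; rewrite mulf_eq0 invr_eq0 (_ : (4 == 0 :> R) = false) ?orbF; last by apply/negbTE.
rewrite sqrf_eq0 subr_eq0 => /eqP h.
have -> : Num.sqrt (1 - eps ^+ 2) = `|u x| by rewrite -h sqrtr_sqr.
have [p|m] := ltrP 0 (u x).
  by rewrite mem_set//= subr0 mulr1 gtr0_norm.
by rewrite memNset/= ?ler0_norm ?sub0r ?mulrN1 ?opprK// => /(le_lt_trans m); rewrite ltxx.
Qed.

Section one_function.
Variable u : V -> R.
Hypothesis Xu : pointwise_X Omega u.
Let bu := bcs_pointwise_X oO bO Xu.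
Let E := fourier_energy u.
Let E0 xi : 0 <= E xi. Proof. exact: fourier_energy_ge0. Qed.
Let mE : measurable_fun setT E. Proof. exact: measurable_fourier_energy. Qed.

Lemma integral_lnE : (\int[mu]_xi (ln (enorm xi) * E xi)%:E =
  \int[mu]_xi (lnplus xi * E xi)%:E - (\int[mu]_xi (lnminus xi * E xi)%R)%:E)%E.
Proof.
rewrite EFin_Rintegral; last exact: (integrable_lnminus_energy oO bO Xu).
rewrite [LHS]integralE; congr (_ - _)%E; apply: eq_integral => xi _.
  by rewrite /= unlock -EFin_max maxC /lnplus maxr_pMl// mul0r.
by rewrite /= unlock -EFinN -EFin_max maxC /lnminus maxr_pMl// mul0r mulNr.
Qed.

Lemma lnplus_energy_ge0 : (0 <= \int[mu]_xi (lnplus xi * E xi)%:E)%E.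
Proof. by apply: integral_ge0 => xi _; rewrite lee_fin; apply: mulr_ge0; [exact: lnplus_ge0|exact: E0]. Qed.

Lemma F0_gtNy : (-oo < F_0 Omega eps u)%E.
Proof.
rewrite /F_0; case: asboolP => _ //.
rewrite integral_lnE; have := lnplus_energy_ge0.
have e2 : 0 < eps ^+ 2 / 2 by move: heps => /andP[e0 e1]; rewrite divr_gt0// exprn_gt0.
case: (integral _ _ _) => [r _|_|//].
  by rewrite -EFinB -EFinM ltNyr.
by rewrite addye// mulry gtr0_sg// mul1e.
Qed.

Lemma Ftilde_lower s : 0 < s -> ((eps ^+ 2 / 2)%:E * (\int[mu]_xi (lnplus xi * E xi)%:E -
  (\int[mu]_xi (lnminus xi * E xi)%R)%:E) + (well_excess Omega eps u / (2 * s))%:E <= Ftilde_s Omega eps s u)%E.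
Proof.
move=> s0; rewrite Ftilde_identity//; apply: leeD => //.
have e2 : 0 < eps ^+ 2 / 2 by move: heps => /andP[e0 e1]; rewrite divr_gt0// exprn_gt0.
apply: lee_wpmul2l; first by rewrite lee_fin ltW.
rewrite -integral_lnE [leLHS]integralE [leRHS]integralE.
have mf : measurable_fun setT (fun xi : V => ln (enorm xi) * E xi).
  by apply: measurable_funM => //; exact: measurable_ln_enorm.
have mg : measurable_fun setT (fun xi : V => log_quotient s xi * E xi).
  by apply: measurable_funM => //; exact: measurable_log_quotient.
have fg xi : ln (enorm xi) * E xi <= log_quotient s xi * E xi.
  by rewrite ler_wpM2r//; have /andP[] := log_quotient_bounds xi s0.
apply: leeB; apply: ge0_le_integral => //.
- exact/measurable_funepos/measurable_EFinP.
- exact/measurable_funepos/measurable_EFinP.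
- move=> xi _; rewrite unlock /= ge_max !le_max lexx orbT andbT lee_fin fg//.
- exact/measurable_funeneg/measurable_EFinP.
- exact/measurable_funeneg/measurable_EFinP.
- by move=> xi _; rewrite unlock /= ge_max !le_max lexx orbT andbT lee_fin lerN2 fg.
Qed.

Lemma Ftilde_gtNy s : 0 < s -> (-oo < Ftilde_s Omega eps s u)%E.
Proof.
move=> s0; apply: lt_le_trans (Ftilde_lower s0); have := lnplus_energy_ge0.
have e2 : 0 < eps ^+ 2 / 2 by move: heps => /andP[e0 e1]; rewrite divr_gt0// exprn_gt0.
case: (integral _ _ _) => [r _|_|//].
  by rewrite -EFinB -EFinM -EFinD ltNyr.
by rewrite addye// mulry gtr0_sg// mul1e addye.
Qed.

End one_function.

Lemma F0_le_liminf (s_ : nat -> R) (u_ : nat -> V -> R) u : (forall k, 0 < s_ k < 1) ->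
  s_ k @[k --> \oo] --> 0 -> (forall k, pointwise_X Omega (u_ k)) -> pointwise_X Omega u ->
  \int[mu]_x `|u_ k x - u x| @[k --> \oo] --> 0 ->
  (F_0 Omega eps u <= limn_einf (fun k => Ftilde_s Omega eps (s_ k) (u_ k)))%E.
Proof.
move=> s01 s0 Xu_ Xu cu; have e2 : 0 < eps ^+ 2 / 2.
  by move: heps => /andP[e0 e1]; rewrite divr_gt0// exprn_gt0.
set c := eps ^+ 2 / 2 in e2.
have sp k : 0 < s_ k by have /andP[] := s01 k.
have Mc := lnminus_energy_cvg oO bO Xu_ Xu cu.
apply: le_limn_einf => r; rewrite /F_0; case: asboolP => [_|n2 _].
- (* the part over low frequencies converges, the other is lower semicontinuous *)
  rewrite integral_lnE// -/c => rlt.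
  set M := (fun k => Rintegral _ _ _) in Mc; set m := Rintegral _ _ _ in Mc rlt.
  (* t stays below the contribution of the high frequencies, and d bounds the
     error on the low ones, with room left above r *)
  have [t rt tl] : exists2 t : R, r < c * (t - m) & (t%:E < \int[mu]_xi (lnplus xi * fourier_energy u xi)%:E)%E.
    have := lnplus_energy_ge0 u; move: rlt; case: (integral _ _ _) => [p|_ _|//].
      rewrite -EFinB -EFinM lte_fin => rp _; exists (p - (c * (p - m) - r) / (2 * c)).
        rewrite (_ : c * _ = (c * (p - m) + r) / 2); [lra|by field; exact: lt0r_neq0].
      by rewrite lte_fin ltrBlDr ltrDl divr_gt0//; lra.
    exists ((r + 1) / c + m); last exact: ltry.
    by rewrite addrK mulrC divfK ?lt0r_neq0//; lra.
  have [d d0 hd] : exists2 d, 0 < d & c * (t - (m + d)) >= r.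
    exists ((c * (t - m) - r) / c); first by rewrite divr_gt0//; lra.
    by rewrite opprD addrA mulrBr [c * (_ / _)]mulrC divfK ?lt0r_neq0//; lra.
  have /lt_limn_einf := lt_le_trans tl (lnplus_energy_liminf oO bO Xu_ Xu cu).
  move/cvgrPdist_le : Mc => /(_ _ d0); apply: filterS2 => k Mk tk.
  apply: le_trans (Ftilde_lower (Xu_ k) (sp k)).
  rewrite -[r%:E]adde0; apply: leeD; last first.
    by rewrite lee_fin divr_ge0 ?well_excess_ge0// mulr_ge0// ltW.
  apply: (@le_trans _ _ (c%:E * (t%:E - (m + d)%:E))%E); first by rewrite -EFinB -EFinM lee_fin.
  apply: lee_wpmul2l; first by rewrite lee_fin ltW.
  apply: leeB; first exact: ltW.
  by rewrite lee_fin; move: Mk; rewrite ler_norml -/(M k) => /andP[h1 h2]; lra.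
- (* a positive limit of the well excesses is divided by s_k -> 0 *)
  have V0 : 0 < well_excess Omega eps u.
    rewrite lt_neqAle well_excess_ge0 andbT eq_sym; apply/eqP => V0; exact: n2 (two_phase_excess0 Xu V0).
  set v := well_excess _ _ _ in V0.
  have v2 : 0 < v / 2 by lra.
  set m := Rintegral _ _ _ in Mc.
  set A := `|r| + c * (`|m| + 1) + 1.
  have A0 : 0 < A by rewrite /A ltr_wpDl// addr_ge0// mulr_ge0 ?(ltW e2)// addr_ge0.
  have sA : 0 < v / 2 / (2 * A) by rewrite divr_gt0// mulr_gt0.
  have /cvgrPdist_le/(_ _ v2) := well_excess_cvg oO bO Xu_ Xu cu heps.
  move/cvgrPdist_le : Mc => /(_ 1 ltr01); move/cvgrPdist_le : s0 => /(_ _ sA).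
  apply: filterS3 => k sk Mk Vk.
  apply: le_trans (Ftilde_lower (Xu_ k) (sp k)).
  set M := Rintegral _ _ _ in Mk; set w := well_excess Omega eps (u_ k) in Vk *.
  have wA : A <= w / (2 * s_ k).
    have s2 : 0 < 2 * s_ k by rewrite mulr_gt0.
    rewrite ler_pdivlMr//; apply: (@le_trans _ _ (v / 2)).
      move: sk; rewrite sub0r normrN gtr0_norm ?sp// ler_pdivlMr ?mulr_gt0//; lra.
    by move: Vk; rewrite -/v ler_norml => /andP[h1 h2]; lra.
  apply: (@le_trans _ _ (c%:E * (0%:E - M%:E) + A%:E)%E); last first.
    apply: leeD; last by rewrite lee_fin.
    apply: lee_wpmul2l; first by rewrite lee_fin ltW.
    by apply: leeB => //; exact: lnplus_energy_ge0.
  rewrite -EFinB -EFinM -EFinD lee_fin sub0r mulrN.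
  have : c * M <= c * (`|m| + 1).
    rewrite ler_wpM2l ?(ltW e2)//; move: Mk; rewrite -/m ler_norml => /andP[h1 h2].
    by have := ler_norm m; lra.
  by have := ler_norm r; rewrite /A; lra.
Qed.

End gamma_liminf.

(** * Regularization inside the domain *)

Section energy_of_sums.
Context {R : realType}.

Lemma sqr_sum_le N (x : 'I_N -> R) : (\sum_i x i) ^+ 2 <= N%:R * \sum_i x i ^+ 2.
Proof.
rewrite expr2 big_distrlr/=.
apply: (@le_trans _ _ (\sum_i \sum_j (x i ^+ 2 / 2 + x j ^+ 2 / 2))).
  apply: ler_sum => i _; apply: ler_sum => j _.
  by have := sqr_ge0 (x i - x j); rewrite sqrrB; lra.
have E (i : 'I_N) : \sum_(j < N) (x i ^+ 2 / 2 + x j ^+ 2 / 2) =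
    N%:R * (x i ^+ 2 / 2) + \sum_(j < N) x j ^+ 2 / 2.
  by rewrite big_split/= sumr_const card_ord mulr_natl.
rewrite (eq_bigr _ (fun i _ => E i)) big_split/= sumr_const card_ord -mulr_sumr -mulr_suml.
by rewrite -[X in _ + X <= _]mulr_natl -mulrDr -splitr.
Qed.

Variable n : nat.
Local Notation V := 'rV[R]_n.
Local Notation mu := (@lebesgue_rV R n).

Lemma Rintegral_eq0 (f : V -> R) : (forall x, f x = 0) -> \int[mu]_x f x = 0.
Proof.
move=> f0; rewrite (_ : f = cst 0); last exact/funext.
by rewrite /Rintegral integral0.
Qed.

Lemma costr_sum (I : Type) (r : seq I) (w : I -> V -> R) xi : (forall i, bcs (w i)) ->
  costr (fun x => \sum_(i <- r) w i x) xi = \sum_(i <- r) costr (w i) xi.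
Proof.
move=> bw; elim: r => [|i r IH].
  by rewrite big_nil; apply: Rintegral_eq0 => x; rewrite big_nil mulr0.
rewrite big_cons -IH /costr -RintegralD//; last 2 first.
- exact/bcs_integrable/bcs_cosM.
- by apply/bcs_integrable/bcs_cosM; exact: bcs_sum.
by apply: eq_Rintegral => x _; rewrite big_cons mulrDr.
Qed.

Lemma sintr_sum (I : Type) (r : seq I) (w : I -> V -> R) xi : (forall i, bcs (w i)) ->
  sintr (fun x => \sum_(i <- r) w i x) xi = \sum_(i <- r) sintr (w i) xi.
Proof.
move=> bw; elim: r => [|i r IH].
  by rewrite big_nil; apply: Rintegral_eq0 => x; rewrite big_nil mulr0.
rewrite big_cons -IH /sintr -RintegralD//; last 2 first.
- exact/bcs_integrable/bcs_sinM.
- by apply/bcs_integrable/bcs_sinM; exact: bcs_sum.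
by apply: eq_Rintegral => x _; rewrite big_cons mulrDr.
Qed.

Lemma energy_sum_le N (w : 'I_N -> V -> R) xi : (forall i, bcs (w i)) ->
  fourier_energy (fun x => \sum_i w i x) xi <= N%:R * \sum_i fourier_energy (w i) xi.
Proof.
move=> bw; rewrite fourier_energyE costr_sum// sintr_sum//.
rewrite [X in _ <= _ * X](eq_bigr _ (fun i _ => fourier_energyE (w i) xi)).
rewrite -mulr_sumr mulrCA; apply: ler_wpM2l; first by rewrite invr_ge0 exprn_ge0// mulr_ge0// pi_ge0.
by rewrite big_split/= mulrDr; apply: lerD; exact: sqr_sum_le.
Qed.

End energy_of_sums.

Section smoothing.
Context {R : realType} {n : nat}.
Local Notation V := 'rV[R]_n.+1.
Local Notation mu := (@lebesgue_rV R n.+1).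
Variable Omega : set V.
Hypotheses (oO : open Omega) (bO : bounded_set Omega).
Variables (N : nat) (eta : 'I_N -> V -> R) (e : 'I_N -> V) (c L : R).
Hypotheses (c0 : 0 < c) (L0 : 0 <= L) (eta0 : forall i x, 0 <= eta i x).
Hypotheses (eta1 : forall x, \sum_i eta i x <= 1) (etaO : forall x, Omega x -> \sum_i eta i x = 1).
Hypothesis etaL : forall i x y, `|eta i x - eta i y| <= L * `|x - y|.
Hypothesis inward : forall i x t h, Omega x -> eta i x != 0 -> 0 < t < c -> `|h| <= c * t ->
  Omega (x + t *: e i + h).
Variables (u : V -> R) (q : R).
Hypotheses (Xu : pointwise_X Omega u) (q01 : 0 <= q < 1) (uq : forall x, `|u x| <= q).

Let bu := bcs_pointwise_X oO bO Xu.
Let v i x := eta i x * u x.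

(** Each piece eta_i u is averaged over cubes shifted along its own inward
    direction. *)
Definition smooth (d : R) (x : V) : R := \sum_i avg d c (e i) (v i) x.

Lemma eta_le1 i x : `|eta i x| <= 1.
Proof.
rewrite ger0_norm//; apply: le_trans (eta1 x); rewrite (bigD1 i)//= lerDl.
exact: sumr_ge0.
Qed.

Lemma measurable_eta i : measurable_fun setT (eta i).
Proof.
apply: continuous_measurable_rV => x A /nbhs_ballP[r /= r0 rA].
have L1 : 0 < L + 1 by rewrite ltr_wpDl.
apply/nbhs_ballP; exists (r / (L + 1)); first by rewrite /= divr_gt0.
move=> y; rewrite -ball_normE /= ltr_pdivlMr// => h; apply: rA.
rewrite -ball_normE /=; apply: le_lt_trans (etaL i x y) _.
by apply: le_lt_trans h; rewrite mulrC ler_wpM2l// lerDl.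
Qed.

Lemma bcs_piece i : bcs (v i).
Proof. exact: (bcsMl bu (measurable_eta i) (eta_le1 i)). Qed.

Lemma sum_piece x : \sum_i v i x = u x.
Proof.
rewrite -mulr_suml; have [Ox|nO] := pselect (Omega x); first by rewrite etaO ?mul1r.
by have [_ _ u0] := Xu; rewrite u0// mulr0.
Qed.

Lemma bcs_smooth d : bcs (smooth d).
Proof. by apply: bcs_sum => i; exact: bcs_avg (bcs_piece i). Qed.

(** If the average at x sees a point y of Omega with eta_i(y) <> 0, then x is
    reached from y by the inward move d e_i, up to an error of norm at most c
    d. *)
Lemma smooth_off d x : 0 < d < c -> ~ Omega x -> smooth d x = 0.
Proof.
move=> /andP[d0 dc] nO; rewrite /smooth big1// => i _.
apply: Rintegral_eq0 => z.
have [z1|/box_eq0 ->] := pselect (cube 1 z); last by rewrite mul0r.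
rewrite /v; have [->|ez] := eqVneq (eta i (x - ashift d c (e i) z)) 0; first by rewrite mul0r mulr0.
have [Oy|nOy] := pselect (Omega (x - ashift d c (e i) z)); last first.
  by have [_ _ ->] := Xu => //; rewrite !mulr0.
case: nO; have := @inward i _ d (d *: (c *: z)) Oy ez.
have -> : x - ashift d c (e i) z + d *: e i + d *: (c *: z) = x.
  by rewrite -addrA -scalerDr subrK.
apply; first by rewrite d0.
rewrite !normrZ (gtr0_norm d0) (gtr0_norm c0) mulrA [d * c]mulrC ler_piMr//.
  by rewrite mulr_ge0// ltW.
exact: rV_norm_le.
Qed.

(** The bound on the increase of the modulus per unit of scale: at scale d the
    weights eta_i seen from x still sum to at most 1 + d * drift. *)
Definition drift : R := L * \sum_i (`|e i| + c).

Lemma drift_ge0 : 0 <= drift.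
Proof. by rewrite mulr_ge0// sumr_ge0// => i _; rewrite addr_ge0// ltW. Qed.

Lemma smooth_bound d x : 0 < d -> `|smooth d x| <= q * (1 + d * drift).
Proof.
move=> d0; apply: le_trans (ler_norm_sum _ _ _) _.
have q0 : 0 <= q by case/andP: q01.
have K i : `|avg d c (e i) (v i) x| <= q * (eta i x + d * (L * (`|e i| + c))).
  rewrite /avg; set K := q * _.
  apply: le_trans (le_normr_Rintegral measurableT (avg_integrable d c (e i) (bcs_piece i) x)) _.
  rewrite -[leRHS](_ : \int[mu]_z (K * box z) = K); last first.
    by rewrite RintegralZl// ?Rintegral_box ?mulr1//; exact: bcs_integrable (@bcs_box R n.+1).
  apply: le_Rintegral => //.
  - exact: integrable_norm (avg_integrable d c (e i) (bcs_piece i) x).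
  - exact: RintegrableZ (bcs_integrable (@bcs_box R n.+1)).
  move=> z _; rewrite normrM (ger0_norm (box_ge0 z)) mulrC.
  have [z1|/box_eq0 ->] := pselect (cube 1 z); last by rewrite !mulr0.
  apply: ler_wpM2r; first exact: box_ge0.
  rewrite normrM mulrC; apply: ler_pM => //.
  rewrite ger0_norm//; set y := x - _.
  have := etaL i x y; rewrite ler_norml => /andP[h _].
  have : `|x - y| <= d * (`|e i| + c).
    rewrite /y opprD addNKr opprK; apply: le_trans (ashift_bound d c (e i) z1) _.
    by rewrite (gtr0_norm d0) (gtr0_norm c0).
  by move/(ler_wpM2l L0); rewrite mulrCA; lra.
apply: le_trans (ler_sum _ (fun i _ => K i)) _.
rewrite -mulr_sumr; apply: ler_wpM2l => //; rewrite big_split/=; apply: lerD => //.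
by rewrite /drift -!mulr_sumr.
Qed.

(** As q < 1, the bound q (1 + d * drift) falls below 1 for small d. *)
Lemma smooth_pointwise_X : exists2 d0 : R, 0 < d0 & forall d, 0 < d < d0 -> pointwise_X Omega (smooth d).
Proof.
have A0 := drift_ge0; have /andP[q0 q1] := q01.
have D : 0 < (1 - q) / (drift + 1) by rewrite divr_gt0//; lra.
exists (Num.min c ((1 - q) / (drift + 1))); first by rewrite lt_min c0.
move=> d /andP[d0]; rewrite lt_min ltr_pdivlMr; last lra.
move=> /andP[dc dq]; split.
- exact: bcs_measurable (bcs_smooth d).
- move=> x; apply: le_trans (smooth_bound x d0) _.
  have : q * (d * drift) <= d * (drift + 1).
    apply: (@le_trans _ _ (1 * (d * drift))); last by rewrite mul1r ler_wpM2l ?(ltW d0)//; lra.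
    by apply: ler_wpM2r; [rewrite mulr_ge0// ltW|exact: ltW].
  by lra.
- by move=> x; apply: smooth_off; rewrite d0.
Qed.

(** Dominates the energy of smooth d - u; with damped, the energy of smooth d. *)
Definition defect (d : R) (xi : V) : R := N%:R * \sum_i
  (((avgc d c (e i) xi - 1) ^+ 2 + avgs d c (e i) xi ^+ 2) * fourier_energy (v i) xi).

Definition damped (d : R) (xi : V) : R := N%:R * \sum_i
  ((avgc d c (e i) xi ^+ 2 + avgs d c (e i) xi ^+ 2) * fourier_energy (v i) xi).

Lemma energy_smooth_le d xi : fourier_energy (smooth d) xi <= damped d xi.
Proof.
apply: le_trans (energy_sum_le xi (fun i => bcs_avg d c (e i) (bcs_piece i))) _.
rewrite /damped; apply: ler_wpM2l => //; apply: ler_sum => i _.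
by rewrite (energy_avg d c (e i) (bcs_piece i)).
Qed.

Lemma energy_smoothB_le d xi : fourier_energy (fun x => smooth d x - u x) xi <= defect d xi.
Proof.
have -> : (fun x => smooth d x - u x) = (fun x => \sum_i (avg d c (e i) (v i) x - v i x)).
  by apply/funext => x; rewrite sumrB sum_piece.
apply: le_trans (energy_sum_le xi (fun i => bcsB (bcs_avg d c (e i) (bcs_piece i)) (bcs_piece i))) _.
rewrite /defect; apply: ler_wpM2l => //; apply: ler_sum => i _.
by rewrite (energy_avgB d c (e i) (bcs_piece i)).
Qed.

End smoothing.

(** * Recovery sequences *)

Section scale_selection.
Context {R : realType}.

(** J k is the largest j <= k whose threshold has been passed at k. *)
Lemma diagonal (P : nat -> nat -> Prop) : (forall j, \forall k \near \oo, P j k) ->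
  exists J : nat -> nat, (forall j, \forall k \near \oo, (j <= J k)%N) /\ \forall k \near \oo, P (J k) k.
Proof.
move=> h; have {h}/choice[N hN] j : exists N, forall k, (N <= k)%N -> P j k.
  by have [N _ hN] := h j; exists N.
pose J k := \max_(j < k.+1 | (N j <= k)%N) (j : nat).
exists J; split => [j|].
  exists (maxn j (N j)) => // k /=; rewrite geq_max => /andP[jk Nk].
  by apply: (@leq_bigmax_cond _ (fun i : 'I_k.+1 => (N i <= k)%N) _ (Ordinal (jk : (j < k.+1)%N))).
exists (N 0) => // k /= Nk.
have C : (0 < #|[pred i : 'I_k.+1 | (N i <= k)%N]|)%N by apply/card_gt0P; exists ord0.
have [i iN E] := @eq_bigmax_cond _ [pred i : 'I_k.+1 | (N i <= k)%N] (fun i => i : nat) C.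
by rewrite /J E; apply: hN.
Qed.

(** At the scale l = 1 / (j s) one has s l = 1/j and D(l)/s = j l D(l), which
    is eventually at most 1/j since l D(l) -> 0; let j grow slowly along the
    sequence. *)
Lemma scale_selection (s_ : nat -> R) (D : R -> R) : (forall k, 0 < s_ k) -> s_ k @[k --> \oo] --> 0 ->
  (forall l, 0 <= D l) ->
  (forall l_ : nat -> R, (forall k, 0 < l_ k) -> l_ k @[k --> \oo] --> +oo ->
     l_ k * D (l_ k) @[k --> \oo] --> 0) ->
  exists l_ : nat -> R, [/\ l_ k @[k --> \oo] --> +oo, s_ k * l_ k @[k --> \oo] --> 0 &
    D (l_ k) / s_ k @[k --> \oo] --> 0].
Proof.
move=> s0 sc D0 Dc; pose l j k := (j.+1%:R * s_ k)^-1.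
have j0 j : 0 < j.+1%:R :> R by [].
have l0 j k : 0 < l j k by rewrite invr_gt0 mulr_gt0.
have loo j : l j k @[k --> \oo] --> +oo.
  apply/gtr0_cvgV0; first exact: nearW.
  rewrite [X in X @ _ --> _](_ : _ = fun k => j.+1%:R * s_ k); last by apply/funext => k; rewrite /= invrK.
  by rewrite -[X in _ --> X](mulr0 j.+1%:R); apply: cvgM => //; exact: cvg_cst.
have [j|J [Joo JP]] := @diagonal (fun j k => j%:R <= l j k /\ D (l j k) / s_ k <= j.+1%:R^-1).
  have e0 : 0 < j.+1%:R^-1 ^+ 2 :> R by rewrite exprn_gt0// invr_gt0.
  have /cvgr0Pnorm_le/(_ _ e0) := Dc _ (l0 j) (loo j).
  have /cvgryPge/(_ j%:R) := loo j; apply: filterS2 => k h1 h2; split => //.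
  apply: (@le_trans _ _ (j.+1%:R * (l j k * D (l j k)))).
    rewrite le_eqVlt; apply/orP; left; apply/eqP; rewrite {2}/l; field.
    by rewrite lt0r_neq0//= addrC natr1 lt0r_neq0.
  rewrite mulrC -ler_pdivlMr// -[X in _ <= X]expr2; apply: le_trans h2; exact: ler_norm.
exists (fun k => l (J k) k); split.
- apply/cvgryPge => A; have := Joo (Num.truncn `|A|).+1; move: JP; apply: filterS2 => k [h _] Jk.
  apply: le_trans h; apply: le_trans (ler_norm A) _; apply: le_trans (ltW (truncnS_gt _)) _.
  by rewrite ler_nat.
- apply/cvgr0Pnorm_le => r r0; have := Joo (Num.truncn r^-1); apply: filterS => k Jk.
  rewrite (_ : s_ k * _ = (J k).+1%:R^-1); last first.
    by rewrite /l invfM mulrCA mulfV ?mulr1// lt0r_neq0.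
  rewrite ger0_norm ?invr_ge0// -[leRHS]invrK lef_pV2 ?posrE ?invr_gt0//.
  by apply: le_trans (ltW (truncnS_gt _)) _; rewrite ler_nat.
- apply/cvgr0Pnorm_le => r r0; have := Joo (Num.truncn r^-1); move: JP; apply: filterS2 => k [_ h] Jk.
  rewrite ger0_norm ?divr_ge0 ?D0 ?(ltW (s0 k))//; apply: le_trans h _.
  rewrite -[leRHS]invrK lef_pV2 ?posrE ?invr_gt0//.
  by apply: le_trans (ltW (truncnS_gt _)) _; rewrite ler_nat.
Qed.

End scale_selection.

Section recovery.
Context {R : realType} {n : nat}.
Local Notation V := 'rV[R]_n.+1.
Local Notation mu := (@lebesgue_rV R n.+1).
Variable Omega : set V.
Hypotheses (oO : open Omega) (bO : bounded_set Omega).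
Variable eps : R.
Hypothesis heps : 0 < eps < 1.
Variables (N : nat) (eta : 'I_N -> V -> R) (e : 'I_N -> V) (c L : R).
Hypotheses (c0 : 0 < c) (L0 : 0 <= L) (eta0 : forall i x, 0 <= eta i x).
Hypotheses (eta1 : forall x, \sum_i eta i x <= 1) (etaO : forall x, Omega x -> \sum_i eta i x = 1).
Hypothesis etaL : forall i x y, `|eta i x - eta i y| <= L * `|x - y|.
Variable u : V -> R.
Hypotheses (Xu : pointwise_X Omega u) (u2 : forall x, Omega x -> u x ^+ 2 = 1 - eps ^+ 2).
Hypothesis lu : log_finite u.

Let bu := bcs_pointwise_X oO bO Xu.
Let v i x := eta i x * u x.
Let bv i : bcs (v i) := bcs_piece oO bO L0 eta0 eta1 etaL Xu i.
Let sm := smooth eta e c u.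
Let bsm d : bcs (sm d) := bcs_smooth oO bO e c L0 eta0 eta1 etaL Xu d.
Let Ev i := fourier_energy (v i).
Let Ev0 i xi : 0 <= Ev i xi. Proof. exact: fourier_energy_ge0. Qed.
Let IEv i : mu.-integrable setT (EFin \o Ev i). Proof. exact: integrable_energy. Qed.
Let mEv i : measurable_fun setT (Ev i). Proof. exact: measurable_fourier_energy. Qed.

Let lv i : log_finite (v i).
Proof.
by apply: (log_finite_mul bu (measurable_eta L0 etaL i) L0 (eta_le1 eta0 eta1 i) (etaL i) lu).
Qed.

Let Isum (I : Type) (r : seq I) (f : I -> V -> R) : (forall i, mu.-integrable setT (EFin \o f i)) ->
  mu.-integrable setT (EFin \o (fun x => \sum_(i <- r) f i x)).
Proof.
move=> If; elim: r => [|i r IH].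
  rewrite (_ : _ \o _ = cst 0%E); first exact: integrable0.
  by apply/funext => x /=; rewrite big_nil.
by under eq_fun do rewrite big_cons; exact: RintegrableD.
Qed.

Let mdefect d : measurable_fun setT (defect eta e c u d).
Proof.
apply: measurable_funM => //; apply: measurable_sum => i.
apply: measurable_funM; last exact: mEv.
by apply: measurable_funD; apply: measurable_funX; [apply: measurable_funB => //; exact: measurable_avgc|exact: measurable_avgs].
Qed.

Lemma defect_ge0 d xi : 0 <= defect eta e c u d xi.
Proof.
apply: mulr_ge0 => //; apply: sumr_ge0 => i _.
by apply: mulr_ge0; [exact: gap_ge0|exact: fourier_energy_ge0].
Qed.

Lemma integrable_defect d : mu.-integrable setT (EFin \o defect eta e c u d).
Proof.
have I5 i : mu.-integrable setT (EFin \o (fun xi => 5 * Ev i xi)) by exact: RintegrableZ.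
apply: (le_Rintegrable (mdefect d) _ (RintegrableZ N%:R (Isum (index_enum 'I_N) I5))) => xi.
rewrite ger0_norm ?defect_ge0//; apply: ler_wpM2l => //; apply: ler_sum => i _.
by apply: ler_wpM2r; [exact: Ev0|exact: gap_le5].
Qed.

Lemma smoothB_sqr_le d : \int[mu]_x ((sm d x - u x) ^+ 2) <= \int[mu]_xi defect eta e c u d xi.
Proof.
have b : bcs (fun x => sm d x - u x) by exact: bcsB.
rewrite -(Rplancherel b); apply: le_Rintegral => //.
- exact: integrable_energy.
- exact: integrable_defect.
- by move=> xi _; exact: (energy_smoothB_le oO bO e c L0 eta0 eta1 etaO etaL Xu).
Qed.

(** (w^2 - u^2)^2 / 4 = (w - u)^2 ((w + u)/2)^2, and u^2 is the square of the
    wells on Omega. *)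
Lemma well_excess_le w : pointwise_X Omega w -> well_excess Omega eps w <= \int[mu]_x ((w x - u x) ^+ 2).
Proof.
move=> Xw; have bw := bcs_pointwise_X oO bO Xw; apply: le_Rintegral => //.
- exact: integrable_well.
- by apply: bcs_integrable; under eq_fun do rewrite expr2; apply: bcsM; exact: bcsB.
move=> x _; rewrite indicE; case: (boolP (x \in Omega)) => [|_]; last by rewrite mul0r sqr_ge0.
rewrite inE mul1r => Ox; rewrite -(u2 Ox).
have [_ w1 _] := Xw; have [_ u1 _] := Xu; move: (w1 x) (u1 x); rewrite !ler_norml.
move: (w x) (u x) => a b /andP[h1 h2] /andP[h3 h4].
have -> : (a ^+ 2 - b ^+ 2) ^+ 2 / 4 = (a - b) ^+ 2 * ((a + b) / 2) ^+ 2 by field.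
rewrite ler_piMr ?sqr_ge0// -real_normK ?num_real// expr_le1// ler_norml.
by apply/andP; split; lra.
Qed.

(** Dominated convergence, the majorant being (1 + ln^+|xi|) times the
    energies of the pieces. *)
Lemma defect_cvg (l_ : nat -> R) : (forall k, 0 < l_ k) -> l_ k @[k --> \oo] --> +oo ->
  l_ k * \int[mu]_xi defect eta e c u (expR (- l_ k)) xi @[k --> \oo] --> 0.
Proof.
move=> l0 loo.
pose g i xi := (10 + gap_const c (e i)) * (Ev i xi + lnplus xi * Ev i xi).
have Ig i : mu.-integrable setT (EFin \o g i).
  by apply: RintegrableZ; apply: RintegrableD => //; exact: lv.
have E : (fun k => l_ k * \int[mu]_xi defect eta e c u (expR (- l_ k)) xi) =
    (fun k => \int[mu]_xi (l_ k * defect eta e c u (expR (- l_ k)) xi)).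
  by apply/funext => k; rewrite RintegralZl//; exact: integrable_defect.
rewrite E -[X in _ --> X](@Rintegral_eq0 R n.+1 (fun=> 0))//.
apply: (@Rdominated_cvg _ _ _ mu (fun k xi => l_ k * defect eta e c u (expR (- l_ k)) xi) (fun=> 0)
  (fun xi => N%:R * \sum_i g i xi) _ _ _ _ _).2.
- by move=> k; apply: measurable_funM.
- exact: measurable_cst.
- apply: aeW => xi.
  pose C := N%:R * \sum_i (gap_const c (e i) * enorm xi ^+ 2 * Ev i xi).
  apply: (@squeeze_cvgr _ _ _ _ (fun=> 0) (fun k => C * (l_ k)^-1)).
  + apply: nearW => k; rewrite mulr_ge0 ?defect_ge0 ?(ltW (l0 k))//=.
    rewrite /C -mulrA mulrCA mulr_suml; apply: ler_wpM2l => //.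
    rewrite mulr_sumr; apply: ler_sum => i _; rewrite mulrA [leRHS]mulrAC.
    by apply: ler_wpM2r; [exact: Ev0|exact: gap_vanish].
  + exact: cvg_cst.
  + rewrite -[X in _ --> X](mulr0 C); apply: cvgM; first exact: cvg_cst.
    by apply/gtr0_cvgV0 => //; exact: nearW.
- by apply: RintegrableZ; exact: Isum.
- move=> k xi; rewrite ger0_norm; last by rewrite mulr_ge0 ?defect_ge0 ?(ltW (l0 k)).
  rewrite mulrCA; apply: ler_wpM2l => //; rewrite mulr_sumr; apply: ler_sum => i _.
  have -> : g i xi = (10 + gap_const c (e i)) * (1 + lnplus xi) * Ev i xi by rewrite /g; ring.
  rewrite mulrA; apply: ler_wpM2r; first exact: Ev0.
  exact: gap_log (ltW (l0 k)).
Qed.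

(** On Omega, of finite measure A, |z| <= t + z^2/t; t is chosen so that t A
    <= r/2. *)
Lemma L1_of_L2 (w_ : nat -> V -> R) : (forall k, pointwise_X Omega (w_ k)) ->
  \int[mu]_x ((w_ k x - u x) ^+ 2) @[k --> \oo] --> 0 ->
  \int[mu]_x `|w_ k x - u x| @[k --> \oo] --> 0.
Proof.
move=> Xw c2; set A := \int[mu]_x \1_Omega x.
have A0 : 0 <= A by exact: Rintegral_ge0.
have IO := bcs_integrable (bcs_indic_Omega oO bO).
apply/cvgr0Pnorm_le => r r0.
pose t := r / (2 * (A + 1)).
have A1 : 0 < 2 * (A + 1) by rewrite mulr_gt0// ltr_wpDl.
have t0 : 0 < t by rewrite divr_gt0.
have rt0 : 0 < t * (r / 2) by rewrite mulr_gt0// divr_gt0.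
move/cvgr0Pnorm_le : c2 => /(_ _ rt0); apply: filterS => k hk.
have bD : bcs (fun x => w_ k x - u x) by apply: bcsB => //; exact: (bcs_pointwise_X oO bO (Xw k)).
have I2 : mu.-integrable setT (EFin \o (fun x => (w_ k x - u x) ^+ 2)).
  by apply: bcs_integrable; under eq_fun do rewrite expr2; exact: bcsM.
rewrite ger0_norm; last by apply: Rintegral_ge0.
apply: (@le_trans _ _ (\int[mu]_x (t * \1_Omega x + t^-1 * (w_ k x - u x) ^+ 2))).
  apply: le_Rintegral => //.
  - exact/bcs_integrable/bcs_norm.
  - by apply: RintegrableD; exact: RintegrableZ.
  move=> x _; rewrite indicE; case: (boolP (x \in Omega)) => [_|/negP xO].
    rewrite mulr1; have z0 := normr_ge0 (w_ k x - u x).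
    rewrite -[(_ - _) ^+ 2]real_normK ?num_real//; move: `|_| z0 => z z0.
    rewrite -(ler_pM2l t0) mulrDr mulVKf ?lt0r_neq0//.
    by have := sqr_ge0 (z - t); have := sqr_ge0 z; have := sqr_ge0 t; rewrite sqrrB; lra.
  have nO : ~ Omega x by move=> Ox; apply: xO; rewrite inE.
  have [_ _ h1] := Xw k; have [_ _ h2] := Xu.
  by rewrite h1// h2// subrr normr0 expr0n/= !mulr0 addr0.
rewrite RintegralD//; [|exact: RintegrableZ..].
rewrite RintegralZl// RintegralZl// -/A.
have h1 : t * A <= r / 2.
  rewrite /t -[leRHS]mulr1 (_ : r / (2 * (A + 1)) * A = r / 2 * (A / (A + 1))); last first.
    by field; rewrite lt0r_neq0// ltr_wpDl.
  by rewrite ler_wpM2l// ?divr_ge0 ?(ltW r0)// ler_pdivrMr ?ltr_wpDl// mul1r lerDl.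
have h2 : t^-1 * \int[mu]_x ((w_ k x - u x) ^+ 2) <= r / 2.
  by rewrite mulrC ler_pdivrMr// mulrC; apply: le_trans hk; exact: ler_norm.
by lra.
Qed.

Lemma log_quotient_le (s : R) (xi : V) : 0 < s ->
  `|log_quotient s xi| <= lnminus xi + lnplus xi * expR (2 * s * ln (enorm xi)).
Proof.
move=> s0; have /andP[] := log_quotient_bounds xi s0; rewrite /lnminus /lnplus.
set l := ln _; set E := expR _; set m := log_quotient _ _ => h1 h2; have E0 : 0 < E := expR_gt0 _.
have [l0|l0] := lerP 0 l.
  by rewrite (max_l (_ : - l <= 0)) ?oppr_le0// add0r ger0_norm// (le_trans l0).
rewrite (max_r (_ : 0 <= - l)) ?oppr_ge0 ?(ltW l0)// mul0r addr0.
rewrite ler0_norm ?lerN2//; apply: le_trans h2 _.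
by rewrite mulr_le0_ge0// ltW.
Qed.

Lemma log_quotient_cvg (s_ : nat -> R) (xi : V) : (forall k, 0 < s_ k) -> s_ k @[k --> \oo] --> 0 ->
  log_quotient (s_ k) xi @[k --> \oo] --> ln (enorm xi).
Proof.
move=> s0 sc; apply: (@squeeze_cvgr _ _ _ _ (fun=> ln (enorm xi))
  (fun k => ln (enorm xi) * expR (2 * s_ k * ln (enorm xi)))).
- by apply: nearW => k; exact: log_quotient_bounds.
- exact: cvg_cst.
- rewrite -[X in _ --> X]mulr1; apply: cvgM; first exact: cvg_cst.
  rewrite -[X in _ --> X]expR0; apply: continuous_cvg; first exact: continuous_expR.
  rewrite -[X in _ --> X](mul0r (ln (enorm xi))); apply: cvgM; last exact: cvg_cst.
  by rewrite -[X in _ --> X](mulr0 2); apply: cvgM => //; exact: cvg_cst.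
Qed.

Section along_a_sequence.
Variables s_ l_ : nat -> R.
Hypotheses (s0 : forall k, 0 < s_ k) (s1 : forall k, s_ k <= 1) (l0 : forall k, 0 < l_ k).
Hypotheses (sl : forall k, s_ k * l_ k <= 1).
Hypotheses (sc : s_ k @[k --> \oo] --> 0).
Let w_ k := sm (expR (- l_ k)).
Hypothesis Xw : forall k, pointwise_X Omega (w_ k).
Hypothesis cw : \int[mu]_x ((w_ k x - u x) ^+ 2) / s_ k @[k --> \oo] --> 0.

Lemma recovery_L2 : \int[mu]_x ((w_ k x - u x) ^+ 2) @[k --> \oo] --> 0.
Proof.
rewrite -[X in _ --> X](mulr0 0).
have -> : (fun k => \int[mu]_x ((w_ k x - u x) ^+ 2)) =
    (fun k => \int[mu]_x ((w_ k x - u x) ^+ 2) / s_ k * s_ k).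
  by apply/funext => k; rewrite divfK// lt0r_neq0.
exact: cvgM.
Qed.

Let K0 := @damp_const R n c.
Let major xi := energy_bound Omega * lnminus xi + K0 * N%:R * \sum_i (lnplus xi * Ev i xi).

Let Imajor : mu.-integrable setT (EFin \o major).
Proof.
apply: RintegrableD; first exact: RintegrableZ (@integrable_lnminus R n).
by apply: RintegrableZ; apply: Isum => i; exact: lv.
Qed.

Let le_major k xi : `|log_quotient (s_ k) xi * fourier_energy (w_ k) xi| <= major xi.
Proof.
have F0 := fourier_energy_ge0 (w_ k) xi.
rewrite normrM [X in _ * X]ger0_norm//.
apply: le_trans (ler_wpM2r F0 (log_quotient_le xi (s0 k))) _; rewrite mulrDl; apply: lerD.
  by rewrite mulrC; apply: ler_wpM2r; [exact: lnminus_ge0|exact: energy_le].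
rewrite -[leLHS]mulrA -mulr_sumr [leRHS]mulrCA; apply: ler_wpM2l; first exact: lnplus_ge0.
apply: le_trans (ler_wpM2l (expR_ge0 _) (energy_smooth_le oO bO e c L0 eta0 eta1 etaL Xu (expR (- l_ k)) xi)) _.
rewrite /damped [leLHS]mulrCA -[leRHS]mulrA [leRHS]mulrCA; apply: ler_wpM2l => //.
rewrite !mulr_sumr; apply: ler_sum => i _; rewrite mulrA; apply: ler_wpM2r; first exact: Ev0.
by apply: damp_exp => //; [exact: ltW|rewrite s0 s1].
Qed.

(** Low frequencies are dominated by a multiple of ln^-|xi|. At high
    frequencies the growth exp(2 s ln|xi|) of the quotient is absorbed by the
    damping of the averages. *)
Lemma recovery_energy :
  (\int[mu]_xi (log_quotient (s_ k) xi * fourier_energy (w_ k) xi)%:E)%E @[k --> \oo] -->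
  (\int[mu]_xi (ln (enorm xi) * fourier_energy u xi)%:E)%E.
Proof.
have bw k := bcs_pointwise_X oO bO (Xw k).
have mf k : measurable_fun setT (fun xi => log_quotient (s_ k) xi * fourier_energy (w_ k) xi).
  by apply: measurable_funM; [exact: measurable_log_quotient|exact: measurable_fourier_energy].
have mg : measurable_fun setT (fun xi => ln (enorm xi) * fourier_energy u xi).
  by apply: measurable_funM; [exact: measurable_ln_enorm|exact: measurable_fourier_energy].
have cv : {ae mu, forall xi, (fun k => log_quotient (s_ k) xi * fourier_energy (w_ k) xi) k @[k --> \oo] -->
    ln (enorm xi) * fourier_energy u xi}.
  apply: aeW => xi; apply: cvgM; first exact: log_quotient_cvg.
  by apply: (energy_cvg oO bO Xw Xu); apply: L1_of_L2 => //; exact: recovery_L2.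
have [Ig cg] := @Rdominated_cvg _ _ _ mu (fun k xi => log_quotient (s_ k) xi * fourier_energy (w_ k) xi)
  _ _ mf mg cv Imajor le_major.
rewrite -(EFin_Rintegral Ig); under eq_fun => k.
  rewrite -(EFin_Rintegral (le_Rintegrable (mf k) (le_major k) Imajor)); over.
by apply: cvg_EFin => //; exact: nearW.
Qed.

Hypothesis tp : two_phase Omega eps u.

Lemma recovery_cvg : Ftilde_s Omega eps (s_ k) (w_ k) @[k --> \oo] --> F_0 Omega eps u.
Proof.
rewrite /F_0 asboolT//; under eq_fun do rewrite (Ftilde_identity oO bO heps (Xw _) (s0 _)).
rewrite -(adde0 ((eps ^+ 2 / 2)%:E * _)%E); apply: cvgeD.
- by rewrite fin_num_adde_defl.
- by apply: cvgeZl => //; exact: recovery_energy.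
apply: cvg_EFin; first exact: nearW.
apply: (@squeeze_cvgr _ _ _ _ (fun=> 0) (fun k => \int[mu]_x ((w_ k x - u x) ^+ 2) / s_ k)) => //.
- apply: nearW => k; have s20 : 0 < 2 * s_ k by rewrite mulr_gt0.
  rewrite /= divr_ge0 ?well_excess_ge0 ?(ltW s20)//=.
  apply: ler_pM; rewrite ?well_excess_ge0 ?invr_ge0 ?(ltW s20)//; first exact: well_excess_le.
  by rewrite lef_pV2 ?posrE// ler_peMl ?(ltW (s0 k))// ler1n.
- exact: cvg_cst.
Qed.

End along_a_sequence.

Let cvg_near_eq (T : topologicalType) (f g : nat -> T) (l : T) :
  (\forall k \near \oo, f k = g k) -> f k @[k --> \oo] --> l -> g k @[k --> \oo] --> l.
Proof. by move=> fg; apply: cvg_trans; exact: near_eq_cvg. Qed.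

(** The scale d = exp(-l) is the one of scale_selection; the values of V are
    controlled by the integral of the defect. *)
Lemma recovery_sequence (s_ : nat -> R) : (forall k, 0 < s_ k < 1) -> s_ k @[k --> \oo] --> 0 ->
  (exists2 d0 : R, 0 < d0 & forall d, 0 < d < d0 -> pointwise_X Omega (sm d)) ->
  two_phase Omega eps u ->
  exists u_ : nat -> V -> R, [/\ forall k, pointwise_X Omega (u_ k),
    \int[mu]_x `|u_ k x - u x| @[k --> \oo] --> 0 &
    Ftilde_s Omega eps (s_ k) (u_ k) @[k --> \oo] --> F_0 Omega eps u].
Proof.
move=> s01 sc [d0 d00 Xd] tp.
have sp k : 0 < s_ k by have /andP[] := s01 k.
have s1 k : s_ k <= 1 by have /andP[_ /ltW] := s01 k.
pose D l := \int[mu]_xi defect eta e c u (expR (- l)) xi.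
have D0 l : 0 <= D l by apply: Rintegral_ge0 => xi _; exact: defect_ge0.
have [l_ [loo sl Dl]] := scale_selection sp sc D0 defect_cvg.
pose good k := (d0^-1 <= l_ k) && (s_ k * l_ k <= 1).
have goodoo : \forall k \near \oo, good k.
  move/cvgr0Pnorm_le : sl => /(_ 1 ltr01); move/cvgryPge : loo => /(_ d0^-1).
  apply: filterS2 => k h1 h2; rewrite /good h1/=; apply: le_trans h2; exact: ler_norm.
have id0 : 0 < d0^-1 by rewrite invr_gt0.
(* away from good indices any admissible pair of parameters will do; l >= 1/d0
   makes exp(-l) smaller than d0 *)
pose l k := if good k then l_ k else d0^-1.
pose s k := if good k then s_ k else (d0^-1 + 1)^-1.
have eql : \forall k \near \oo, l_ k = l k by move: goodoo; apply: filterS => k; rewrite /l => ->.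
have eqs : \forall k \near \oo, s_ k = s k by move: goodoo; apply: filterS => k; rewrite /s => ->.
have ld k : d0^-1 <= l k by rewrite /l; case: ifP => // /andP[].
have l0 k : 0 < l k by exact: lt_le_trans (ld k).
have s0' k : 0 < s k by rewrite /s; case: ifP => // _; rewrite invr_gt0; lra.
have s1' k : s k <= 1.
  by rewrite /s; case: ifP => // _; rewrite invf_le1; lra.
have sl' k : s k * l k <= 1.
  rewrite /s /l; case: ifP => [/andP[_]//|_].
  by rewrite mulrC ler_pdivrMr; lra.
have Xw k : pointwise_X Omega (sm (expR (- l k))).
  apply: Xd; rewrite expR_gt0/= expRN -[ltRHS]invrK ltf_pV2 ?posrE ?expR_gt0//.
  by apply: le_lt_trans (ld k) _; have := expR_ge1Dx (l k); lra.
have sc' : s k @[k --> \oo] --> 0 by exact: cvg_near_eq sc.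
have cw : \int[mu]_x ((sm (expR (- l k)) x - u x) ^+ 2) / s k @[k --> \oo] --> 0.
  apply: (@squeeze_cvgr _ _ _ _ (fun=> 0) (fun k => D (l k) / s k)).
  - apply: nearW => k; rewrite divr_ge0 ?(ltW (s0' k))//=; last by apply: Rintegral_ge0 => x _; exact: sqr_ge0.
    by rewrite ler_wpM2r ?invr_ge0 ?(ltW (s0' k))//; exact: smoothB_sqr_le.
  - exact: cvg_cst.
  - apply: cvg_near_eq Dl; move: eql eqs; apply: filterS2 => k -> ->//.
exists (fun k => sm (expR (- l k))); split => //.
  by apply: L1_of_L2 => //; exact: recovery_L2 cw.
have := recovery_cvg s0' s1' l0 sl' sc' Xw cw tp; apply: cvg_near_eq.
by move: eqs; apply: filterS => k ->.
Qed.

End recovery.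

(** * Gamma-convergence *)

Section gamma_convergence.
Context {R : realType} {n : nat}.
Local Notation V := 'rV[R]_n.+1.
Local Notation mu := (@lebesgue_rV R n.+1).
Variable Omega : set V.
Hypothesis hOmega : bounded_lipschitz_domain Omega.
Variable eps : R.
Hypothesis heps : 0 < eps < 1.

Let oO : open Omega. Proof. by case: hOmega. Qed.
Let bO : bounded_set Omega. Proof. by case: hOmega. Qed.
Let lO : lipschitz_boundary Omega. Proof. by case: hOmega. Qed.

Lemma L1_cvg_ae (u_ w_ : nat -> V -> R) (u w : V -> R) :
  (forall k, measurable_fun setT (u_ k)) -> (forall k, measurable_fun setT (w_ k)) ->
  measurable_fun setT u -> measurable_fun setT w ->
  (forall k, {ae mu, forall x, u_ k x = w_ k x}) -> {ae mu, forall x, u x = w x} ->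
  L1_cvg Omega u_ u -> L1_cvg Omega w_ w.
Proof.
move=> mu_ mw_ mu1 mw1 uw_ uw; rewrite /L1_cvg.
have E k : (\int[mu]_(x in Omega) `|u_ k x - u x|%:E = \int[mu]_(x in Omega) `|w_ k x - w x|%:E)%E.
  apply: ae_eq_integral.
  - exact: measurable_Omega.
  - by apply/measurable_EFinP/measurable_funTS/measurableT_comp => //; exact: measurable_funB.
  - by apply/measurable_EFinP/measurable_funTS/measurableT_comp => //; exact: measurable_funB.
  - by move: uw (uw_ k); apply: filterS2 => x /= -> ->.
by under eq_fun do rewrite E.
Qed.

Definition phase_rep (E : set V) (x : V) : R := Num.sqrt (1 - eps ^+ 2) * (\1_E x - \1_(Omega `\` E) x).

Let q2 : 0 < 1 - eps ^+ 2 < 1.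
Proof. by move: heps => /andP[e0 e1]; apply/andP; split; nra. Qed.

Section phase.
Variable E : set V.
Hypotheses (mE : measurable E) (EO : E `<=` Omega).
Let w := phase_rep E.

Lemma phase_rep_sqr x : Omega x -> w x ^+ 2 = 1 - eps ^+ 2.
Proof.
move=> Ox; rewrite /w /phase_rep exprMn sqr_sqrtr; last by case/andP: q2 => /ltW.
rewrite !indicE in_setD (mem_set Ox); case: (x \in E) => /=.
  by rewrite subr0 expr1n mulr1.
by rewrite sub0r sqrrN expr1n mulr1.
Qed.

Lemma phase_rep_off x : ~ Omega x -> w x = 0.
Proof.
move=> nO; rewrite /w /phase_rep !indicE in_setD (memNset nO) memNset ?subrr ?mulr0//.
by move=> /EO.
Qed.

Lemma phase_rep_le x : `|w x| <= Num.sqrt (1 - eps ^+ 2).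
Proof.
have [Ox|nO] := pselect (Omega x); last by rewrite phase_rep_off// normr0 sqrtr_ge0.
by rewrite -(phase_rep_sqr Ox) sqrtr_sqr.
Qed.

Lemma sqrt_wells : 0 <= Num.sqrt (1 - eps ^+ 2) < 1.
Proof. by rewrite sqrtr_ge0/= -[ltRHS]sqrtr1 ltr_sqrt// ; case/andP: q2. Qed.

Lemma phase_rep_pointwise_X : pointwise_X Omega w.
Proof.
split; [|move=> x; apply: le_trans (phase_rep_le x) _|exact: phase_rep_off].
  apply: measurable_funM => //; apply: measurable_funB; first exact: measurable_indic.
  by apply: measurable_indic; apply: measurableD => //; exact: measurable_Omega.
by case/andP: sqrt_wells => _ /ltW.
Qed.

End phase.

(** The negative part of the logarithm contributes a finite amount, so a
    finite F_0 bounds the positive part. *)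
Lemma log_finite_F0 u : pointwise_X Omega u -> two_phase Omega eps u -> F_0 Omega eps u != +oo%E -> log_finite u.
Proof.
move=> Xu tp; rewrite /F_0 asboolT// (integral_lnE oO bO)// => F.
have bu := bcs_pointwise_X oO bO Xu.
apply/integrableP; split.
  by apply/measurable_EFinP/measurable_funM; [exact: measurable_lnplus|exact: measurable_fourier_energy].
have -> : (\int[mu]_xi `|(EFin \o (fun xi : V => (lnplus xi * fourier_energy u xi)%R)) xi| =
    \int[mu]_xi (lnplus xi * fourier_energy u xi)%:E)%E.
  apply: eq_integral => xi _; rewrite /= ger0_norm//.
  by apply: mulr_ge0; [exact: lnplus_ge0|exact: fourier_energy_ge0].
have e2 : 0 < eps ^+ 2 / 2 by move: heps => /andP[e0 e1]; rewrite divr_gt0// exprn_gt0.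
rewrite ltey; apply: contra F => /eqP ->.
by rewrite addye// mulry gtr0_sg// mul1e.
Qed.

(** Constant sequences do when F_0 u = +oo. Otherwise u is replaced by the
    representative that takes the values of the wells everywhere on Omega. *)
Lemma gamma_limsup (s_ : nat -> R) u : (forall k, 0 < s_ k < 1) -> s_ k @[k --> \oo] --> 0 ->
  space_X Omega u -> exists u_ : nat -> V -> R, [/\ forall k, space_X Omega (u_ k),
    L1_cvg Omega u_ u & (limn_esup (fun k => Ftilde_s Omega eps (s_ k) (u_ k)) <= F_0 Omega eps u)%E].
Proof.
move=> s01 sc Xu; have [mu1 _ _] := Xu.
have [F|F] := eqVneq (F_0 Omega eps u) +oo%E.
  exists (fun=> u); split => //; last by rewrite F leey.
  rewrite /L1_cvg; under eq_fun do under eq_integral do rewrite subrr normr0.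
  by under eq_fun do rewrite integral0; exact: cvg_cst.
have [tp|ntp] := pselect (two_phase Omega eps u); last by move: F; rewrite /F_0 asboolF ?eqxx.
have [E [mE EO uw]] := tp; pose w := phase_rep E.
have Xw : pointwise_X Omega w by exact: phase_rep_pointwise_X.
have mw : measurable_fun setT w by case: Xw.
have uw' : {ae mu, forall x, u x = w x} := uw.
have tpw : two_phase Omega eps w by exact: (two_phase_ae uw' tp).
have FE : F_0 Omega eps u = F_0 Omega eps w by exact: F0_ae.
rewrite FE in F *.
have lw := log_finite_F0 Xw tpw F.
have [N [eta [e [c [L [[c0 L0] eta0 [eta1 etaO] etaL inw]]]]]] := inward_partition oO bO lO.
have XS := smooth_pointwise_X oO bO c0 L0 eta0 eta1 etaL inw Xw sqrt_wells (phase_rep_le EO).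
have [u_ [Xu_ cu Fc]] := recovery_sequence oO bO heps c0 L0 eta0 eta1 etaO etaL Xw (phase_rep_sqr E) lw s01 sc XS tpw.
exists u_; split.
- by move=> k; exact: pointwise_X_space_X.
- have mu_ k : measurable_fun setT (u_ k) by case: (Xu_ k).
  have uu k : {ae mu, forall x, u_ k x = u_ k x} by exact: aeW.
  have wu : {ae mu, forall x, w x = u x} by move: uw'; apply: filterS => x ->.
  exact: (L1_cvg_ae mu_ mu_ mw mu1 uu wu ((L1_cvgE oO bO Xu_ Xw).2 cu)).
- by rewrite (cvg_limn_einf_sup Fc).2.
Qed.

Lemma gamma_liminf (s_ : nat -> R) (u_ : nat -> V -> R) u : (forall k, 0 < s_ k < 1) ->
  s_ k @[k --> \oo] --> 0 -> (forall k, space_X Omega (u_ k)) -> space_X Omega u ->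
  L1_cvg Omega u_ u -> (F_0 Omega eps u <= limn_einf (fun k => Ftilde_s Omega eps (s_ k) (u_ k)))%E.
Proof.
move=> s01 sc Xu_ Xu cu.
have Xr_ k := pointwise_X_rep oO (Xu_ k); have Xr := pointwise_X_rep oO Xu.
have m_ k : measurable_fun setT (u_ k) by case: (Xu_ k).
have m : measurable_fun setT u by case: Xu.
have mr_ k : measurable_fun setT (rep Omega (u_ k)) by case: (Xr_ k).
have mr : measurable_fun setT (rep Omega u) by case: Xr.
have a_ k := ae_rep (Xu_ k); have a := ae_rep Xu.
rewrite (@F0_ae _ _ Omega eps _ _ m mr a); under eq_fun do rewrite (Ftilde_ae oO (m_ _) (mr_ _) (a_ _)).
apply: (F0_le_liminf oO bO heps s01 sc Xr_ Xr).
by apply/(L1_cvgE oO bO Xr_ Xr); apply: (L1_cvg_ae m_ mr_ m mr a_ a cu).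
Qed.

End gamma_convergence.

Theorem theorem6p1 (R : realType) (n : nat) (Omega : set 'rV[R]_n.+1) (eps : R)
    (hOmega : bounded_lipschitz_domain Omega) (heps : 0 < eps < 1) :
  [/\ forall (s : R) (u : 'rV[R]_n.+1 -> R), 0 < s < 1 -> space_X Omega u ->
        (-oo < Ftilde_s Omega eps s u)%E,
      forall u : 'rV[R]_n.+1 -> R, space_X Omega u ->
        (-oo < F_0 Omega eps u)%E &
      forall s_ : nat -> R, (forall k, 0 < s_ k < 1) ->
        s_ k @[k --> \oo] --> 0 ->
        Gamma_cvg (space_X Omega) (L1_cvg Omega)
          (fun k => Ftilde_s Omega eps (s_ k)) (F_0 Omega eps)].
Proof.
have [_ oO _ bO _] := hOmega.
have R_ u (Xu : space_X Omega u) : measurable_fun setT u /\ measurable_fun setT (rep Omega u).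
  by split; [case: Xu|case: (pointwise_X_rep oO Xu)].
split.
- move=> s u /andP[s0 _] Xu; have [m mr] := R_ _ Xu.
  by rewrite (Ftilde_ae oO m mr (ae_rep Xu)); apply: Ftilde_gtNy => //; exact: pointwise_X_rep.
- move=> u Xu; have [m mr] := R_ _ Xu.
  by rewrite (@F0_ae _ _ Omega eps _ _ m mr (ae_rep Xu)); apply: F0_gtNy => //; exact: pointwise_X_rep.
- move=> s_ s01 sc; split; first by move=> u_ u; exact: gamma_liminf.
  by move=> u; exact: gamma_limsup.
Qed.
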